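(* The map $\Psi$ restricts to a bijection from $\mathcal{T}^b$ to $\mathcal{C}^b$; consequently, for every $w\in S_+$, $\Psi$ restricts to a bijection from $\mathcal{T}^b_w$ to $\mathcal{C}^b_w$.
   Context: Tableaux are in English convention on Young diagrams; $T(r,c)$ is the entry at row $r$, column $c$; $T_j$ is the set of entries in column $j$. An increasing tableau has positive integer entries strictly increasing along rows and columns. A reverse set-valued tableau (RSVT) is a filling with nonempty finite subsets of $\mathbb{Z}_{>0}$ with $\min Q(r,c)\ge\max Q(r,c+1)$ and $\min Q(r,c)>\max Q(r+1,c)$; $L(Q)$ keeps the maximum of each cell. For finite $S,T\subseteq\mathbb{Z}_{>0}$: $T\triangleleft S$ is obtained by going through $S$ from largest to smallest, each $s$ picking the largest unpicked element of $T$ less than $s$ (if any), and taking the picked set; $T\trianglerighteq S$ is obtained by going through $S$ from smallest to largest, each $s$ picking the smallest unpicked $t\in T$ with $t\ge s$. For an increasing tableau $P$, $K_-(P)$ is the tableau of the same shape whose column $j$ is $P_1\triangleleft(P_2\triangleleft(\cdots\triangleleft P_j))$ sorted increasingly; for an RSVT $Q$, $K_-(L(Q))$ is the tableau of the same shape whose column $j$ is $L(Q)_1\trianglerighteq(L(Q)_2\trianglerighteq(\cdots\trianglerighteq L(Q)_j))$ sorted increasingly. $\mathcal{T}$ is the set of pairs $(P,Q)$ with $P$ increasing, $Q$ an RSVT, same shape; $\mathcal{T}^b=\{(P,Q)\in\mathcal{T}:K_-(P)\ge K_-(L(Q))\text{ entrywise}\}$. The reading word $\mathrm{word}(P)$ reads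 columns left to right, each bottom to top; $\mathrm{rev}$ reverses a word. Hecke words: $\equiv_H$ is generated by $ii\equiv i$, $i(i+1)i\equiv(i+1)i(i+1)$, $ij\equiv ji$ ($|i-j|\ge2$); $[a]_H=w\in S_+$ means $a\equiv_H$ a reduced word of $w$. $\mathcal{T}_w=\{(P,Q)\in\mathcal{T}:[\mathrm{rev}(\mathrm{word}(P))]_H=w\}$, $\mathcal{T}^b_w=\mathcal{T}^b\cap\mathcal{T}_w$. A compatible pair $(a,i)$ consists of words of equal length with $i$ weakly increasing and $i_j=i_{j+1}\Rightarrow a_j>a_{j+1}$; $\mathcal{C}$ is the set of compatible pairs, $\mathcal{C}^b$ those with $i_j\le a_j$ for all $j$, $\mathcal{C}_w$ (resp. $\mathcal{C}^b_w$) those in $\mathcal{C}$ (resp. $\mathcal{C}^b$) with $[a]_H=w$. Reverse row insertion. For a tableau $P$, $P_{r\downarrow}$ is $P$ with its first $r-1$ rows deleted. A value $x$ is ejectable in $P$ if $x$ is in the first row of $P$ and either $x+1$ is not in the first row, or $x+1$ is in the first row and is ejectable in $P_{2\downarrow}$. A cell $(r,c)$ is outer if neither $(r+1,c)$ nor $(r,c+1)$ is a cell. The bumping path of $(r,c)$ in $P$ is $(r,c_r),\dots,(1,c_1)$ with $c_r=c$ and $c_i$ the largest index with $P(i,c_i)<P(i+1,c_{i+1})$; set $m_i=P(i,c_i)$. Input: increasing $P$, outer cell $(r,c)$, $\alpha\in\{0,1\}$; output $(P',m)$ with $m=m_1$. Start with $P'=P$. If $\alpha=1$, delete cell $(r,c)$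 from $P'$ and set $\alpha_r=1$, $i=r-1$; if $\alpha=0$ set $m_{r+1}=\infty$, $\alpha_{r+1}=0$, $i=r$. While $i\ge1$, let $R$ be the set of entries in row $i$ of $P$: (D) if $m_i+1\in R$, leave row $i$, set $\alpha_i=\alpha_{i+1}$; (DR) else if $\alpha_{i+1}=1$ and $m_{i+1}\notin R$, replace $m_i$ by $m_{i+1}$ in row $i$ of $P'$, $\alpha_i=1$; otherwise let $x$ be the largest value ejectable in the current $P'_{(i+1)\downarrow}$ with $m_i<x<m_{i+1}$: (IR) if it exists, replace $m_i$ by $x$ in row $i$ of $P'$, $\alpha_i=1$; (NR) if not, leave row $i$, $\alpha_i=0$. Then decrease $i$ by one. At $i=0$ output $P'$. The map $\Psi:\mathcal{T}\to\mathcal{C}$: $\Psi$ of a pair of empty tableaux is the pair of empty words. Otherwise let $q=\min$ of all entries of $Q$ and $(r,c)$ the rightmost cell with $q\in Q(r,c)$. If $Q(r,c)=\{q\}$, delete that cell to get $Q'$ and reverse-insert $(P,(r,c),1)$; otherwise remove $q$ from $Q(r,c)$ to get $Q'$ and reverse-insert $(P,(r,c),0)$; let $(P',m)$ be the output. With $(a',i')=\Psi(P',Q')$, set $\Psi(P,Q)=(m\,a',\,q\,i')$ (concatenation). It is known that $\Psi$ is a bijection $\mathcal{T}\to\mathcal{C}$ mapping $\mathcal{T}_w$ onto $\mathcal{C}_w$. *)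

(* Defs.v *)
From mathcomp Require Import all_boot.
From Stdlib Require Import Relations.
Set Implicit Arguments. Unset Strict Implicit. Unset Printing Implicit Defensive.

(* Conventions: a tableau is the list of its rows, top *)
(* to bottom (English convention), each row listed left to right.     *)
(* Rows and columns are 0-indexed in the code (row r here = row r+1   *)
(* of the paper).  A finite set of positive integers (a cell of an    *)
(* RSVT) is represented canonically as a strictly increasing list.    *)

Definition tab := seq (seq nat).
Definition rsvt := seq (seq (seq nat)).

Definition row {A} (X : seq (seq A)) i : seq A := nth [::] X i.
Definition entry (P : tab) i j : nat := nth 0 (row P i) j.
Definition set_entry (P : tab) i j x : tab := set_nth [::] P i (set_nth 0 (row P i) j x).

Definition shape {A} (X : seq (seq A)) : seq nat := map size X.
Definition is_shape (sh : seq nat) : bool := all (fun n => 0 < n) sh && sorted geq sh.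

Definition cells {A} (X : seq (seq A)) : seq (nat * nat) :=
  flatten [seq [seq (r, c) | c <- iota 0 (size (row X r))] | r <- iota 0 (size X)].

Definition increasing (P : tab) : bool :=
  is_shape (shape P)
  && all (fun rc => 0 < entry P rc.1 rc.2) (cells P)
  && all (fun rc => (rc.2.+1 < size (row P rc.1)) ==> (entry P rc.1 rc.2 < entry P rc.1 rc.2.+1)) (cells P)
  && all (fun rc => (rc.2 < size (row P rc.1.+1)) ==> (entry P rc.1 rc.2 < entry P rc.1.+1 rc.2)) (cells P).

Definition seqmax (s : seq nat) : nat := \max_(x <- s) x.
Definition seqmin (s : seq nat) : nat := foldr minn (head 0 s) s.

Definition qcell (Q : rsvt) i j : seq nat := nth [::] (row Q i) j.

Definition is_rsvt (Q : rsvt) : bool :=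
  is_shape (shape Q)
  && all (fun rc => let s := qcell Q rc.1 rc.2 in
                    [&& s != [::], sorted ltn s & all (fun x => 0 < x) s]) (cells Q)
  && all (fun rc => (rc.2.+1 < size (row Q rc.1)) ==>
             (seqmin (qcell Q rc.1 rc.2) >= seqmax (qcell Q rc.1 rc.2.+1))) (cells Q)
  && all (fun rc => (rc.2 < size (row Q rc.1.+1)) ==>
             (seqmin (qcell Q rc.1 rc.2) > seqmax (qcell Q rc.1.+1 rc.2))) (cells Q).

Definition LQ (Q : rsvt) : tab := map (map seqmax) Q.

Definition col (P : tab) j : seq nat := [seq nth 0 R j | R <- P & j < size R].

Fixpoint pick_lt (avail ss : seq nat) : seq nat :=
  match ss with
  | [::] => [::]
  | s :: ss' =>
    let cands := [seq t <- avail | t < s] in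
    if cands is [::] then pick_lt avail ss'
    else let t := seqmax cands in t :: pick_lt (rem t avail) ss'
  end.
Definition tri_lt (T S : seq nat) : seq nat := sort leq (pick_lt T (rev (sort leq S))).

Fixpoint pick_ge (avail ss : seq nat) : seq nat :=
  match ss with
  | [::] => [::]
  | s :: ss' =>
    let cands := [seq t <- avail | s <= t] in
    if cands is [::] then pick_ge avail ss'
    else let t := seqmin cands in t :: pick_ge (rem t avail) ss'
  end.
Definition tri_ge (T S : seq nat) : seq nat := sort leq (pick_ge T (sort leq S)).

Fixpoint nest (op : seq nat -> seq nat -> seq nat) (cs : seq (seq nat)) : seq nat :=
  match cs with
  | [::] => [::]
  | x :: xs => if xs is [::] then x else op x (nest op xs)
  end.

Definition Kcol (op : seq nat -> seq nat -> seq nat) (P : tab) j : seq nat :=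
  sort leq (nest op [seq col P k | k <- iota 0 j.+1]).

Definition inT (t : tab * rsvt) : Prop :=
  increasing t.1 /\ is_rsvt t.2 /\ shape t.1 = shape t.2.

Definition K_dominates (P : tab) (Q : rsvt) : Prop :=
  forall rc, rc \in cells P ->
    nth 0 (Kcol tri_ge (LQ Q) rc.2) rc.1 <= nth 0 (Kcol tri_lt P rc.2) rc.1.

Definition inTb (t : tab * rsvt) : Prop := inT t /\ K_dominates t.1 t.2.

Definition word (P : tab) : seq nat :=
  flatten [seq rev (col P j) | j <- iota 0 (size (row P 0))].

Inductive hecke_move : seq nat -> seq nat -> Prop :=
  | hm_idem x y i : hecke_move (x ++ [:: i; i] ++ y) (x ++ [:: i] ++ y)
  | hm_braid x y i : hecke_move (x ++ [:: i; i.+1; i] ++ y) (x ++ [:: i.+1; i; i.+1] ++ y)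
  | hm_comm x y i j : (i.+1 < j) || (j.+1 < i) ->
      hecke_move (x ++ [:: i; j] ++ y) (x ++ [:: j; i] ++ y).

Definition hecke_eq : seq nat -> seq nat -> Prop := clos_refl_sym_trans _ hecke_move.

(* S_+ : permutations of Z_{>0} fixing all but finitely many elements,
   represented as functions nat -> nat (values at 0 irrelevant) *)
Definition in_Splus (w : nat -> nat) : Prop :=
  (forall n, 0 < n -> 0 < w n)
  /\ (forall n m, 0 < n -> 0 < m -> w n = w m -> n = m)
  /\ (forall m, 0 < m -> exists2 n, 0 < n & w n = m)
  /\ (exists N, forall n, N <= n -> w n = n).

Definition s_tr (i n : nat) : nat := if n == i then i.+1 else if n == i.+1 then i else n.

Definition word_perm (a : seq nat) : nat -> nat := foldr (fun i f => s_tr i \o f) id a.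

Definition same_perm (f g : nat -> nat) : Prop := forall n, 0 < n -> f n = g n.

Definition reduced_word_of (r : seq nat) (w : nat -> nat) : Prop :=
  all (fun i => 0 < i) r /\ same_perm (word_perm r) w /\
  forall b, all (fun i => 0 < i) b -> same_perm (word_perm b) w -> size r <= size b.

Definition hecke_class (a : seq nat) (w : nat -> nat) : Prop :=
  exists r, reduced_word_of r w /\ hecke_eq a r.

Definition inTw (w : nat -> nat) (t : tab * rsvt) : Prop := inT t /\ hecke_class (rev (word t.1)) w.
Definition inTbw (w : nat -> nat) (t : tab * rsvt) : Prop := inTb t /\ hecke_class (rev (word t.1)) w.

Definition compatible (c : seq nat * seq nat) : Prop :=
  let: (a, i) := c in
  [/\ size a = size i, all (fun x => 0 < x) a, all (fun x => 0 < x) i,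
      sorted leq i &
      forall j, j.+1 < size i -> nth 0 i j = nth 0 i j.+1 -> nth 0 a j.+1 < nth 0 a j].

Definition inC (c : seq nat * seq nat) : Prop := compatible c.
Definition inCb (c : seq nat * seq nat) : Prop :=
  compatible c /\ forall j, j < size c.1 -> nth 0 c.2 j <= nth 0 c.1 j.
Definition inCbw (w : nat -> nat) (c : seq nat * seq nat) : Prop := inCb c /\ hecke_class c.1 w.

Fixpoint ejectable (P : tab) (x : nat) : bool :=
  match P with
  | [::] => false
  | R :: P' => (x \in R) && ((x.+1 \notin R) || ejectable P' x.+1)
  end.

(* c_i: largest index in row i (of P) with entry < v *)
Definition bump_col (P : tab) i v : nat := (count (fun y => y < v) (row P i)).-1.

Definition max_ejectable (P' : tab) i (lo : nat) (hi : option nat) : option nat :=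
  let cands := [seq x <- row P' i.+1 |
                 [&& lo < x, (if hi is Some h then x < h else true) & ejectable (drop i.+1 P') x]] in
  if cands is [::] then None else Some (seqmax cands).

(* treat row i, with c_i = ci, m_{i+1} = mnext (None = infinity), alpha_{i+1} = anext *)
Definition rri_step (P P' : tab) i ci (mnext : option nat) (anext : bool) : tab * bool :=
  let mi := entry P i ci in
  let R := row P i in
  if mi.+1 \in R then (P', anext)
  else
    let dr := if anext then (if mnext is Some m then (if m \notin R then Some m else None) else None)
              else None in
    if dr is Some m then (set_entry P' i ci m, true)
    else if max_ejectable P' i mi mnext is Some x then (set_entry P' i ci x, true)
    else (P', false).

Fixpoint rri_loop (P P' : tab) i ci (mnext : option nat) (anext : bool) {struct i} : tab :=
  let: (P'', ai) := rri_step P P' i ci mnext anext in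
  let mi := entry P i ci in
  match i with
  | 0 => P''
  | i'.+1 => rri_loop P P'' i' (bump_col P i' mi) (Some mi) ai
  end.

Fixpoint path_top (P : tab) i ci : nat :=
  match i with
  | 0 => entry P 0 ci
  | i'.+1 => path_top P i' (bump_col P i' (entry P i ci))
  end.

(* delete the (outer) cell (r,c), removing the row if it becomes empty *)
Definition delete_cell {A} (X : seq (seq A)) r c : seq (seq A) :=
  [seq R <- set_nth [::] X r (take c (row X r)) | size R != 0].

Definition rev_insert (P : tab) r c (alpha : bool) : tab * nat :=
  let m := path_top P r c in
  if alpha then
    let P0 := delete_cell P r c in
    if r is r'.+1 then (rri_loop P P0 r' (bump_col P r' (entry P r c)) (Some (entry P r c)) true, m)
    else (P0, m)
  else (rri_loop P P r c None false, m).

Definition qentries (Q : rsvt) : seq nat := flatten (flatten Q).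

Definition cells_with (Q : rsvt) q : seq (nat * nat) :=
  [seq rc <- cells Q | q \in qcell Q rc.1 rc.2].

Definition rightmost (l : seq (nat * nat)) : nat * nat :=
  foldl (fun best rc => if best.2 < rc.2 then rc else best) (head (0, 0) l) l.

Fixpoint psi_fuel (n : nat) (P : tab) (Q : rsvt) : seq nat * seq nat :=
  match n with
  | 0 => ([::], [::])
  | n'.+1 =>
    if qentries Q is [::] then ([::], [::]) else
    let q := seqmin (qentries Q) in
    let rc := rightmost (cells_with Q q) in
    let s := qcell Q rc.1 rc.2 in
    let alpha := s == [:: q] in
    let Q' := if alpha then delete_cell Q rc.1 rc.2
              else set_nth [::] Q rc.1 (set_nth [::] (row Q rc.1) rc.2 (rem q s)) in
    let: (P', m) := rev_insert P rc.1 rc.2 alpha in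
    let: (a', i') := psi_fuel n' P' Q' in
    (m :: a', q :: i')
  end.

Definition Psi (t : tab * rsvt) : seq nat * seq nat :=
  psi_fuel (size (qentries t.2)) t.1 t.2.

Definition bij_on {X Y} (A : X -> Prop) (B : Y -> Prop) (f : X -> Y) : Prop :=
  [/\ forall x, A x -> B (f x),
      forall x y, A x -> A y -> f x = f y -> x = y &
      forall b, B b -> exists2 x, A x & f x = b].

(* Main.v *)
Require Import Defs.
From mathcomp Require Import all_boot.
From Stdlib Require Import Relations.
From mathcomp Require Import zify.

Set Implicit Arguments.
Unset Strict Implicit.
Unset Printing Implicit Defensive.

(** The reverse insertion is undone row by row: after row [i] has been treated, the
    flag [al] is 1 exactly when the emitted value [m_i] is not ejectable in the rows
    treated so far, so the flag is determined by the output and a forward insertion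
    exists.  Two successive forward insertions obey a Pieri rule (the second cell is
    strictly to the right of the first one iff the second value is larger), whence
    [Psi] is a bijection onto the compatible pairs; it preserves the Hecke class
    because an ejectable value is absorbed by the row word.

    For flagged pairs, Koenig's theorem describes the number of entries [>= v] in
    column [j] of [K_-(P)] as a minimum over cuts, given by one separator per column.
    Displacing a single separator at each row shows that a reverse insertion changes
    no column of [K_-(P)], except, when the cell of column [c] is deleted, column [c],
    whose count drops in a controlled way.  With the analogous minima for [K_-(L(Q))],
    [(P, Q)] is dominant iff [(P', Q')] is and [q <= m], and one concludes by induction
    on the number of entries of [Q]. *)

(** * Increasing tableaux and the treatment of one row *)

(** Halfway through a reverse insertion there is no tableau: untouched rows lie on top, treated rows
    below, and one emitted value is in transit between them. Such a state is encoded by columns with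
    one extra entry, the value in transit, placed in the column it left; it is omitted if its row
    still contains it. As these columns need not form a tableau, costs of cuts are compared instead
    of keys. Deleting a cell in column [c] is the obstacle, since the two counts compared by
    dominance there need not drop together. If the count for [P] drops, an optimal cut extended by
    one separator bounds column [c.+1]; if the count for [L(Q)] does not drop, an optimal cut with
    its last separator removed bounds column [c.-1]. Dominance in every column other than [c] is the
    same before and after the step, and key columns are nested, so the neighbours settle column [c].
    Column 0 has no left neighbour, and [q <= m] takes its place. *)

Definition lto (y : nat) (e : option nat) : bool := if e is Some h then y < h else true.

(** In a strictly increasing row this is the column where a forward insertion of [e] lands; its
    predecessor is the column that the bumping path visits when [e] arrives from below. [None] is
    infinity. *)
Definition pos (R : seq nat) (e : option nat) : nat := count (lto^~ e) R.

Lemma lto_trans x y e : x <= y -> lto y e -> lto x e.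
Proof. by case: e => //= h; apply: leq_ltn_trans. Qed.

Lemma pos_le_size R e : pos R e <= size R.
Proof. exact: count_size. Qed.

Lemma lto_nth R e i : sorted ltn R -> i < size R -> lto (nth 0 R i) e = (i < pos R e).
Proof.
elim: R i => // x R IH i /= pR; have sR := path_sorted pR.
rewrite /pos /=; case: (boolP (lto x e)) => lx.
  by case: i => [|i] /= hi; [rewrite lx | rewrite IH].
have n0 : pos R e = 0.
  apply/eqP; rewrite -leqn0 leqNgt -has_count; apply/hasPn => y yR.
  apply: contra lx; apply: lto_trans.
  by have /allP/(_ y yR) := order_path_min ltn_trans pR; apply: ltnW.
case: i => [|i] /= hi; first by rewrite (negbTE lx) -/(pos R e) n0.
by rewrite -/(pos R e) n0 IH // n0.
Qed.

Lemma nth_lt R i j : sorted ltn R -> i < j -> j < size R -> nth 0 R i < nth 0 R j.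
Proof. by move=> sR ij jR; apply: (sorted_ltn_nth ltn_trans 0 sR) => //; rewrite inE; lia. Qed.

Lemma nth_le R i j : sorted ltn R -> i <= j -> j < size R -> nth 0 R i <= nth 0 R j.
Proof. by rewrite leq_eqVlt => sR /orP[/eqP-> //|ij jR]; apply/ltnW/nth_lt. Qed.

Lemma nth_lt_inv R i j : sorted ltn R -> i < size R -> nth 0 R i < nth 0 R j -> i < j.
Proof. by move=> sR iR h; rewrite ltnNge; apply/negP => /nth_le-/(_ _ sR iR); lia. Qed.

Lemma posE R e q : sorted ltn R -> q <= size R ->
  (forall k, k < q -> lto (nth 0 R k) e) -> (q < size R -> ~~ lto (nth 0 R q) e) -> pos R e = q.
Proof.
move=> sR qR h1 h2; apply/eqP; rewrite eqn_leq; apply/andP; split.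
  have [//|ltq] := leqP (pos R e) q.
  have qs : q < size R by apply: leq_trans ltq (pos_le_size _ _).
  by have := h2 qs; rewrite lto_nth // ltq.
case: q qR h1 {h2} => // q qR h1; rewrite -lto_nth //; exact: h1.
Qed.

Definition above (R S : seq nat) : Prop :=
  size S <= size R /\ forall k, k < size S -> nth 0 R k < nth 0 S k.

Lemma above_trans R S U : above R S -> above S U -> above R U.
Proof.
move=> [h1 h2] [h3 h4]; split=> [|k kU]; first exact: leq_trans h3 h1.
by apply: ltn_trans (h4 k kU); apply/h2/(leq_trans kU).
Qed.

Definition okrow (R : seq nat) : Prop := [/\ R != [::], sorted ltn R & all (ltn 0) R].

(** Recursive form of [increasing] (see [incP]): the insertion is followed from the bottom row
    upwards, so every tail of rows has to be a tableau in its own right. *)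
Fixpoint inc (P : tab) : Prop :=
  if P is R :: T then [/\ okrow R, above R (head [::] T) & inc T] else True.

Lemma head_row (P : tab) : head [::] P = row P 0. Proof. by case: P. Qed.

Lemma inc_okrow P R : inc P -> R \in P -> okrow R.
Proof. by elim: P => //= S T IH [oS _ iT]; rewrite inE => /predU1P[->|/(IH iT)]. Qed.

Lemma inc_head_sorted P : inc P -> sorted ltn (head [::] P).
Proof. by case: P => //= R T [[]]. Qed.

Lemma inc_above R T U : inc (R :: T) -> U \in T -> above R U.
Proof.
elim: T R => //= S T IH R [_ oRS iT]; rewrite inE => /predU1P[->//|UT].
by apply: above_trans oRS (IH _ _ UT).
Qed.

Lemma inc_cat A P : inc (A ++ P) -> inc P.
Proof. by elim: A => //= R A IH [_ _ /IH]. Qed.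

Lemma inc_catl A R T U : inc (A ++ R :: T) -> U \in A -> okrow U /\ above U R.
Proof.
elim: A => //= V A IH iA; rewrite inE => /predU1P[->|/IH]; last by apply; case: iA.
split; first by case: iA.
by apply: (inc_above iA); rewrite mem_cat in_cons eqxx orbT.
Qed.

Lemma inc_cat_head A P P' : inc (A ++ P) -> inc P' ->
  (forall R, above R (head [::] P) -> above R (head [::] P')) -> inc (A ++ P').
Proof.
elim: A => //= R A IH [oR ovR iA] iP' h; split=> //; last exact: IH.
by case: A {IH iA} ovR => [|S A] //= /h.
Qed.

(** Infinity counts as ejectable, so that the initial state with flag 0 satisfies the invariant
    [al = ~~ ejecto T e] as well. *)
Definition ejecto (T : tab) (e : option nat) : bool := if e is Some h then ejectable T h else true.

Lemma ejectable_mem T x : ejectable T x -> x \in head [::] T.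
Proof. by case: T => //= R T /andP[]. Qed.

Definition ejcands (T : tab) m e : seq nat :=
  [seq x <- head [::] T | [&& m < x, lto x e & ejectable T x]].

(* Treatment of one row [R] of the reverse insertion, [T] being the already
   treated rows below it and [e], [al] the value and the flag they emitted
   ([None] is the value oo).  The result is the value replacing the bumped
   entry (that entry itself when the row is left alone) and the new flag. *)
Definition rstep (R : seq nat) (T : tab) e (al : bool) : nat * bool :=
  let m := nth 0 R (pos R e).-1 in
  if m.+1 \in R then (m, al)
  else if al && (if e is Some h then h \notin R else false) then (odflt 0 e, true)
  else if ejcands T m e is [::] then (m, false) else (seqmax (ejcands T m e), true).

(** The constructors are the cases (D), (DR), (IR) and (NR). The condition on [al] in the last two
    is the failure of (DR): a raised flag then comes with a finite value already in [R]. *)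
Variant rstep_spec (R : seq nat) (T : tab) (e : option nat) (al : bool) (m : nat) : nat -> bool -> Prop :=
| RstepD of m.+1 \in R : rstep_spec R T e al m m al
| RstepDR h of e = Some h & al & h \notin R & m.+1 \notin R : rstep_spec R T e al m h true
| RstepIR x of m.+1 \notin R & (al -> exists2 h, e = Some h & h \in R)
    & m < x & lto x e & ejectable T x
    & (forall z, x < z -> lto z e -> ~~ ejectable T z) : rstep_spec R T e al m x true
| RstepNR of m.+1 \notin R & (al -> exists2 h, e = Some h & h \in R)
    & (forall z, m < z -> lto z e -> ~~ ejectable T z) : rstep_spec R T e al m m false.

Lemma seqmax_ge s x : x \in s -> x <= seqmax s.
Proof. by move=> xs; apply: (leq_bigmax_seq (F := id)). Qed.

Lemma seqmax_mem s : s != [::] -> seqmax s \in s.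
Proof.
elim: s => // x s IH _; rewrite /seqmax big_cons -/(seqmax s).
case: s IH => [_|y s IH]; first by rewrite /seqmax big_nil maxn0 inE.
rewrite /maxn; case: ifP => _; last by rewrite inE eqxx.
by rewrite inE IH // orbT.
Qed.

Lemma rstepP R T e (al : bool) : (al -> e != None) ->
  rstep_spec R T e al (nth 0 R (pos R e).-1) (rstep R T e al).1 (rstep R T e al).2.
Proof.
move=> ale; rewrite /rstep; set m := nth 0 R _.
case: ifP => [mR|/negbT mR]; first exact: RstepD.
case: (boolP (al && _)) => [/andP[al1]|nal] /=.
  by case: e m mR ale => //= h m mR _ hR; apply: RstepDR.
have alR : al -> exists2 h, e = Some h & h \in R.
  move=> al1; move: nal (ale al1); rewrite al1 /=; case: e {m mR ale} => //= h.
  by rewrite negbK => hR _; exists h.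
case E: (ejcands T m e) => [|y s] /=.
  apply: RstepNR => // z mz ze; apply/negP => ej.
  have : z \in ejcands T m e by rewrite mem_filter mz ze ej /= ejectable_mem.
  by rewrite E.
rewrite -E; have := @seqmax_mem (ejcands T m e); rewrite E => /(_ isT).
rewrite -E mem_filter => /andP[/and3P[h1 h2 h3] h4].
apply: RstepIR => // z xz ze; apply/negP => ej.
have /seqmax_ge : z \in ejcands T m e.
  by rewrite mem_filter ze ej /= ejectable_mem // (ltn_trans h1 xz).
by rewrite leqNgt xz.
Qed.

Lemma size_upd R q (x : nat) : q < size R -> size (set_nth 0 R q x) = size R.
Proof. by move=> qR; rewrite size_set_nth; apply/maxn_idPr. Qed.

Lemma nth_upd R q x k : nth 0 (set_nth 0 R q x) k = if k == q then x else nth 0 R k.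
Proof. by rewrite nth_set_nth. Qed.

Lemma sorted_nth (s : seq nat) :
  (forall i, i.+1 < size s -> nth 0 s i < nth 0 s i.+1) -> sorted ltn s.
Proof. by move=> h; apply/(sortedP 0). Qed.

Lemma all_nth (a : pred nat) (s : seq nat) : (forall i, i < size s -> a (nth 0 s i)) -> all a s.
Proof. by move=> h; apply/(all_nthP 0). Qed.

Lemma memR_nth (R : seq nat) h : h \in R -> exists2 k, k < size R & nth 0 R k = h.
Proof. by move=> /(nthP 0). Qed.

Lemma nth_mem (R : seq nat) k : k < size R -> nth 0 R k \in R.
Proof. exact: mem_nth. Qed.

Lemma sorted_upd R q x : sorted ltn R -> q <= size R ->
  (forall k, k < q -> nth 0 R k < x) -> (forall k, q < k -> k < size R -> x < nth 0 R k) ->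
  sorted ltn (set_nth 0 R q x).
Proof.
move=> sR qR h1 h2; apply: sorted_nth => i; rewrite size_set_nth !nth_upd => hi.
case: (eqVneq i q) => [iq|niq]; case: (eqVneq i.+1 q) => [iq'|niq']; first lia.
- by apply: h2; lia.
- by apply: h1; lia.
- by apply: nth_lt => //; lia.
Qed.

Lemma all_upd R q x : all (ltn 0) R -> q <= size R -> 0 < x -> all (ltn 0) (set_nth 0 R q x).
Proof.
move=> aR qR x0; apply: all_nth => i; rewrite size_set_nth nth_upd => hi.
by case: (eqVneq i q) => // niq; apply: (allP aR); apply: nth_mem; lia.
Qed.

Lemma mem_upd R q x y : q < size R -> sorted ltn R ->
  (y \in set_nth 0 R q x) = (y == x) || (y \in R) && (y != nth 0 R q).
Proof.
move=> qR sR; apply/idP/idP.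
  move=> /(nthP 0)[k]; rewrite size_upd // nth_upd => kR.
  case: eqP => [_ <-|/eqP nkq <-]; first by rewrite eqxx.
  rewrite nth_mem //= orbC; apply/orP; left.
  by rewrite nth_uniq // (sorted_uniq ltn_trans ltnn).
case/orP => [/eqP->|/andP[/(nthP 0)[k kR <-] ne]].
  by apply/(nthP 0); exists q; rewrite ?size_upd // nth_upd eqxx.
apply/(nthP 0); exists k; rewrite ?size_upd // nth_upd.
by case: (eqVneq k q) ne => // ->; rewrite eqxx.
Qed.

(* The situation in which a row [R] is about to be treated: [e] was emitted
   from column [pos (head [::] T) e] of the row below. *)
Definition rowst R T e : Prop :=
  [/\ okrow R, above R (head [::] T), inc T, pos (head [::] T) e < size R
    & lto (nth 0 R (pos (head [::] T) e)) e].

(** Here [q] is the bumped column, [m] the emitted entry, [x] its replacement, [a] the new flag and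
    [p] the column of [e] in the row below. [rf_key] isolates what the invariance of the key uses:
    the row is unchanged, or [e] replaces an entry straight above its own column, or [x] exceeds [m]
    and no entry of the next row from column [q.-1] on is smaller than [x]. In the first and last
    case, [K1] allows a value in transit to be dropped. *)
Record row_facts (R : seq nat) (T : tab) (e : option nat) (p q m x : nat) (a : bool) : Prop := RowFacts {
  rf_pq : p <= q;
  rf_q : q < size R;
  rf_m : nth 0 R q = m;
  rf_me : lto m e;
  rf_after : forall k, q < k -> k < size R -> ~~ lto (nth 0 R k) e;
  rf_mx : m <= x;
  rf_xe : forall h, e = Some h -> x <= h;
  rf_xR : forall k, q < k -> k < size R -> x < nth 0 R k;
  rf_inc : inc (set_nth 0 R q x :: T);
  rf_al : a = ~~ ejectable (set_nth 0 R q x :: T) m;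
  rf_pos : pos (set_nth 0 R q x) (Some m) = q;
  rf_key : let K1 := forall h, e = Some h -> h \notin head [::] T ->
                       p.+1 < size R /\ nth 0 R p.+1 <= h in
    [\/ x = m /\ K1,
        [/\ e = Some x, p = q, x \notin head [::] T & x \notin R]
      | [/\ m < x, 0 < q, K1 & forall k, k < size (head [::] T) -> q <= k.+1 ->
                                    x <= nth 0 (head [::] T) k]] }.

Lemma row_facts_intro R T e p q m x a :
  okrow R -> above R (head [::] T) -> inc T -> p <= q -> q < size R -> nth 0 R q = m ->
  lto m e -> (forall k, q < k -> k < size R -> ~~ lto (nth 0 R k) e) ->
  m <= x -> (forall h, e = Some h -> x <= h) ->
  (forall k, q < k -> k < size R -> x < nth 0 R k) ->
  (q < size (head [::] T) -> x < nth 0 (head [::] T) q) ->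
  a = ~~ ejectable (set_nth 0 R q x :: T) m ->
  (let K1 := forall h, e = Some h -> h \notin head [::] T ->
                p.+1 < size R /\ nth 0 R p.+1 <= h in
    [\/ x = m /\ K1,
        [/\ e = Some x, p = q, x \notin head [::] T & x \notin R]
      | [/\ m < x, 0 < q, K1 & forall k, k < size (head [::] T) -> q <= k.+1 ->
                                    x <= nth 0 (head [::] T) k]]) ->
  row_facts R T e p q m x a.
Proof.
move=> [R0 sR aR] [oT1 oT2] iT pq qR Em me aft mx xe xR xH ha hk.
have sR' : sorted ltn (set_nth 0 R q x).
  apply: sorted_upd => // [|k kq]; first exact: ltnW.
  by apply: leq_trans mx; rewrite -Em; apply: nth_lt.
have m0 : 0 < m by rewrite -Em; apply: (allP aR); apply: nth_mem.
split=> //.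
  split=> //; first split=> //.
  - by rewrite -size_eq0 size_upd // size_eq0.
  - by apply: all_upd => //; [apply: ltnW | apply: leq_trans mx].
  split=> [|k kH]; first by rewrite size_upd.
  by rewrite nth_upd; case: (eqVneq k q) kH => [->|_]; [apply: xH | apply: oT2].
apply: posE => // [|k kq|_]; first by rewrite size_upd // ltnW.
  by rewrite nth_upd /= ifN ?neq_ltn ?kq // -Em; apply: nth_lt.
by rewrite nth_upd eqxx /= -leqNgt.
Qed.

Lemma upd_id R q : q < size R -> set_nth 0 R q (nth 0 R q) = R.
Proof.
move=> qR; apply: (@eq_from_nth _ 0); rewrite size_upd // => i iR.
by rewrite nth_upd; case: (eqVneq i q) => // ->.
Qed.

Lemma not_ejectable_succ T h : ~~ ejectable T h -> h \in head [::] T -> h.+1 \in head [::] T.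
Proof. by case: T => //= R T h1 hR; apply: contraR h1 => h2; rewrite hR h2. Qed.

(* [lia] is too slow in the presence of the remaining hypotheses. *)
Ltac clia := repeat match goal with H : ?T |- _ =>
  lazymatch T with
  | is_true (leq _ _) => fail | is_true (~~ (leq _ _)) => fail | @eq _ _ _ => fail
  | is_true (_ && _) => fail | is_true (_ || _) => fail | is_true (~~ (_ && _)) => fail
  | is_true (_ == _) => fail | is_true (_ != _) => fail
  | _ => clear H end end; lia.

Lemma rstep_facts R T e al : rowst R T e -> al = ~~ ejecto T e ->
  let st := rstep R T e al in
  let q := (pos R e).-1 in
  row_facts R T e (pos (head [::] T) e) q (nth 0 R q) st.1 st.2.
Proof.
move=> [oR oT iT pR lp] ale /=; have [R0 sR aR] := oR; have [oT1 oT2] := oT.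
have sH := inc_head_sorted iT.
have alN : al -> e != None by rewrite ale; case: (e).
have := rstepP R T alN; move: (rstep R T e al) => [x0 a0] /=.
have pq : pos (head [::] T) e < pos R e by rewrite -lto_nth.
have pRle := pos_le_size R e.
have qR : (pos R e).-1 < size R by clia.
have ple : pos (head [::] T) e <= (pos R e).-1 by clia.
have me : lto (nth 0 R (pos R e).-1) e by rewrite lto_nth //; clia.
have aft k : (pos R e).-1 < k -> k < size R -> ~~ lto (nth 0 R k) e.
  by move=> qk kR; rewrite lto_nth // -leqNgt; clia.
have HP k : k < size (head [::] T) -> pos (head [::] T) e <= k ->
    forall h, e = Some h -> h <= nth 0 (head [::] T) k.
  move=> kH pk h eh; move: (lto_nth e sH kH); rewrite ltnNge pk /= eh /=; clia.
have posl l : l < size (head [::] T) -> lto (nth 0 (head [::] T) l) e ->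
    l < pos (head [::] T) e.
  by move=> lH; rewrite lto_nth.
have posg l : l < size (head [::] T) -> ~~ lto (nth 0 (head [::] T) l) e ->
    pos (head [::] T) e <= l.
  by move=> lH; rewrite lto_nth // -leqNgt.
move: (pos _ e) (pos R e).-1 pR lp {pq pRle} qR ple me aft HP posl posg.
move=> p q pR lp qR ple me aft HP posl posg rs.
have [m Em] : {m | nth 0 R q = m} by exists (nth 0 R q).
rewrite Em in rs me *.
have mR : m \in R by rewrite -Em; apply: nth_mem.
have intro x a := row_facts_intro oR oT iT ple qR Em me aft (x := x) (a := a).
have upm : set_nth 0 R q m = R by rewrite -Em upd_id.
have mxt : forall k, q < k -> k < size R -> m < nth 0 R k.
  by move=> k qk kR; rewrite -Em; apply: nth_lt.
have mxT : q < size (head [::] T) -> m < nth 0 (head [::] T) q.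
  by rewrite -Em; apply: oT2.
have afth h k : e = Some h -> q < k -> k < size R -> h <= nth 0 R k.
  by move=> eh qk kR; move: (aft k qk kR); rewrite eh /= -leqNgt.
have mh h : e = Some h -> m < h by move=> eh; move: me; rewrite eh.
have mk k : k < size R -> m < nth 0 R k -> q < k.
  by move=> kR mk; apply: (nth_lt_inv sR); rewrite ?Em.
have nextR h : e = Some h -> h \in R -> p.+1 < size R /\ nth 0 R p.+1 <= h.
  move=> eh /memR_nth[k kR kh]; have qk : q < k by apply: mk; rewrite ?kh ?mh.
  by split; [clia | rewrite -kh; apply: nth_le => //; clia].
have K1R h : (al -> exists2 h, e = Some h & h \in R) -> e = Some h -> h \notin head [::] T ->
    p.+1 < size R /\ nth 0 R p.+1 <= h.
  move=> h2 eh hH; apply: nextR => //; have [|h' eh' h'R] := h2.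
    by rewrite ale eh /=; apply: contra hH; apply: ejectable_mem.
  by move: eh' h'R; rewrite eh => -[->].
case: rs => [h1|h eh al1 hR h1|x h1 h2 mx xe ej h3|h1 h2 h3].
(* (D): [m.+1] stands right of column [q], so [e] is at most, hence equal to, [m.+1]. Then [m] is
   ejectable after the step exactly when [e] is ejectable below, and the flag is kept. *)
- have eh h : e = Some h -> h = m.+1.
    move=> eh; have [k kR km] := memR_nth h1; have := mk k kR; rewrite km => /(_ (ltnSn _)) qk.
    by have := afth h k eh qk kR; have := mh h eh; clia.
  have enN : e != None.
    have [k kR km] := memR_nth h1; have := mk k kR; rewrite km => /(_ (ltnSn _)) qk.
    by have := aft k qk kR; case: (e).
  apply: intro => //; first by move=> h /mh/ltnW.
  + rewrite upm /= mR h1 /= ale; case: (e) enN eh => //= h _ eh.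
    by rewrite (eh h).
  + by apply: Or31; split=> // h eh' hH; apply: nextR => //; rewrite (eh h).
- have xR k : q < k -> k < size R -> h < nth 0 R k.
    move=> qk kR; rewrite ltn_neqAle (afth h) // andbT.
    by apply: contra hR => /eqP->; apply: nth_mem.
  (* Otherwise the non-ejectable [h] has [h.+1] in its row, and the entry of [R] above [h.+1] would
     lie strictly between [h] and [h.+1]. *)
  have pqT : p = q -> h \notin head [::] T.
    move=> epq; apply/negP => hH; have := @not_ejectable_succ T h.
    move: (al1); rewrite ale eh /= => -> /(_ isT hH) /memR_nth[k kH kh].
    have [l lH lh] := memR_nth hH.
    have lk : l < k by apply: (nth_lt_inv sH); rewrite ?lh ?kh.
    have pl : p <= l by apply: posg; rewrite ?lh ?eh //= ltnn.
    have kR : k < size R by clia.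
    by have := xR k; have := oT2 k kH; rewrite kh => a1 /(_ _ kR) a2; have := a2; clia.
  have hH : q < size (head [::] T) -> h < nth 0 (head [::] T) q.
    move=> kH; have := HP q kH ple h eh.
    rewrite leq_eqVlt => /orP[/eqP hk|//].
    have [epq|npq] := eqVneq p q.
      by have := pqT epq; rewrite hk nth_mem.
    have ltpq : p < q by rewrite ltn_neqAle npq.
    have := HP p; have := nth_lt sH ltpq kH => a1 /(_ (ltn_trans ltpq kH) (leqnn _) h eh) a2.
    exact: leq_ltn_trans a2 a1.
  apply: intro => //.
  + exact/ltnW/mh.
  + by move=> h'; rewrite eh => -[->].
  + rewrite /= mem_upd // Em eqxx andbF orbF.
    by have := mh h eh; case: (eqVneq m h) => //= ->; rewrite ltnn.
  + have [epq|npq] := eqVneq p q.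
      by apply: Or32; split=> //; apply: pqT.
    apply: Or33; split=> //; first exact: mh.
    * by clia.
    * move=> h' eh' _; split; first by clia.
      apply: leq_trans (ltnW (mh _ eh')).
      by rewrite -Em; apply: nth_le => //; clia.
    * by move=> k kH qk; apply: HP => //; clia.
(* (IR): [x] is an entry of the row below in a column [l < p <= q]; this gives [0 < q] and bounds
   that row from column [q.-1] on. *)
- have [l lH lx] := memR_nth (ejectable_mem ej).
  have lp' : l < p by apply: posl; rewrite ?lx.
  have xl k : k < size (head [::] T) -> q <= k.+1 -> x <= nth 0 (head [::] T) k.
    by move=> kH qk; rewrite -lx; apply: nth_le => //; clia.
  apply: intro => //.
  + exact: ltnW.
  + by move=> h eh; move: xe; rewrite eh => /ltnW.
  + move=> k qk kR; have := aft k qk kR; case E: e xe => [h|] //= xh.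
    by rewrite -leqNgt; apply: leq_trans.
  + by move=> kH; rewrite -lx; apply: nth_lt => //; clia.
  + rewrite /= mem_upd // Em eqxx andbF orbF.
    by case: (eqVneq m x) mx => //= ->; rewrite ltnn.
  + apply: Or33; split=> //; first by clia.
    by move=> h; apply: K1R.
- apply: intro => //; first by move=> h /mh/ltnW.
  + by rewrite upm /= mR h1.
  + by apply: Or31; split=> // h; apply: K1R.
Qed.

(** * Reverse insertion and its inverse *)

Definition outer (P : tab) r : Prop := r < size P /\ size (row P r.+1) < size (row P r).

Lemma outer0 R T : outer (R :: T) 0 -> size (head [::] T) < size R.
Proof. by case=> _; rewrite -nth0. Qed.

Lemma outerS R T r : outer (R :: T) r.+1 -> outer T r. Proof. by []. Qed.

(** Relational form of the reverse insertion: [P'], [m] and [a] are the state once the top row of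
    [P] has been treated. Every lower part of a run is again a run on a smaller tableau, which
    [rri_loop], working on the whole tableau, does not display. *)
Inductive rins : tab -> nat -> bool -> tab -> nat -> bool -> Prop :=
| Rins_del R T :
    rins (R :: T) 0 true (if size R == 1 then T else take (size R).-1 R :: T) (last 0 R) true
| Rins_zero R T (q := (pos R None).-1) :
    rins (R :: T) 0 false (set_nth 0 R q (rstep R T None false).1 :: T) (nth 0 R q)
      (rstep R T None false).2
| Rins_row R T r al T' e a (q := (pos R (Some e)).-1) : rins T r al T' e a ->
    rins (R :: T) r.+1 al (set_nth 0 R q (rstep R T' (Some e) a).1 :: T') (nth 0 R q)
      (rstep R T' (Some e) a).2.

Definition ins m R := set_nth 0 R (pos R (Some m)) m.

Lemma size_ins m R : size (ins m R) = maxn (pos R (Some m)).+1 (size R).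
Proof. exact: size_set_nth. Qed.

Lemma nth_ins m R k : nth 0 (ins m R) k = if k == pos R (Some m) then m else nth 0 R k.
Proof. exact: nth_upd. Qed.

Lemma pos_ge R m : sorted ltn R -> pos R (Some m) < size R -> m <= nth 0 R (pos R (Some m)).
Proof. by move=> sR h; rewrite leqNgt; have /= -> := lto_nth (Some m) sR h; rewrite ltnn. Qed.

Lemma sorted_ins m R : sorted ltn R -> sorted ltn (ins m R).
Proof.
move=> sR; apply: sorted_upd => // [|k kp|k pk kR]; first exact: pos_le_size.
  have := lto_nth (Some m) sR (leq_trans kp (pos_le_size _ _)).
  by rewrite kp.
exact: leq_ltn_trans (pos_ge sR (ltn_trans pk kR)) (nth_lt sR pk kR).
Qed.

(** [H] is the treated row below and [ins e H] the same row before treatment. The two extra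
    conditions are those of [rowst]: because the original rows form a tableau, the row above can be
    treated next. *)
Lemma above_ins R e H : sorted ltn H ->
  above R (ins e H) <->
  above R H /\ pos H (Some e) < size R /\ nth 0 R (pos H (Some e)) < e.
Proof.
move=> sH; split=> [[h1 h2]|[[h1 h2] [h3 h4]]].
  rewrite size_ins in h1 h2; split.
    split=> [|k kH]; first by clia.
    have [kp|npk] := eqVneq k (pos H (Some e)).
      rewrite kp in kH *; apply: leq_trans (pos_ge sH kH).
      by have := h2 (pos H (Some e)); rewrite nth_ins eqxx; apply; rewrite leq_max ltnSn.
    have := h2 k; rewrite nth_ins (negbTE npk); apply.
    by rewrite leq_max kH orbT.
  split; first by clia.
  by have := h2 (pos H (Some e)); rewrite nth_ins eqxx; apply; rewrite leq_max ltnSn.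
split=> [|k]; first by rewrite size_ins geq_max h1 andbT.
rewrite size_ins nth_ins; have [->//|npk] := eqVneq k (pos H (Some e)).
by move=> kH; apply: h2; have := pos_le_size H (Some e); clia.
Qed.

Lemma rowst_ins R T e : okrow R -> inc T -> above R (ins e (head [::] T)) -> rowst R T (Some e).
Proof. by move=> oR iT /(above_ins R e (inc_head_sorted iT))[h1 [h2 h3]]. Qed.

Lemma pos_take_all R m : (forall k, k < size R -> nth 0 R k < m) -> pos R (Some m) = size R.
Proof.
move=> h; apply/eqP; rewrite -all_count; apply/(all_nthP 0) => i; exact: h.
Qed.

Lemma ins_facts R T e p q m x a : row_facts R T e p q m x a -> ins m (set_nth 0 R q x) = R.
Proof.
case=> _ qR Em _ _ _ _ _ _ _ pE _; rewrite /ins pE.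
apply: (@eq_from_nth _ 0) => [|i]; rewrite !size_upd ?size_upd // => iR.
by rewrite !nth_upd; case: eqVneq => // ->.
Qed.

Lemma sorted_last R : sorted ltn R -> R != [::] ->
  (forall k, k < (size R).-1 -> nth 0 R k < last 0 R).
Proof.
move=> sR R0 k kR; rewrite -nth_last; apply: nth_lt => //.
by case: (R) R0.
Qed.

Lemma ins_take R : sorted ltn R -> R != [::] ->
  pos (take (size R).-1 R) (Some (last 0 R)) = (size R).-1 /\
  ins (last 0 R) (take (size R).-1 R) = R.
Proof.
move=> sR R0; have sz : 0 < size R by case: (R) R0.
have st : size (take (size R).-1 R) = (size R).-1 by rewrite size_take; case: ltnP; clia.
have pE : pos (take (size R).-1 R) (Some (last 0 R)) = (size R).-1.
  rewrite -[RHS]st; apply: pos_take_all => k; rewrite st => kR.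
  by rewrite nth_take // sorted_last.
split=> //; apply: (@eq_from_nth _ 0); rewrite size_ins pE st; first by clia.
move=> i iR; rewrite nth_ins pE; case: (eqVneq i (size R).-1) => [->|ni].
  by rewrite nth_last.
by rewrite nth_take //; clia.
Qed.

Lemma rowst_None R T : okrow R -> above R (head [::] T) -> inc T ->
  size (head [::] T) < size R -> rowst R T None.
Proof.
by move=> oR aR iT h; split=> //; rewrite /pos /= count_predT.
Qed.

(** The second conclusion makes the flag a function of the output, so no flag has to be recorded to
    invert a row. The third recovers the original first row and thereby, through [above_ins], the
    hypotheses of [rstep_facts] for the row above. *)
Lemma rins_state P r al P' m a : inc P -> outer P r -> rins P r al P' m a ->
  [/\ inc P', a = ~~ ejectable P' m, head [::] P = ins m (head [::] P') & m \in head [::] P].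
Proof.
move=> + + ri; elim: ri => {P r al P' m a} [R T|R T q|R T r al T' e a q _ IH].
- move=> [oR aR iT] /outer0 szT; have [R0 sR pR] := oR.
  have lR : last 0 R \in R by case: (R) R0 => //= x s _; rewrite mem_last.
  case: ifP => [/eqP s1|/negbT s1].
    have T0 : T = [::].
      case: T iT szT {aR} => //= S T [[S0 _ _] _ _]; rewrite s1.
      by case: S S0.
    rewrite T0 /=; split=> //.
    by case: (R) s1 => [|x []].
  have [pE iE] := ins_take sR R0.
  have sz : 0 < size R by case: (R) R0.
  have st : size (take (size R).-1 R) = (size R).-1 by rewrite size_take; case: ltnP; clia.
  split=> //=.
  + split=> //.
      split.
      * by rewrite -size_eq0 st; clia.
      * exact: take_sorted.
      * by apply/allP => z /mem_take; apply: (allP pR).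
    split=> [|k kT]; first by rewrite st; clia.
    by rewrite nth_take; [apply: aR.2 | clia].
  + suff -> : (last 0 R \in take (size R).-1 R) = false by [].
    apply/negP => /memR_nth[k]; rewrite st => kR; rewrite nth_take // => h.
    by have := sorted_last sR R0 kR; rewrite h ltnn.
- move=> [oR aR iT] /outer0 szT.
  have rs := rowst_None oR aR iT szT.
  have F := rstep_facts rs (erefl : false = ~~ ejecto T None); rewrite /= -/q in F.
  split=> //=; [exact: rf_inc F | exact: rf_al F | by rewrite (ins_facts F)|].
  by apply: nth_mem; apply: rf_q F.
- move=> [oR aR iT] /outerS oT; have [iT' aE hT _] := IH iT oT.
  have rs : rowst R T' (Some e) by apply: rowst_ins => //; rewrite -hT.
  have F := rstep_facts rs aE; rewrite /= -/q in F.
  split=> //=; [exact: rf_inc F | exact: rf_al F | by rewrite (ins_facts F)|].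
  by apply: nth_mem; apply: rf_q F.
Qed.

Lemma rins_rowst R T r al T' e a : inc (R :: T) -> outer T r -> rins T r al T' e a ->
  rowst R T' (Some e) /\ a = ~~ ejecto T' (Some e).
Proof.
move=> [oR aR iT] oT ri; have [iT' aE hT _] := rins_state iT oT ri.
by split=> //; apply: rowst_ins => //; rewrite -hT.
Qed.

(** * Forward insertion: recovering the value received from below *)

Definition isnext (A : pred nat) y e : Prop :=
  (forall z, y < z -> lto z e -> ~~ A z) /\ (forall h, e = Some h -> y < h /\ A h).

Lemma isnext_uniq A y e e' : isnext A y e -> isnext A y e' -> e = e'.
Proof.
case: e => [h|]; case: e' => [h'|] //= [h1 h2] [h3 h4].
- have [yh Ah] := h2 _ erefl; have [yh' Ah'] := h4 _ erefl; congr Some.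
  case: (ltngtP h h') => // hh.
    by have := h3 h yh hh; rewrite Ah.
  by have := h1 h' yh' hh; rewrite Ah'.
- by have [yh Ah] := h2 _ erefl; have := h3 h yh isT; rewrite Ah.
- by have [yh Ah] := h4 _ erefl; have := h1 _ yh isT; rewrite Ah.
Qed.

Lemma isnext_ohead (A : pred nat) y (s : seq nat) : (forall z, A z -> z \in s) ->
  isnext A y (ohead (sort leq [seq z <- s | (y < z) && A z])).
Proof.
move=> As; set t := [seq z <- s | _].
have mt z : (z \in sort leq t) = (y < z) && A z.
  by rewrite mem_sort mem_filter; case: (boolP (A z)) => [/As->|]; rewrite ?andbT ?andbF.
have := sort_sorted leq_total t; case E: (sort leq t) => [|h u] /= st; split=> //.
- by move=> z yz _; move: (mt z); rewrite E yz /= => <-.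
- move=> z yz zh; apply/negP => Az; move: (mt z); rewrite E yz Az inE.
  rewrite ltn_eqF //= => /(allP (order_path_min leq_trans st)).
  by rewrite leqNgt => /negP; apply; exact: zh.
- by move=> h' [<-]; apply/andP; rewrite -mt E inE eqxx.
Qed.

(* The value that [rstep] received from the rows [T] when it emitted [m] and left
   the row [R]: the three cases undo (D), (DR), and (IR) or (NR). *)
Definition nexte R (T : tab) m : option nat :=
  let y := nth 0 R (pos R (Some m)) in
  if (y == m) && (m.+1 \in R) then Some m.+1
  else if (y != m) && ~~ ejectable T y then Some y
  else ohead (sort leq [seq z <- R ++ head [::] T | (y < z) && ((z \in R) || ejectable T z)]).

Lemma nexteP R T m (y := nth 0 R (pos R (Some m))) :
  [\/ [/\ y = m, m.+1 \in R & nexte R T m = Some m.+1],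
      [/\ y <> m, ~~ ejectable T y & nexte R T m = Some y]
    | [/\ y = m -> m.+1 \notin R, y <> m -> ejectable T y
        & isnext (fun z => (z \in R) || ejectable T z) y (nexte R T m)]].
Proof.
rewrite /nexte -/y; case: eqP => [ym|ym] /=; last first.
  case: ifP => [h|/negbFE h]; first by apply: Or32.
  apply: Or33; split=> //; apply: isnext_ohead => z /orP[zR|/ejectable_mem zT].
    by rewrite mem_cat zR.
  by rewrite mem_cat zT orbT.
case: ifP => [h|/negbT h]; first by apply: Or31.
apply: Or33; split=> //; apply: isnext_ohead => z /orP[zR|/ejectable_mem zT].
  by rewrite mem_cat zR.
by rewrite mem_cat zT orbT.
Qed.

(** The inverse of [rins]: it returns the larger tableau, the row of the outer cell and the initial
    flag, which is raised exactly when a cell is created. [nexte] being [None] means that the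
    reverse insertion started in this row from the value infinity. *)
Fixpoint fins (P : tab) m : tab * nat * bool :=
  if P is R :: T then
    if pos R (Some m) == size R then (ins m R :: T, 0, true)
    else if nexte R T m is Some e then
      let: (T', r, al) := fins T e in (ins m R :: T', r.+1, al)
    else (ins m R :: T, 0, false)
  else ([:: [:: m]], 0, true).

(** For (D) and (DR) the value is read off directly. After (IR) or (NR), [e] is the next element
    above [x] among the entries of the row and the ejectable values below: nothing of that set lies
    in between, by maximality of [x], and a finite [e] belongs to it, being ejectable if [al] is 0
    and an entry of [R] if (DR) failed. *)
Lemma nexte_rstep R T e al (q := (pos R e).-1) : rowst R T e -> al = ~~ ejecto T e ->
  nexte (set_nth 0 R q (rstep R T e al).1) T (nth 0 R q) = e.
Proof.
move=> rs ale; have F := rstep_facts rs ale; rewrite /= -/q in F.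
have alN : al -> e != None by rewrite ale; case: (e).
have [[R0 sR aR] aRT iT _ _] := rs.
have := rstepP R T alN; rewrite -/q.
move: (rstep R T e al) F => [x a'] /= F.
have [_ qR _ me aft mx xe xR _ _ pE _] := F; rewrite /nexte pE.
have [m Em] : {m | nth 0 R q = m} by exists (nth 0 R q).
move: me mx {F pE}; rewrite !Em => me mx rsp.
rewrite nth_upd eqxx mem_upd //.
have mk k : k < size R -> m < nth 0 R k -> q < k.
  by move=> kR mk; apply: (nth_lt_inv sR); rewrite ?Em.
have nxt : (forall z, x < z -> lto z e -> ~~ ejectable T z) -> 
    (al -> exists2 h, e = Some h & h \in R) -> (forall h, e = Some h -> x < h) ->
    ohead (sort leq [seq z <- set_nth 0 R q x ++ head [::] T |
      (x < z) && ((z \in set_nth 0 R q x) || ejectable T z)]) = e.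
  move=> h1 h2 h3.
  apply: (@isnext_uniq (fun z => (z \in set_nth 0 R q x) || ejectable T z) x).
    apply: isnext_ohead => z /orP[zR|/ejectable_mem zT]; by rewrite mem_cat ?zR ?zT ?orbT.
  split=> [z xz ze|h eh].
    rewrite negb_or h1 // andbT mem_upd // gtn_eqF //= Em.
    apply/negP => /andP[/memR_nth[k kR kz] _].
    have qk : q < k by apply: mk; rewrite ?kz //; apply: leq_ltn_trans xz.
    by have := aft k qk kR; rewrite kz ze.
  split; first exact: h3.
  have [al1|al0] := boolP al.
    have [h' + hR] := h2 al1; rewrite eh => -[hh]; rewrite -hh in hR.
    rewrite mem_upd // hR Em; have mh : m < h by move: me; rewrite eh.
    by rewrite (gtn_eqF mh) orbT.
  by move: ale al0; rewrite eh /= => ->; rewrite negbK => ->; rewrite orbT.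
case: rsp xR mx xe nxt => [h1|h eh al1 hR h1|x' h1 h2 mx' xe' ej h3|h1 h2 h3] xR mx xe nxt.
- rewrite h1 Em eqxx /= (gtn_eqF (ltnSn m)) /=.
  have [k kR km] := memR_nth h1; have := mk k kR; rewrite km => /(_ (ltnSn _)) qk.
  by have := aft k qk kR; rewrite km; case: (e) me => //= h mh; rewrite -leqNgt => hm; congr Some; clia.
- have hm : m < h by move: me; rewrite eh.
  rewrite (gtn_eqF hm) /=; move: al1; rewrite ale eh /= => -> /=; by [].
- rewrite (gtn_eqF mx') /= ej /=; apply: nxt => //.
  by move=> h eh; move: xe'; rewrite eh.
- rewrite eqxx /= (negbTE h1) andFb orbF (gtn_eqF (ltnSn m)) /=; apply: nxt => //.
  by move=> h eh; move: me; rewrite eh.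
Qed.

Lemma fins_rins P r al P' m a : inc P -> outer P r -> rins P r al P' m a ->
  fins P' m = (P, r, al).
Proof.
move=> + + ri; elim: ri => {P r al P' m a} [R T|R T q|R T r al T' e a q ri IH].
- move=> [oR aR iT] /outer0 szT; have [R0 sR pR] := oR.
  case: ifP => [/eqP s1|/negbT s1].
    have T0 : T = [::].
      case: T iT szT {aR} => //= S T [[S0 _ _] _ _]; rewrite s1.
      by case: S S0.
    by rewrite T0 /=; case: (R) s1 => [|x []].
  have [pE iE] := ins_take sR R0.
  have sz : 0 < size R by case: (R) R0.
  have st : size (take (size R).-1 R) = (size R).-1 by rewrite size_take; case: ltnP; clia.
  by rewrite /= pE st eqxx iE.
- move=> [oR aR iT] /outer0 szT.
  have rs := rowst_None oR aR iT szT.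
  have F := rstep_facts rs (erefl : false = ~~ ejecto T None); rewrite /= -/q in F.
  rewrite /= (rf_pos F) (nexte_rstep rs) // (ins_facts F) size_upd ?(rf_q F) //.
  by rewrite ltn_eqF // (rf_q F).
- move=> iP /outerS oT.
  have [rs aE] := rins_rowst iP oT ri; have [_ _ iT] := iP.
  have F := rstep_facts rs aE; rewrite /= -/q in F.
  rewrite /= (rf_pos F) (nexte_rstep rs) // (ins_facts F) size_upd ?(rf_q F) //.
  by rewrite ltn_eqF ?(rf_q F) // IH.
Qed.

Lemma ins_pos R m e : sorted ltn R -> pos R (Some m) < size R -> lto m e ->
  (forall k, pos R (Some m) < k -> k < size R -> ~~ lto (nth 0 R k) e) ->
  pos (ins m R) e = (pos R (Some m)).+1.
Proof.
move=> sR pR me aft; have sz : size (ins m R) = size R by rewrite size_ins; clia.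
apply: posE; rewrite ?sz //; first exact: sorted_ins.
  move=> k kp; rewrite nth_ins; case: eqVneq => // nk; apply: (lto_trans _ me).
  have kR : k < size R by clia.
  by have := lto_nth (Some m) sR kR; rewrite /= => /esym; clia.
by move=> kR; rewrite nth_ins gtn_eqF // aft.
Qed.

(** Converse of [nexte_rstep]: the value found by [nexte] is one that the reverse step accepts, and
    the step restores the bumped entry. The delicate part is [rowst], that [e] fits below the new
    row. *)
Lemma nexte_facts R T m al (q := pos R (Some m)) (e := nexte R T m) :
  inc (R :: T) -> 0 < m -> q < size R ->
  [/\ m <= nth 0 R q, lto m e, forall k, q < k -> k < size R -> ~~ lto (nth 0 R k) e,
      rowst (ins m R) T e & al = ~~ ejecto T e -> (rstep (ins m R) T e al).1 = nth 0 R q].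
Proof.
move=> [[R0 sR aR] aRT iT] m0 qR.
have my : m <= nth 0 R q by exact: pos_ge.
have NP := nexteP R T m; rewrite -/q -/e in NP.
have [y Ey] : {y | nth 0 R q = y} by exists (nth 0 R q).
rewrite Ey in my NP *.
have me : lto m e.
  case: NP => [[_ _ ->]|[ym _ ->]|[_ _ [_ +]]] /=; first by [].
    by rewrite ltn_neqAle my andbT; apply/eqP => h; case: ym.
  by case: (e) => //= h /(_ h erefl)[+ _]; apply: leq_ltn_trans.
have yk k : q < k -> k < size R -> y < nth 0 R k.
  by move=> qk kR; rewrite -Ey; apply: nth_lt.
have aft k : q < k -> k < size R -> ~~ lto (nth 0 R k) e.
  move=> qk kR; have := yk k qk kR.
  case: NP => [[ym _ ->]|[_ _ ->]|[_ _ [+ _]]] /=; try by clia.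
  move=> h1 h2; apply/negP => h3; have := h1 _ h2 h3.
  by rewrite nth_mem.
have pE : pos (ins m R) e = q.+1 by apply: ins_pos.
have sz : size (ins m R) = size R by rewrite size_ins; clia.
have sH := inc_head_sorted iT; have [aRT1 aRT2] := aRT.
have aI : above (ins m R) (head [::] T).
  split=> [|k kH]; first by rewrite sz.
  rewrite nth_ins -/q; case: (eqVneq k q) => [kq|_]; last exact: aRT2.
  by rewrite kq in kH *; apply: leq_ltn_trans my _; rewrite -Ey; apply: aRT2.
have oI : okrow (ins m R).
  split; [by rewrite -size_eq0 sz size_eq0 | exact: sorted_ins|].
  by apply: all_upd => //; apply: ltnW.
have qR' : q < size (ins m R) by rewrite sz.
have nI : nth 0 (ins m R) q = m by rewrite nth_ins eqxx.
have rs : rowst (ins m R) T e.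
  have pH : pos (head [::] T) e <= size (head [::] T) := pos_le_size _ _.
  have [pq|pq] := leqP (pos (head [::] T) e) q.
    split=> //; first by clia.
    by apply: lto_trans me; rewrite -[X in _ <= X]nI; apply: nth_le => //; apply: sorted_ins.
  (* the entry [z] preceding the place of [e] in the row below cannot be ejectable *)
  set p := pos _ e in pH pq *; pose z := nth 0 (head [::] T) p.-1.
  have p1 : p.-1 < size (head [::] T) by clia.
  have ze : lto z e by rewrite lto_nth // -/p; clia.
  have yz : y < z.
    rewrite -Ey; apply: leq_trans (aRT2 q _) _; first by clia.
    by apply: nth_le => //; clia.
  case: NP => [[ym _ ee]|[_ _ ee]|[_ _ [h1 _]]].
  - by move: ze; rewrite ee /= -ym; clia.
  - by move: ze; rewrite ee /=; clia.
  have /norP[zR zej] := h1 z yz ze.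
  have zH : z \in head [::] T by apply: nth_mem.
  have [k kH kz] := memR_nth (not_ejectable_succ zej zH).
  have pk : p.-1 < k by apply: (nth_lt_inv sH); rewrite // kz.
  have pH' : p < size (head [::] T) by clia.
  have nze : nth 0 (head [::] T) p = z.+1.
    have := nth_lt sH (_ : p.-1 < p) pH'; rewrite -/z => /(_ _) zp.
    have := nth_le sH (_ : p <= k) kH; rewrite kz => kp.
    have := zp ltac:(clia); have := kp ltac:(clia); clia.
  have np : p != q by clia.
  split=> //; first by rewrite -/p; clia.
  rewrite -/p nth_ins (negbTE np); have := aRT2 p pH'; rewrite nze => h.
  by apply: lto_trans ze; clia.
split=> // ale.
have alN : al -> e != None by rewrite ale; case: (e).
have := rstepP (ins m R) T alN; rewrite pE /= nI.
move: (rstep _ _ _ _) => [x a'] /=.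
have mI z : (z \in ins m R) = (z == m) || (z \in R) && (z != y).
  by rewrite mem_upd // -/q Ey.
case=> [h1|h eh al1 hR h1|x' h1 h2 mx xe ej h3|h1 h2 h3].
- move: h1; rewrite mI (gtn_eqF (ltnSn m)) /= => /andP[h1 h2].
  have [k kR km] := memR_nth h1.
  have yp : y <= m.+1.
    rewrite -Ey -km; apply: nth_le => //; rewrite leqNgt; apply/negP => kq.
    by have := lto_nth (Some m) sR kR; rewrite -/q kq km /= ltnNge leqnSn.
  by clia.
- case: NP => [[ym mR ee]|[ym yej ee]|[hh1 hh2 [hh3 hh4]]].
  + by move: h1; rewrite mI mR ym (gtn_eqF (ltnSn m)).
  + by move: eh; rewrite ee => -[].
  + have [yh /orP[hR'|hej]] := hh4 _ eh.
      by move: hR; rewrite mI hR' (gtn_eqF yh) orbT.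
    by move: al1; rewrite ale eh /= hej.
- case: NP => [[ym mR ee]|[ym yej ee]|[hh1 hh2 [hh3 hh4]]].
  + by move: h1; rewrite mI mR ym (gtn_eqF (ltnSn m)).
  + move: (ale); rewrite ee /= yej => /h2[h]; rewrite ee => -[<-].
    by rewrite mI eqxx andbF orbF => /eqP/ym.
  + have [xy|yx|//] := ltngtP x' y; last first.
      by have := hh3 x' yx xe; rewrite ej orbT.
    have ny : y <> m by clia.
    have := h3 y xy; rewrite hh2 // => /(_ _) h; suff /h : lto y e by [].
    by case: (e) hh4 => //= h' /(_ h' erefl)[].
- case: NP => [[ym mR ee]//|[ym yej ee]|[hh1 hh2 [hh3 hh4]]].
  + move: (ale); rewrite ee /= yej => /h2[h]; rewrite ee => -[<-].
    by rewrite mI eqxx andbF orbF => /eqP.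
  + have [ym|ym] := eqVneq y m; first by [].
    have my' : m < y by clia.
    have := h3 y my'; rewrite hh2; last by apply/eqP.
    move=> /(_ _) h; suff /h : lto y e by [].
    by case: (e) hh4 => //= h' /(_ h' erefl)[].
Qed.

Lemma take_ins R m : pos R (Some m) = size R ->
  size (ins m R) = (size R).+1 /\ take (size R) (ins m R) = R /\ last 0 (ins m R) = m.
Proof.
move=> pE; have sz : size (ins m R) = (size R).+1 by rewrite size_ins pE; clia.
split=> //; split; last by rewrite -nth_last sz /= nth_ins pE eqxx.
apply: (@eq_from_nth _ 0) => [|i]; rewrite size_take sz ltnSn // => iR.
by rewrite nth_take // nth_ins pE ltn_eqF.
Qed.

Lemma rins_fins P' m P r al : inc P' -> 0 < m -> fins P' m = (P, r, al) ->
  exists a, [/\ inc P, outer P r & rins P r al P' m a].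
Proof.
elim: P' m P r al => [|R T IH] m P r al /=.
  move=> _ m0 [<- <- <-]; exists true; split=> //; first by rewrite /= /okrow /= m0.
  exact: (Rins_del [:: m] [::]).
move=> iRT m0; have [[R0 sR aR] aRT iT] := iRT.
case: eqP => [pE [<- <- <-]|/eqP pN].
  have [sz [tk la]] := take_ins pE.
  exists true; split.
  - split=> //.
      split; [by rewrite -size_eq0 sz | exact: sorted_ins|].
      by apply: all_upd => //; rewrite pE.
    have [h1 h2] := aRT; split=> [|k kT]; first by rewrite sz; clia.
    rewrite nth_ins pE ltn_eqF; [exact: h2 | by clia].
  - split=> //; change (size (nth [::] T 0) < size (ins m R)); rewrite nth0 sz; have [h1 h2] := aRT; exact: h1.
  - have := Rins_del (ins m R) T; rewrite sz /= eqSS size_eq0 (negbTE R0) tk la.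
    by [].
have qR : pos R (Some m) < size R by rewrite ltn_neqAle pN pos_le_size.
have sz : size (ins m R) = size R by rewrite size_ins; clia.
have back x : x = nth 0 R (pos R (Some m)) -> set_nth 0 (ins m R) (pos R (Some m)) x = R.
  move=> ->; apply: (@eq_from_nth _ 0) => [|i]; rewrite size_upd sz // => iR.
  by rewrite nth_upd nth_ins; case: eqVneq => // ->.
case E: (nexte R T m) => [e|].
  case F: (fins T e) => [[T2 r2] al2] [<- <- <-].
  have [my me _ _ _] := nexte_facts true iRT m0 qR; rewrite E /= in me.
  have e0 : 0 < e by clia.
  have [a [iT2 oT2 ri]] := IH e T2 r2 al2 iT e0 F.
  have [_ aE hE _] := rins_state iT2 oT2 ri.
  have [_ _ aft rs] := nexte_facts a iRT m0 qR; rewrite E => rE.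
  rewrite E in aft rs.
  have pE : pos (ins m R) (Some e) = (pos R (Some m)).+1 by apply: ins_pos.
  have := Rins_row (ins m R) ri; rewrite pE /= rE // back //.
  rewrite nth_ins eqxx => ri'.
  have [oI aI _ pI nI] := rs.
  eexists; split; [|by []|exact: ri'].
  by split=> //; rewrite hE; apply/above_ins; first exact: inc_head_sorted.
move=> [<- <- <-].
have [my me aft rs rE] := nexte_facts false iRT m0 qR; rewrite E in aft rs rE me.
have pE : pos (ins m R) None = (pos R (Some m)).+1 by apply: ins_pos.
have := Rins_zero (ins m R) T; rewrite pE /= rE // back //.
rewrite nth_ins eqxx => ri'.
have [oI aI _ pI nI] := rs.
eexists; split; [by split|split=> //|exact: ri'].
Qed.

(** * Hecke equivalence *)

Definition far i j := (i.+1 < j) || (j.+1 < i).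

Lemma heq_refl a : hecke_eq a a. Proof. exact: rst_refl. Qed.

Lemma heq_sym a b : hecke_eq a b -> hecke_eq b a. Proof. exact: rst_sym. Qed.

Lemma heq_trans b a c : hecke_eq a b -> hecke_eq b c -> hecke_eq a c.
Proof. exact: rst_trans. Qed.

Lemma heq_cat x y a b : hecke_eq a b -> hecke_eq (x ++ a ++ y) (x ++ b ++ y).
Proof.
elim=> {a b} [a b h|a|a b _ /heq_sym //|a b c _ h1 _ h2]; [|exact: heq_refl|exact: heq_trans h2].
apply: rst_step; case: h => [u v i|u v i|u v i j h].
- by have := hm_idem (x ++ u) (v ++ y) i; rewrite !catA.
- by have := hm_braid (x ++ u) (v ++ y) i; rewrite !catA.
- by have := hm_comm (x ++ u) (v ++ y) h; rewrite !catA.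
Qed.

Lemma heq_catl x a b : hecke_eq a b -> hecke_eq (x ++ a) (x ++ b).
Proof. by move=> /(heq_cat x [::]); rewrite !cats0. Qed.

Lemma heq_catr y a b : hecke_eq a b -> hecke_eq (a ++ y) (b ++ y).
Proof. exact: (heq_cat [::]). Qed.

Lemma heq_cons x a b : hecke_eq a b -> hecke_eq (x :: a) (x :: b).
Proof. exact: (heq_catl [:: x]). Qed.

Lemma heq_idem i : hecke_eq [:: i; i] [:: i].
Proof. exact: rst_step (hm_idem [::] [::] i). Qed.

Lemma heq_braid i : hecke_eq [:: i; i.+1; i] [:: i.+1; i; i.+1].
Proof. exact: rst_step (hm_braid [::] [::] i). Qed.

Lemma heq_swap1 x s : all (far x) s -> hecke_eq (x :: s) (s ++ [:: x]).
Proof.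
elim: s => [_|y s IH /= /andP[xy /IH h]]; first exact: heq_refl.
apply: heq_trans (heq_cons y h).
by apply: (@heq_catr s [:: x; y] [:: y; x]); apply: rst_step; apply: (hm_comm [::] [::]).
Qed.

Lemma heq_swap s t : all (fun x => all (far x) t) s -> hecke_eq (s ++ t) (t ++ s).
Proof.
elim: s => [_|x s IH /= /andP[h /IH hs]]; first by rewrite cats0; apply: heq_refl.
apply: heq_trans (heq_cons x hs) _; rewrite -cat_cons -[x :: s]cat1s catA.
by apply: heq_catr; apply: heq_swap1.
Qed.

(** This word is Hecke equivalent to [rev (word P)] (see [word_hecke]) and can be transformed one
    row at a time. *)
Definition rowword (P : tab) : seq nat := flatten [seq rev R | R <- P].

Lemma sorted_split R q : sorted ltn R -> q < size R ->
  R = take q R ++ nth 0 R q :: drop q.+1 R /\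
  all (ltn^~ (nth 0 R q)) (take q R) && all (ltn (nth 0 R q)) (drop q.+1 R).
Proof.
move=> sR qR; have E : R = take q R ++ nth 0 R q :: drop q.+1 R.
  by rewrite -drop_nth // cat_take_drop.
split=> //; move: sR; rewrite {1}E (sorted_pairwise ltn_trans) pairwise_cat /= allrelC allrel_consl.
by case/and3P=> /andP[h1 _] _ /andP[h2 _]; rewrite h2 andbT.
Qed.

Lemma set_nth_split R q (x : nat) : q < size R -> set_nth 0 R q x = take q R ++ x :: drop q.+1 R.
Proof.
move=> qR; have sz : size (take q R) = q by rewrite size_take qR.
apply: (@eq_from_nth _ 0); first by rewrite size_upd // size_cat /= sz size_drop; clia.
move=> i _; rewrite nth_upd nth_cat sz; case: (ltngtP i q) => [iq|iq|->].
- by rewrite nth_take.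
- have -> : i - q = (i - q.+1).+1 by clia.
  by rewrite /= nth_drop; congr nth; clia.
- by rewrite subnn.
Qed.

Lemma all_far_gt x s : all (ltn x.+1) s -> all (far x) s.
Proof. by apply: sub_all => y; rewrite /far /= => ->. Qed.

Lemma all_far_lt x s : all (fun y => y.+1 < x) s -> all (far x) s.
Proof. by apply: sub_all => y; rewrite /far /= => ->; rewrite orbT. Qed.

Lemma absorb_left R x : sorted ltn R -> x \in R -> x.+1 \notin R -> hecke_eq (x :: rev R) (rev R).
Proof.
move=> sR /memR_nth[q qR qx] xR; have [E /andP[_ h2]] := sorted_split sR qR.
rewrite qx in E h2; rewrite E rev_cat rev_cons cat_rcons.
have h : all (far x) (rev (drop q.+1 R)).
  rewrite all_rev; apply: all_far_gt; apply/allP => z zR; have xz : x.+1 <= z := allP h2 _ zR.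
  rewrite /= ltn_neqAle xz andbT.
  by apply: contra xR => /eqP->; apply: mem_drop zR.
rewrite -cat_cons; apply: heq_trans (heq_catr _ (heq_swap1 h)) _.
rewrite -catA; apply: heq_catl.
exact: (@heq_catr (rev (take q R)) [:: x; x] [:: x]) (heq_idem x).
Qed.

Lemma absorb_right R x : sorted ltn R -> x.+1 \in R -> x \notin R ->
  hecke_eq (rev R ++ [:: x.+1]) (rev R).
Proof.
move=> sR /memR_nth[q qR qx] xR; have [E /andP[h2 _]] := sorted_split sR qR.
rewrite qx in E h2; rewrite E rev_cat rev_cons cat_rcons -!catA /=.
have h : all (far x.+1) (rev (take q R)).
  rewrite all_rev; apply: all_far_lt; apply/allP => z zR.
  have := allP h2 _ zR; rewrite /= !ltnS leq_eqVlt => /predU1P[zx|//].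
  by rewrite -zx (mem_take zR) in xR.
apply: heq_catl; apply: heq_trans (heq_cons _ (heq_sym (heq_swap1 h))) _.
exact: (@heq_catr (rev (take q R)) [:: x.+1; x.+1] [:: x.+1]) (heq_idem x.+1).
Qed.

(** [x] moves left past the entries smaller than [m], and [m] moves left past the entries larger
    than [x]; since [m < x], all these pairs differ by at least two. *)
Lemma slide_bump R q x : sorted ltn R -> q < size R -> nth 0 R q < x ->
  (forall k, q < k -> k < size R -> x < nth 0 R k) ->
  hecke_eq (rev R ++ [:: x]) (nth 0 R q :: rev (set_nth 0 R q x)).
Proof.
move=> sR qR mx aft; have [E /andP[h1 h2]] := sorted_split sR qR.
rewrite (set_nth_split _ qR) [in rev R]E; set m := nth 0 R q in mx E h1 h2 *.
rewrite !rev_cat !rev_cons !cat_rcons -catA /=.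
have hl : all (far x) (rev (take q R)).
  by rewrite all_rev; apply: all_far_lt; apply: sub_all h1 => z /= zm; clia.
have hh : all (far m) (rev (drop q.+1 R)).
  rewrite all_rev; apply: all_far_gt; apply/(all_nthP 0) => i; rewrite size_drop nth_drop => iR /=.
  by have := aft (q.+1 + i) ltac:(clia) ltac:(clia); clia.
apply: heq_trans (heq_catl _ (heq_cons m (heq_sym (heq_swap1 hl)))) _.
rewrite -cat_cons; apply: heq_trans (heq_catr _ (heq_sym (heq_swap1 hh))).
by rewrite -catA; apply: heq_refl.
Qed.

Lemma slide_braid R m : sorted ltn R -> m \in R -> m.+1 \in R ->
  hecke_eq (rev R ++ [:: m.+1]) (m :: rev R).
Proof.
move=> sR /memR_nth[q qR qm] /memR_nth[k kR km]; have [E /andP[h1 h2]] := sorted_split sR qR.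
have qk : q < k by apply: (nth_lt_inv sR); rewrite // qm km.
have qk' : k = q.+1.
  apply/eqP; rewrite eqn_leq qk andbT leqNgt; apply/negP => h.
  have := nth_lt sR h kR; have := nth_lt sR (ltnSn q) (ltn_trans h kR).
  by rewrite qm km; clia.
rewrite qk' in kR km; rewrite (drop_nth 0 kR) km qm in E h2; rewrite qm in h1.
have [E2 /andP[h3 h4]] := sorted_split sR kR; rewrite km in h4.
rewrite E rev_cat !rev_cons !cat_rcons -!catA /=.
have hl : all (far m.+1) (rev (take q R)).
  by rewrite all_rev; apply: all_far_lt; apply: sub_all h1.
have hh : all (far m) (rev (drop q.+2 R)).
  by rewrite all_rev; apply: all_far_gt.
apply: heq_trans (heq_catl _ (heq_cons _ (heq_cons m (heq_sym (heq_swap1 hl))))) _.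
rewrite -[m :: rev _ ++ _]cat_cons; apply: heq_trans (heq_catr _ (heq_sym (heq_swap1 hh))).
rewrite -catA; apply: heq_catl.
exact: (@heq_catr (rev (take q R)) [:: m.+1; m; m.+1] [:: m; m.+1; m]) (heq_sym (heq_braid m)).
Qed.

(** If [x.+1] is in [R], a braid move turns [x] before the row into [x.+1] after it, which the lower
    rows absorb by recursion; otherwise [x] commutes to its copy in [R] and merges with it. This
    mirrors the recursion defining [ejectable]. *)
Lemma ejectable_absorb T x : inc T -> ejectable T x -> hecke_eq (x :: rowword T) (rowword T).
Proof.
elim: T x => // R T IH x [[_ sR _] _ iT] /= /andP[xR].
rewrite /rowword /= -/(rowword T); case: (boolP (x.+1 \in R)) => [x1R /= ej|x1R _].
  have h := heq_catr (rowword T) (slide_braid sR xR x1R).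
  apply: heq_trans (heq_sym h) _; rewrite -catA; apply: heq_catl; exact: IH.
exact: (heq_catr (rowword T) (absorb_left sR xR x1R)).
Qed.

(** (D) is a braid move and (DR) a bump. In (IR) and (NR) the incoming value is absorbed, by the
    rows below if it is ejectable and by [R] otherwise. (IR) then draws the ejectable [x] out of the
    rows below and bumps with it; (NR) draws [m] out of [R] itself. *)
Lemma rstep_hecke R T e al (q := (pos R e).-1) : rowst R T e -> al = ~~ ejecto T e ->
  hecke_eq (rev R ++ (if e is Some h then [:: h] else [::]) ++ rowword T)
    (nth 0 R q :: rev (set_nth 0 R q (rstep R T e al).1) ++ rowword T).
Proof.
move=> rs ale; have := rstep_facts rs ale; rewrite /= -/q.
have alN : al -> e != None by rewrite ale; case: (e).
have [[R0 sR aR] aRT iT _ _] := rs; have := rstepP R T alN; rewrite -/q.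
move: (rstep R T e al) => [x a'] /= rsp [_ qR _ me aft mx _ xR _ _ _ _].
have mR := nth_mem qR; have upm := upd_id qR; move: me mx mR rsp upm.
have [m Em] : {m | nth 0 R q = m} by exists (nth 0 R q).
rewrite !Em => me mx mR rsp upm.
have absorb : m.+1 \notin R -> (al -> exists2 h, e = Some h & h \in R) ->
    hecke_eq (rev R ++ (if e is Some h then [:: h] else [::]) ++ rowword T) (rev R ++ rowword T).
  move=> mR' h2; have [al1|] := boolP al; last first.
    rewrite ale negbK; case: (e) => [h|] /= => [ej|_]; last exact: heq_refl.
    by apply: heq_catl; apply: ejectable_absorb.
  have [h eh hR] := h2 al1; rewrite eh catA; apply: heq_catr.
  have mh : m < h by move: me; rewrite eh.
  (* [h.-1] lies strictly between [m] and [h], where [R] has no entry, so [R] absorbs [h] from the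
     right. *)
  have {mh} : m < h.-1.
    have : h != m.+1 by apply: contra mR' => /eqP <-.
    by clia.
  case: h eh hR => // h eh hR /= mh; apply: absorb_right => //; apply/negP => /memR_nth[k kR kh].
  have qk : q < k by apply: (nth_lt_inv sR); rewrite // Em kh.
  by have := aft k qk kR; rewrite kh eh /= ltnSn.
have bump y : m < y -> (forall k, q < k -> k < size R -> y < nth 0 R k) ->
    hecke_eq (rev R ++ y :: rowword T) (m :: rev (set_nth 0 R q y) ++ rowword T).
  move=> my yR; have := slide_bump sR qR (x := y); rewrite Em => /(_ my yR) h.
  by have := heq_catr (rowword T) h; rewrite -catA.
case: rsp xR mx => [h1|h eh al1 hR h1|y h1 h2 my ye ej h3|h1 h2 h3] xR mx.
- rewrite upm; have [k kR km] := memR_nth h1.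
  have qk : q < k by apply: (nth_lt_inv sR); rewrite // Em km.
  have := aft k qk kR; rewrite km; case: (e) me => //= h mh; rewrite -leqNgt => hm.
  have -> : h = m.+1 by clia.
  rewrite -[m.+1 :: _]cat1s catA; exact: (heq_catr _ (slide_braid sR mR h1)).
- by rewrite eh; apply: bump => //; move: me; rewrite eh.
- apply: heq_trans (absorb h1 h2) _; apply: heq_trans (bump y my xR).
  by apply: heq_catl; apply: heq_sym; apply: ejectable_absorb.
- apply: heq_trans (absorb h1 h2) _; rewrite upm -cat_cons; apply: heq_catr.
  by apply: heq_sym; apply: absorb_left.
Qed.

Lemma rins_hecke P r al P' m a : inc P -> outer P r -> rins P r al P' m a ->
  hecke_eq (rowword P) (m :: rowword P').
Proof.
move=> + + ri; elim: ri => {P r al P' m a} [R T|R T q|R T r al T' e a q ri IH].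
- move=> [[R0 sR aR] _ iT] /outer0 szT.
  have E : R = rcons (take (size R).-1 R) (last 0 R).
    case/lastP: (R) R0 => // s x _; rewrite size_rcons last_rcons /=.
    by rewrite -[in take _ _]cats1 take_size_cat.
  rewrite /rowword /= [in rev R]E rev_rcons; case: ifP => [/eqP s1|_]; last exact: heq_refl.
  have -> : T = [::].
    case: T iT szT => //= S T [[S0 _ _] _ _]; rewrite s1.
    by case: S S0.
  by rewrite s1 /= take0; apply: heq_refl.
- move=> [oR aR iT] /outer0 szT; have rs := rowst_None oR aR iT szT.
  exact: (rstep_hecke rs (erefl : false = ~~ ejecto T None)).
- move=> iP /outerS oT; have [rs aE] := rins_rowst iP oT ri; have [_ _ iT] := iP.
  apply: heq_trans (heq_catl (rev R) (IH iT oT)) _.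
  exact: (rstep_hecke rs aE).
Qed.

(** * From the column word to the row word *)

Definition colword (P : tab) n : seq nat := flatten [seq col P j | j <- rev (iota 0 n)].

Lemma colwordS P n : colword P n.+1 = col P n ++ colword P n.
Proof. by rewrite /colword -addn1 iotaD rev_cat. Qed.

Lemma col_cons R T j : col (R :: T) j = (if j < size R then [:: nth 0 R j] else [::]) ++ col T j.
Proof. by rewrite /col /=; case: ifP. Qed.

Lemma mem_col P j z : z \in col P j -> exists R, [/\ R \in P, j < size R & nth 0 R j = z].
Proof. by case/mapP => R; rewrite mem_filter => /andP[jR RP] ->; exists R. Qed.

(** An entry of column [n] below the first row exceeds the entry of that row in column [n], which
    exceeds those of the earlier columns. The difference is at least two, so the letters commute. *)
Lemma colword_cons R T n : inc (R :: T) -> n <= size R ->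
  hecke_eq (colword (R :: T) n) (rev (take n R) ++ colword T n).
Proof.
move=> iRT; have [[_ sR _] aRT _] := iRT; elim: n => [|n IH] nR; first by rewrite take0; apply: heq_refl.
rewrite !colwordS col_cons nR /= (take_nth 0 nR) rev_rcons cat_cons; apply: heq_cons.
apply: heq_trans (heq_catl _ (IH (ltnW nR))) _; rewrite !catA; apply: heq_catr.
apply: heq_swap; apply/allP => z /mem_col[S [ST nS <-]]; rewrite all_rev.
have [h1 h2] := inc_above iRT ST; apply: all_far_lt; apply/allP => y /memR_nth[k].
rewrite size_take nR => kn; rewrite nth_take // => <-.
by have := nth_lt sR kn nR; have := h2 n nS; clia.
Qed.

Lemma colword_rowword P n : inc P -> size (row P 0) <= n -> hecke_eq (colword P n) (rowword P).
Proof.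
elim: P n => [|R T IH] n /=.
  move=> _ _; elim: n => [|n IH]; first exact: heq_refl.
  by rewrite colwordS.
move=> iRT /= Rn; have [oR [szT _] iT] := iRT.
have -> : colword (R :: T) n = colword (R :: T) (size R).
  elim: n Rn => [|n IHn]; first by rewrite /row /= leqn0 => /eqP->.
  rewrite leq_eqVlt => /predU1P[<-//|h]; rewrite colwordS IHn //.
  case E: (col _ n) => [//|z s]; have : z \in col (R :: T) n by rewrite E inE eqxx.
  case/mem_col => S [SP nS _]; move: SP; rewrite inE => /predU1P[SR|ST].
    by move: h nS; rewrite SR /row /=; clia.
  by have [hS _] := inc_above iRT ST; move: h nS; rewrite /row /=; clia.
apply: heq_trans (colword_cons iRT (leqnn _)) _; rewrite take_size.
by apply: heq_catl; apply: IH => //; rewrite /row nth0.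
Qed.

Lemma rev_word P : rev (word P) = colword P (size (row P 0)).
Proof.
rewrite /word /colword; elim: (iota _ _) => // j s IH.
by rewrite /= rev_cat revK IH rev_cons map_rcons flatten_rcons.
Qed.

Lemma word_hecke P : inc P -> hecke_eq (rev (word P)) (rowword P).
Proof. by move=> iP; rewrite rev_word; apply: colword_rowword. Qed.

(** * Greedy matchings and minimum cuts *)

Lemma count_remE (a : pred nat) t s : t \in s -> count a s = a t + count a (rem t s).
Proof. by move=> ts; rewrite (permP (perm_to_rem ts)). Qed.

Lemma count0 (a : pred nat) s : (forall y, y \in s -> ~~ a y) -> count a s = 0.
Proof. by move=> h; apply/eqP; rewrite -leqn0 leqNgt -has_count; apply/hasPn. Qed.

Lemma count_sub_in (T : eqType) (a b : pred T) s : (forall y, y \in s -> a y -> b y) ->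
  count a s <= count b s.
Proof.
elim: s => //= y s IH h; apply: leq_add.
  by case: (boolP (a y)) => // /h->; rewrite ?inE ?eqxx.
by apply: IH => z zs; apply: h; rewrite inE zs orbT.
Qed.

Lemma count_sub_add (a b c : pred nat) s : (forall y, a y -> b y || c y) ->
  count a s <= count b s + count c s.
Proof.
move=> h; elim: s => //= y s IH; move: (h y).
by case: (a y) (b y) (c y) => [] [] [] //= hy; first [by have := hy isT | clia].
Qed.

Lemma count_sort (a : pred nat) s : count a (sort leq s) = count a s.
Proof. by apply/permP; rewrite perm_sort. Qed.

(** Weak duality: a picked value in [[v, u[] is charged to [av], and one that is at least [u] to the
    larger [s] that picked it. *)
Lemma pick_lt_le av ss v u :
  count (leq v) (pick_lt av ss) <= count (fun y => v <= y < u) av + count (leq u.+1) ss.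
Proof.
elim: ss av => //= s ss IH av; case E: [seq t <- av | t < s] => [|z zs].
  by apply: leq_trans (IH av) _; rewrite leq_add2l leq_addl.
rewrite -E; have := @seqmax_mem [seq t <- av | t < s]; rewrite E => /(_ isT).
rewrite -E mem_filter => /andP[]; move: (seqmax _) => t ts tav /=.
by have := IH (rem t av); rewrite (count_remE _ tav); clia.
Qed.

(* Minimality of the greedy matching: together with [pick_lt_le], this is
   Koenig's theorem for the relation [t < s], the covers being given by a cut. *)
Lemma pick_lt_cut av ss v : sorted geq ss ->
  exists u, count (fun y => v <= y < u) av + count (leq u.+1) ss <= count (leq v) (pick_lt av ss).
Proof.
elim: ss av => [|s ss IH] av /= sss.
  by exists v; rewrite addn0 leqn0; apply/eqP/count0 => y _; clia.
have ges y : y \in ss -> y <= s.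
  have /allP h : all (geq s) ss.
    by apply: order_path_min sss => a b c /= ab bc; apply: leq_trans ab.
  exact: h.
have cut0 : (forall y, y \in av -> ~~ (v <= y < s)) -> exists u,
    count (fun y => v <= y < u) av + ((u < s) + count (leq u.+1) ss) <= 0.
  move=> h; exists s; rewrite ltnn count0 // count0 // => y /ges.
  by rewrite -leqNgt.
case E: [seq t <- av | t < s] => [|z zs].
  have [|u hu] := cut0; last by exists u; apply: leq_trans hu _.
  move=> y yav; apply/negP => /andP[_ ys].
  by have := mem_filter (fun t => t < s) y av; rewrite E ys yav.
rewrite -E; have ne : [seq t <- av | t < s] != [::] by rewrite E.
have := seqmax_mem ne; have mx := @seqmax_ge [seq t <- av | t < s].
rewrite mem_filter => /andP[]; move: (seqmax _) mx => t mx ts tav /=.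
have gap y : y \in av -> t < y -> s <= y.
  move=> yav ty; rewrite leqNgt; apply/negP => ys.
  by have := mx y; rewrite mem_filter ys yav => /(_ isT); clia.
have [vt|tv] := leqP v t; last first.
  have [|u hu] := cut0; last by exists u; apply: leq_trans hu _.
  by move=> y yav; apply/negP => /andP[vy ys]; have := gap y yav; clia.
have [u hu] := IH (rem t av) (path_sorted sss).
(* The cut [u] of the remaining problem is kept unless it charges both [t] and [s]. In that case it
   is moved to [s]: [s] is spared, the gap between [t] and [s] adds nothing, and no later element
   exceeds [s]. *)
have [/andP[tu us]|nus] := boolP (t < u < s); last first.
  exists u; rewrite (count_remE _ tav) vt /=.
  by move: nus hu; case: (ltnP t u); case: (ltnP u s) => //=; clia.
have h1 : count (fun y => v <= y < s) (rem t av) <= count (fun y => v <= y < u) (rem t av).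
  apply: count_sub_in => y /mem_rem yav /andP[vy ys].
  by rewrite vy /= ltnNge; apply/negP => uy; have := gap y yav; clia.
have h2 : count (leq s.+1) ss = 0 by apply: count0 => y /ges; rewrite -leqNgt.
by exists s; rewrite (count_remE _ tav) h2; clia.
Qed.

Lemma tri_lt_le T S v u :
  count (leq v) (tri_lt T S) <= count (fun y => v <= y < u) T + count (leq u.+1) S.
Proof.
by rewrite count_sort; apply: leq_trans (pick_lt_le _ _ _ u) _; rewrite count_rev count_sort.
Qed.

Lemma tri_lt_cut T S v :
  exists u, count (fun y => v <= y < u) T + count (leq u.+1) S <= count (leq v) (tri_lt T S).
Proof.
have [|u hu] := @pick_lt_cut T (rev (sort leq S)) v.
  by rewrite rev_sorted; apply: sort_sorted leq_total S.
by exists u; rewrite count_sort; move: hu; rewrite count_rev count_sort.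
Qed.

Lemma seqmin_le s x : x \in s -> seqmin s <= x.
Proof.
rewrite /seqmin; move: (head 0 s) => d.
elim: s => //= y s IH; rewrite inE geq_min => /predU1P[->|/IH ->]; by rewrite ?leqnn ?orbT.
Qed.

Lemma seqmin_mem s : s != [::] -> seqmin s \in s.
Proof.
case: s => // x s _; rewrite /seqmin [head _ _]/=.
suff h t : foldr minn x t \in x :: t.
  by have := h (x :: s); rewrite !inE orbA orbb.
elim: t => [|y t IH] /=; first by rewrite inE.
rewrite /minn; case: ifP => _; first by rewrite !inE eqxx orbT.
by move: IH; rewrite !inE => /orP[->//|->]; rewrite !orbT.
Qed.

Lemma pick_ge_le av ss v u :
  count (gtn v) (pick_ge av ss) <= count (fun y => u <= y < v) av + count (gtn u) ss.
Proof.
elim: ss av => //= s ss IH av; case E: [seq t <- av | s <= t] => [|z zs].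
  by apply: leq_trans (IH av) _; rewrite leq_add2l leq_addl.
rewrite -E; have := @seqmin_mem [seq t <- av | s <= t]; rewrite E => /(_ isT).
rewrite -E mem_filter => /andP[]; move: (seqmin _) => t ts tav /=.
by have := IH (rem t av); rewrite (count_remE _ tav); clia.
Qed.

(** The exchange of [pick_lt_cut] with the order reversed; the relation is now [s <= t], so a cut
    charges both ends when [s < u <= t]. *)
Lemma pick_ge_cut av ss v : sorted leq ss ->
  exists u, count (fun y => u <= y < v) av + count (gtn u) ss <= count (gtn v) (pick_ge av ss).
Proof.
elim: ss av => [|s ss IH] av /= sss.
  by exists v; rewrite addn0 leqn0; apply/eqP/count0 => y _; clia.
have ges y : y \in ss -> s <= y.
  have /allP h : all (leq s) ss by apply: order_path_min sss; apply: leq_trans.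
  exact: h.
have cut0 : (forall y, y \in av -> ~~ (s <= y < v)) -> exists u,
    count (fun y => u <= y < v) av + ((s < u) + count (gtn u) ss) <= 0.
  move=> h; exists s; rewrite ltnn count0 // count0 // => y /ges.
  by rewrite -leqNgt.
case E: [seq t <- av | s <= t] => [|z zs].
  have [|u hu] := cut0; last by exists u; apply: leq_trans hu _.
  move=> y yav; apply/negP => /andP[ys _].
  by have := mem_filter (fun t => s <= t) y av; rewrite E ys yav.
rewrite -E; have ne : [seq t <- av | s <= t] != [::] by rewrite E.
have := seqmin_mem ne; have mx := @seqmin_le [seq t <- av | s <= t].
rewrite mem_filter => /andP[]; move: (seqmin _) mx => t mx ts tav /=.
have gap y : y \in av -> y < t -> y < s.
  move=> yav ty; rewrite ltnNge; apply/negP => ys.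
  by have := mx y; rewrite mem_filter ys yav => /(_ isT); clia.
have [vt|tv] := leqP v t.
  have [|u hu] := cut0; last by exists u; apply: leq_trans hu _.
  by move=> y yav; apply/negP => /andP[vy ys]; have := gap y yav; clia.
have [u hu] := IH (rem t av) (path_sorted sss).
have [/andP[tu us]|nus] := boolP (s < u <= t); last first.
  exists u; rewrite (count_remE _ tav) tv andbT /=.
  by move: nus hu; case: (leqP u t); case: (ltnP s u) => //=; clia.
have h1 : count (fun y => s <= y < v) (rem t av) <= count (fun y => u <= y < v) (rem t av).
  apply: count_sub_in => y /mem_rem yav /andP[ys vy].
  by rewrite vy andbT leqNgt; apply/negP => uy; have := gap y yav; clia.
have h2 : count (gtn s) ss = 0 by apply: count0 => y /ges; rewrite -leqNgt.
by exists s; rewrite (count_remE _ tav) h2; clia.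
Qed.

Lemma tri_ge_le T S v u :
  count (gtn v) (tri_ge T S) <= count (fun y => u <= y < v) T + count (gtn u) S.
Proof.
by rewrite count_sort; apply: leq_trans (pick_ge_le _ _ _ u) _; rewrite count_sort.
Qed.

Lemma tri_ge_cut T S v :
  exists u, count (fun y => u <= y < v) T + count (gtn u) S <= count (gtn v) (tri_ge T S).
Proof.
have [u hu] := @pick_ge_cut T (sort leq S) v (sort_sorted leq_total S).
by exists u; rewrite count_sort; move: hu; rewrite count_sort.
Qed.

(* The cuts of an iterated product [C k <| (C k.+1 <| (...))]: column [C k] is
   charged for the window [v, u[, the next one for the window starting at [u.+1]. *)
Fixpoint wcost (C : nat -> seq nat) k v us : nat :=
  if us is u :: us' then count (fun y => v <= y < u) (C k) + wcost C k.+1 u.+1 us'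
  else count (leq v) (C k).

Fixpoint qcost (C : nat -> seq nat) k v us : nat :=
  if us is u :: us' then count (fun y => u <= y < v) (C k) + qcost C k.+1 u us'
  else count (gtn v) (C k).

Definition nestc op (C : nat -> seq nat) k n := nest op [seq C i | i <- iota k n.+1].

Lemma nestcS op C k n : nestc op C k n.+1 = op (C k) (nestc op C k.+1 n).
Proof. by []. Qed.

Lemma nest_lt_le C k us v : count (leq v) (nestc tri_lt C k (size us)) <= wcost C k v us.
Proof.
elim: us k v => [|u us IH] k v //; rewrite [size _]/= nestcS.
by apply: leq_trans (tri_lt_le _ _ _ u) _; rewrite leq_add2l; apply: IH.
Qed.

Lemma nest_lt_ex C k n v : exists2 us, size us = n &
  wcost C k v us <= count (leq v) (nestc tri_lt C k n).
Proof.
elim: n k v => [|n IH] k v; first by exists [::].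
rewrite nestcS; have [u hu] := tri_lt_cut (C k) (nestc tri_lt C k.+1 n) v.
have [us su hus] := IH k.+1 u.+1; exists (u :: us); first by rewrite /= su.
apply: leq_trans hu.
by rewrite [wcost _ _ _ _]/= leq_add2l.
Qed.

Lemma nest_ge_le C k us v : count (gtn v) (nestc tri_ge C k (size us)) <= qcost C k v us.
Proof.
elim: us k v => [|u us IH] k v //; rewrite [size _]/= nestcS.
by apply: leq_trans (tri_ge_le _ _ _ u) _; rewrite leq_add2l; apply: IH.
Qed.

Lemma nest_ge_ex C k n v : exists2 us, size us = n &
  qcost C k v us <= count (gtn v) (nestc tri_ge C k n).
Proof.
elim: n k v => [|n IH] k v; first by exists [::].
rewrite nestcS; have [u hu] := tri_ge_cut (C k) (nestc tri_ge C k.+1 n) v.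
have [us su hus] := IH k.+1 u; exists (u :: us); first by rewrite /= su.
apply: leq_trans hu.
by rewrite [qcost _ _ _ _]/= leq_add2l.
Qed.

(** Comparison of minimum cut costs, stated cut by cut. Quantifying over the starting value [v]
    makes it local: by [wle_up], it need only be proved from the first column that differs. *)
Definition wle k n C C' := forall v us, size us = n ->
  exists2 us', size us' = n & wcost C k v us' <= wcost C' k v us.

Lemma wle_trans k n C C' C'' : wle k n C C' -> wle k n C' C'' -> wle k n C C''.
Proof.
move=> h1 h2 v us hu; have [us2 s2 c2] := h2 v us hu; have [us1 s1 c1] := h1 v us2 s2.
by exists us1 => //; apply: leq_trans c2.
Qed.

Lemma wcost_perm C C' k v us : (forall i, k <= i <= k + size us -> perm_eq (C i) (C' i)) ->
  wcost C k v us = wcost C' k v us.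
Proof.
elim: us k v => [|u us IH] k v h /=; first by apply/permP/h; rewrite addn0 !leqnn.
congr (_ + _); first by apply/permP/h; rewrite leqnn leq_addr.
by apply: IH => i hi; apply: h => /=; clia.
Qed.

Lemma wle_perm k n C C' : (forall i, k <= i <= k + n -> perm_eq (C i) (C' i)) -> wle k n C C'.
Proof. by move=> h v us su; exists us => //; rewrite (@wcost_perm C C') // su. Qed.

Lemma wle_up k d n C C' : (forall i, k <= i < k + d -> perm_eq (C i) (C' i)) ->
  wle (k + d) n C C' -> wle k (d + n) C C'.
Proof.
elim: d k => [|d IH] k h hw; first by rewrite addn0 in hw.
have h' i : k.+1 <= i < k.+1 + d -> perm_eq (C i) (C' i) by move=> hi; apply: h; clia.
have hw' : wle (k.+1 + d) n C C' by rewrite addSnnS.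
move=> v [|u us] //= [su]; have [us' su' hus] := IH k.+1 h' hw' u.+1 us su.
exists (u :: us') => /=; first by rewrite su'.
apply: leq_add => //; rewrite (permP (h k _)) //; clia.
Qed.

Lemma wle_nest n C C' v : wle 0 n C C' ->
  count (leq v) (nestc tri_lt C 0 n) <= count (leq v) (nestc tri_lt C' 0 n).
Proof.
move=> h; have [us su hu] := nest_lt_ex C' 0 n v; have [us' su' hu'] := h v us su.
by apply: leq_trans hu; apply: leq_trans hu'; rewrite -su'; apply: nest_lt_le.
Qed.

Lemma wcost_shift C k a b us :
  wcost C k a us <= count (fun y => a <= y < b) (C k) + wcost C k b us.
Proof.
case: us => [|u us] /=; last rewrite addnA leq_add2r; apply: count_sub_add => y.
  by move=> ->; rewrite /= ltnNge orNb.
by case/andP=> -> ->; rewrite andbT ltnNge orNb.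
Qed.

Definition addf e p (C : nat -> seq nat) k := if k == p then e :: C k else C k.

Lemma wle_addf k n e p C : wle k n C (addf e p C).
Proof.
move=> v us su; exists us => //; elim: us k v {su} => [|u us IH] k v /=.
  by rewrite /addf; case: eqP => //= _; rewrite leq_addl.
by apply: leq_add => //; rewrite /addf; case: eqP => //= _; rewrite leq_addl.
Qed.

Lemma wcost_addf_gt k e p C v us : p < k -> wcost (addf e p C) k v us = wcost C k v us.
Proof.
move=> pk; apply: wcost_perm => i /andP[ki _]; rewrite /addf gtn_eqF //.
exact: leq_trans ki.
Qed.

(* A cut charging the extra element [e] of column [p] is moved down to [e]. *)
Lemma wle_drop p n e C :
  (forall u, count (fun y => e < y <= u) (C p.+1) <= count (fun y => e <= y < u) (C p)) ->
  wle p n.+1 (addf e p C) C.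
Proof.
move=> H v [|u us] // su; have [/andP[ve eu]|ne] := boolP (v <= e < u); last first.
  exists (u :: us) => //=; rewrite wcost_addf_gt // leq_add2r /addf eqxx /=.
  by rewrite (negbTE ne).
exists (e :: us) => //=; rewrite wcost_addf_gt // /addf eqxx /= ltnn andbF add0n.
have h1 := wcost_shift C p.+1 e.+1 u.+1 us.
have h2 := count_cat; have h3 := H u.
have h4 : count (fun y => v <= y < e) (C p) + count (fun y => e <= y < u) (C p)
    <= count (fun y => v <= y < u) (C p).
  elim: (C p) => //= y s IH; apply: leq_trans (_ : ((v <= y < e) + (e <= y < u)) +
    (count (fun y => v <= y < e) s + count (fun y => e <= y < u) s) <= _); first by clia.
  by apply: leq_add => //; clia.
have h5 : count (fun y => e < y < u.+1) (C p.+1) = count (fun y => e < y <= u) (C p.+1) by [].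
by clia.
Qed.

(* A cut charging the extra element [x] of column [k.+1] has its previous
   separator moved up to [x]. *)
Lemma wle_add k n x C :
  (forall u, u < x -> count (fun y => u <= y < x) (C k) <= count (fun y => u < y <= x) (C k.+1)) ->
  wle k n.+2 (addf x k.+1 C) C.
Proof.
move=> H v [|u [|w us]] // su; have [/andP[ux xw]|ne] := boolP (u < x < w); last first.
  exists (u :: w :: us) => //=; rewrite wcost_addf_gt // addnA addnA leq_add2r /addf eqxx /=.
  by rewrite ltn_eqF // (negbTE ne).
exists (x :: w :: us) => //=; rewrite wcost_addf_gt // !addnA leq_add2r /addf eqxx /=.
rewrite ltn_eqF // ltnn add0n; have h1 := H u ux.
have h2 : count (fun y => v <= y < x) (C k) <=
    count (fun y => v <= y < u) (C k) + count (fun y => u <= y < x) (C k).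
  by apply: count_sub_add => y /andP[-> ->]; rewrite andbT ltnNge orNb.
have h3 : count (fun y => u < y <= x) (C k.+1) + count (fun y => x < y < w) (C k.+1) <=
    count (fun y => u < y < w) (C k.+1).
  elim: (C k.+1) => //= y s IH; apply: leq_trans (_ : ((u < y <= x) + (x < y < w)) +
    (count (fun y => u < y <= x) s + count (fun y => x < y < w) s) <= _); first by clia.
  by apply: leq_add => //; clia.
by clia.
Qed.

(** A separator [u] in [[m, x[] spares [m] but charges [x]. It is moved up to [z], where [x] is
    spared too; the elements of [B] no longer charged pay for the wider window in column [k]. One
    separator is enough because the replaced entry is in the last column. *)
Lemma wle_replace k m x B C C' : perm_eq (C k) (C' k) -> perm_eq (C k.+1) (m :: B) ->
  perm_eq (C' k.+1) (x :: B) ->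
  (exists2 z, x <= z & forall u, m <= u < x ->
     count (fun y => u <= y < z) (C k) <= count (fun y => u < y <= z) B) ->
  wle k 1 C' C.
Proof.
move=> pk pC pC' [z xz H] v [|u [|]] // _.
have [/andP[mu ux]|ne] := boolP (m <= u < x); last first.
  exists [:: u] => //=; rewrite -(permP pk) leq_add2l (permP pC) (permP pC') /=.
  by rewrite leq_add2r; clia.
exists [:: z] => //=; rewrite -(permP pk) (permP pC) (permP pC') /=.
have h1 := H u; rewrite mu ux in h1; have {h1} h1 := h1 isT.
have h2 : count (fun y => v <= y < z) (C k) <=
    count (fun y => v <= y < u) (C k) + count (fun y => u <= y < z) (C k).
  by apply: count_sub_add => y /andP[-> ->]; rewrite andbT ltnNge orNb.
have h3 : count (fun y => u < y <= z) B + count (leq z.+1) B <= count (leq u.+1) B.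
  elim: B {pC pC' H h1} => //= y s IH; apply: leq_trans (_ : ((u < y <= z) + (z < y)) +
    (count (fun y => u < y <= z) s + count (leq z.+1) s) <= _); first by clia.
  by apply: leq_add => //; clia.
by clia.
Qed.

Lemma wle_replace_up k n m x B C C' : m <= x ->
  (forall i, i != k + n -> perm_eq (C i) (C' i)) ->
  perm_eq (C (k + n)) (m :: B) -> perm_eq (C' (k + n)) (x :: B) -> wle k n C C'.
Proof.
move=> mx h pC pC' v us su; exists us => //; rewrite -su in h pC pC'.
elim: us k v h pC pC' {su} => [|u us IH] k v h pC pC' /=.
  rewrite addn0 in pC pC'; rewrite (permP pC) (permP pC') /= leq_add2r.
  by case: (leqP v m) => // vm; rewrite (leq_trans vm mx).
rewrite /= -addSnnS in h pC pC'; rewrite (permP (h k _)); last by rewrite ltn_eqF // leq_addr.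
by rewrite leq_add2l IH.
Qed.

(** * Invariance of the cuts under reverse insertion *)

Lemma col_cat A B j : col (A ++ B) j = col A j ++ col B j.
Proof. by rewrite /col filter_cat map_cat. Qed.

Lemma count_col (a : pred nat) X j :
  count a (col X j) = count (fun S => (j < size S) && a (nth 0 S j)) X.
Proof.
by rewrite /col count_map count_filter; apply: eq_count => S /=; rewrite andbC.
Qed.

Lemma inc_sorted P R : inc P -> R \in P -> sorted ltn R.
Proof. by move=> iP /(inc_okrow iP)[]. Qed.

Lemma col_ge T j z x : inc T -> (j < size (head [::] T) -> x <= nth 0 (head [::] T) j) ->
  z \in col T j -> x <= z.
Proof.
case: T => [|R T] // iT /= h /mem_col[S [ST jS <-]].
move: ST; rewrite inE => /predU1P[SR|ST]; first by rewrite SR in jS *; apply: h.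
have [h1 h2] := inc_above iT ST; apply: leq_trans (h _) (ltnW (h2 j jS)).
exact: leq_trans jS h1.
Qed.

Lemma count_col_sub (a b : pred nat) j k X :
  (forall S, S \in X -> j < size S -> a (nth 0 S j) -> (k < size S) && b (nth 0 S k)) ->
  count a (col X j) <= count b (col X k).
Proof.
move=> h; rewrite !count_col; apply: count_sub_in => S SX /andP[jS aS]; exact: h.
Qed.

Lemma ejectable_head_notin R q x m : sorted ltn R -> q < size R -> nth 0 R q = m -> m < x ->
  m \notin set_nth 0 R q x.
Proof. by move=> sR qR Em mx; rewrite mem_upd // Em eqxx andbF orbF ltn_eqF. Qed.

Section RowStep.
Variables (R : seq nat) (T : tab) (e : option nat) (p q m x : nat) (a : bool).
Hypotheses (rs : rowst R T e) (F : row_facts R T e p q m x a) (Ep : p = pos (head [::] T) e).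
Let R' := set_nth 0 R q x.

(** The destination [z] of the separator displaced in [wle_replace]: the left neighbour has no more
    entries below [z] than column [j] has up to [z]. *)
Definition excess j k (C : nat -> seq nat) :=
  exists2 z, k <= z & count (gtn z) (C j.-1) <= count (geq z) (C j).

(** In (DR) with [p = q], column [q] gains a counted entry and column [q.-1] at most one, so the
    witness from below survives. In the third case of [rf_key], take [z = x]: the rows below have
    nothing under [x] in column [q.-1], and [x] itself is counted in column [q]. *)
Lemma rstep_excess :
  (p = q -> forall h, e = Some h -> h \notin head [::] T -> 0 < p /\ excess p h (col T)) ->
  m \notin R' -> 0 < q /\ excess q m (col (R' :: T)).
Proof.
have [[R0 sR aR] _ iT _ _] := rs; have [_ qR Em _ _ mx _ _ _ _ _ key] := F => IH mR'.
have q1 : q.-1 < size R by clia.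
have qR' : q < size R' by rewrite size_upd.
have q1R' : q.-1 < size R' by rewrite size_upd.
have x1 z : x <= z -> 0 < count (geq z) (col (R' :: T) q).
  by move=> xz; rewrite col_cons qR' /= nth_upd eqxx /geq /= xz.
case: key => [[xm _]|[eh pq hT hR]|[ltmx q0 _ K2]].
- by move: mR'; rewrite /R' xm -Em upd_id // nth_mem.
- have [p0 [z hz cz]] := IH pq x eh hT; rewrite pq in p0 cz; split=> //.
  exists z; first exact: leq_trans hz.
  rewrite !col_cons qR' q1R' !count_cat; apply: leq_add => //=.
  by rewrite !nth_upd eqxx /geq /= hz; case: (_ < _).
- split=> //; exists x; first exact: ltnW.
  apply: leq_trans (x1 x (leqnn x)); rewrite col_cons q1R' /= (@count0 _ (col T _)).
    by rewrite addn0; case: (_ < _).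
  move=> y yT; rewrite -leqNgt; apply: (col_ge iT _ yT) => h; apply: K2 => //; clia.
Qed.

Variables (A : tab) (j : nat).
Hypothesis iX : inc (A ++ R :: T).
Let X := A ++ R :: T.
Let X' := A ++ R' :: T.

Definition weq C C' := wle 0 j C C' /\ wle 0 j C' C.

Lemma weq_refl C : weq C C. Proof. by split; apply: wle_perm. Qed.

Lemma weq_sym C C' : weq C C' -> weq C' C. Proof. by case. Qed.

Lemma weq_trans C C' C'' : weq C C' -> weq C' C'' -> weq C C''.
Proof. by move=> [h1 h2] [h3 h4]; split; [apply: wle_trans h3 | apply: wle_trans h2]. Qed.

Lemma weq_perm C C' : (forall i, i <= j -> perm_eq (C i) (C' i)) -> weq C C'.
Proof. by move=> h; split; apply: wle_perm => i; [|rewrite perm_sym]; apply: h. Qed.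

Let colX i : col X i = col A i ++ (if i < size R then [:: nth 0 R i] else [::]) ++ col T i.
Proof. by rewrite /X col_cat col_cons. Qed.

Let colX'ne i : i != q -> col X' i = col X i.
Proof.
move=> iq; have [_ qR _ _ _ _ _ _ _ _ _ _] := F.
by rewrite /X' colX col_cat col_cons /R' size_upd // nth_upd (negbTE iq).
Qed.

Let colXq : perm_eq (col X q) (m :: col A q ++ col T q).
Proof.
have [_ qR <- _ _ _ _ _ _ _ _ _] := F.
by rewrite colX qR perm_catC /= perm_cons perm_catC.
Qed.

Let colX'q : perm_eq (col X' q) (x :: col A q ++ col T q).
Proof.
have [_ qR _ _ _ _ _ _ _ _ _ _] := F.
by rewrite /X' col_cat col_cons size_upd // qR nth_upd eqxx perm_catC /= perm_cons perm_catC.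
Qed.

Let sX S : S \in X -> sorted ltn S. Proof. exact: inc_sorted. Qed.

Let iT : inc T. Proof. by case: rs. Qed.

Let aboveA S : S \in A -> above S R.
Proof. by move=> SA; have [] := inc_catl iX SA. Qed.

(** A row with an entry in []h, u]] in column [p.+1] also has one in [[h, u[] in column [p]: [R] and
    the rows above it have at most [h] in column [p.+1], and the rows below have at least [h] in
    column [p]. This is the hypothesis of [wle_drop]. *)
Lemma weq_drop h : p < j -> e = Some h -> h \notin head [::] T -> p.+1 < size R ->
  nth 0 R p.+1 <= h -> weq (addf h p (col X)) (col X).
Proof.
move=> pj eh hT pR hp; split; last exact: wle_addf.
have -> : j = p + (j - p.+1).+1 by clia.
apply: wle_up => [i /andP[_ ip]|]; first by rewrite /addf ltn_eqF.
rewrite add0n; apply: wle_drop => u; apply: count_col_sub => S SX pS /andP[hS Su].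
have Sp : nth 0 S p < nth 0 S p.+1 by apply: nth_lt => //; apply: sX.
rewrite (ltnW pS) (leq_trans Sp Su) andbT /=; move: SX; rewrite mem_cat inE => /or3P[SA|/eqP SR|ST].
- have [h1 h2] := aboveA SA; have := h2 _ pR; clia.
- by move: hS; rewrite SR ltnNge hp.
- have sT : sorted ltn (head [::] T) := inc_head_sorted iT.
  apply: (@col_ge T p) => //; last first.
    by apply/mapP; exists S; rewrite // mem_filter ST (ltnW pS).
  by rewrite Ep eh => ?; apply: pos_ge.
Qed.

Definition fcol (b : bool) h k C := if b then addf h k C else C.

(* The column [p] of the partially treated tableau carries the value [h] emitted by
   the rows below as an extra entry, unless it is still present in its row. *)
Definition fe := if e is Some h then fcol ((p < j) && (h \notin head [::] T)) h p (col X) else col X.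

Lemma weq_fe : (forall h, e = Some h -> h \notin head [::] T -> p.+1 < size R /\ nth 0 R p.+1 <= h) ->
  weq fe (col X).
Proof.
rewrite /fe /fcol; case E: e => [h|] h1; last exact: weq_refl.
by case: ifP => [/andP[pj hT]|_]; [have [] := h1 h erefl hT; apply: weq_drop | apply: weq_refl].
Qed.

Lemma weq_replace : m < x -> j = q -> 0 < q ->
  (exists2 z, x <= z & forall u, m <= u < x ->
     count (fun y => u <= y < z) (col T q.-1) <= count (fun y => u < y <= z) (col T q)) ->
  weq (col X) (col X').
Proof.
move=> mx jq q0 [z xz hz]; have [_ qR Em _ _ _ _ _ _ _ _ _] := F; split.
  apply: (@wle_replace_up 0 j m x (col A q ++ col T q)); rewrite ?add0n ?jq //; first exact: ltnW.
  by move=> i /colX'ne ->.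
have -> : j = q.-1 + 1 by clia.
apply: (@wle_up 0 q.-1 1) => [i /andP[_ iq]|]; first by rewrite colX'ne //; clia.
have q1 : q.-1.+1 = q by clia.
rewrite add0n; apply: (@wle_replace _ m x (col A q ++ col T q)); rewrite ?q1 //.
  by rewrite colX'ne //; clia.
exists z => // u mux; rewrite colX !count_cat; apply: leq_trans (leq_addl _ _).
rewrite (@count0 _ (col A _)) => [|y /mem_col[S [SA qS <-]]]; last first.
  have [h1 h2] := aboveA SA; have sS : sorted ltn S by apply: sX; rewrite mem_cat SA.
  have := h2 q qR; rewrite Em; have := nth_le sS (leq_pred q) (leq_trans qR h1); clia.
rewrite add0n (_ : count _ (if _ then _ else _) = 0) ?add0n; first exact: hz.
have sR : sorted ltn R by apply: sX; rewrite mem_cat inE eqxx orbT.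
by case: ifP => //= q1R; have := nth_lt sR _ qR => /(_ q.-1); rewrite Em; clia.
Qed.

(** A row with an entry in [[u, x[] in column [q.-1] also has one in []u, x]] in column [q]: such a
    row is [R] or above it, where column [q] is at most [m], since below [R] column [q.-1] has
    nothing under [x]. *)
Lemma weq_add : m < x -> q < j -> 0 < q ->
  (forall k, k < size (head [::] T) -> q <= k.+1 -> x <= nth 0 (head [::] T) k) ->
  weq (addf x q (col X)) (col X).
Proof.
move=> mx qj q0 K2; have [_ qR Em _ _ _ _ _ _ _ _ _] := F; split; last exact: wle_addf.
have -> : j = q.-1 + (j - q.+1).+2 by clia.
apply: wle_up => [i /andP[_ iq]|]; first by rewrite /addf ltn_eqF //; clia.
rewrite add0n -[in addf _ q _](prednK q0); apply: wle_add => u ux; apply: count_col_sub => S SX pS /andP[uS Sx].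
have q1 : q.-1.+1 = q by clia.
rewrite q1; have [qS Sm] : q < size S /\ nth 0 S q <= x.
  move: SX; rewrite mem_cat inE => /or3P[SA|/eqP SR|ST].
  - have [h1 h2] := aboveA SA; have := h2 q qR; rewrite Em => ?; split; clia.
  - by rewrite SR; split=> //; clia.
  - have zT : nth 0 S q.-1 \in col T q.-1.
      by apply/mapP; exists S; rewrite // mem_filter ST pS.
    by have := col_ge iT (fun h => K2 _ h (leqSpred q)) zT; clia.
rewrite qS Sm andbT /=; apply: leq_ltn_trans uS _; apply: nth_lt => //; first exact: sX.
by clia.
Qed.

(** For [q < j], adjoining [x] to the old columns and [m] to the new ones gives the same multisets
    ([swap]), so one row amounts to dropping [h] and adding [x]; when (DR) goes straight up, [h]
    already is that [x]. For [q = j] no separator follows column [q], and the replacement must be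
    free by itself, which is where [excess] is used. *)
Lemma weq_rstep :
  (j = p -> forall h, e = Some h -> h \notin head [::] T -> 0 < p /\ excess p h (col T)) ->
  weq fe (fcol ((q < j) && (m \notin R')) m q (col X')).
Proof.
move=> HC; have [pq qR Em _ _ mx _ _ _ _ _ key] := F.
have sR : sorted ltn R by apply: sX; rewrite mem_cat inE eqxx orbT.
have agree i : i != q -> perm_eq (col X i) (col X' i) by move=> /colX'ne ->.
have swap : weq (addf x q (col X)) (addf m q (col X')).
  apply: weq_perm => i _; rewrite /addf; case: eqP => [->|/eqP /agree //].
  rewrite (perm_trans (_ : perm_eq _ (x :: m :: col A q ++ col T q))) ?perm_cons //.
  rewrite perm_sym (perm_trans (_ : perm_eq _ (m :: x :: col A q ++ col T q))) ?perm_cons //.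
  by rewrite -[[:: m, x & _]]/([:: m] ++ [:: x] ++ _) perm_catCA.
case: key => [[xm K1]|[eh epq hT hR]|[ltmx q0 K1 K2]].
- apply: weq_trans (weq_fe K1) _.
  rewrite /fcol (_ : m \notin R' = false) ?andbF; last first.
    by rewrite /R' xm -Em upd_id // nth_mem.
  by rewrite /X' /R' xm -Em upd_id //; apply: weq_refl.
- have ltmx : m < x.
    rewrite ltn_neqAle mx andbT; apply: contra hR => /eqP <-.
    by rewrite -Em nth_mem.
  have mR' : m \notin R' by apply: ejectable_head_notin.
  rewrite /fe eh hT mR' !andbT epq /fcol; case: ifP => qj; first exact: swap.
  have [jq|njq] := eqVneq j q; last first.
    by apply: weq_perm => i ij; apply: agree; clia.
  have jp : j = p by rewrite jq epq.
  have [p0 [z xz cz]] := HC jp x eh hT; rewrite epq in p0 cz.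
  apply: weq_replace => //; exists z => // u /andP[mu ux].
  apply: leq_trans (_ : count (gtn z) (col T q.-1) <= _).
    by apply: sub_count => y /= /andP[_ ->].
  apply: leq_trans cz _; apply: count_sub_in => y yT; rewrite /geq /= => ->; rewrite andbT.
  apply: leq_trans ux _; apply: (col_ge iT _ yT) => hq.
  have : x <= nth 0 (head [::] T) (pos (head [::] T) e).
    by rewrite eh; apply: pos_ge; rewrite ?inc_head_sorted // -eh -Ep epq.
  by rewrite -Ep epq.
- apply: weq_trans (weq_fe K1) _.
  have mR' : m \notin R' by apply: ejectable_head_notin.
  rewrite /fcol mR' andbT; case: ifP => qj.
    apply: weq_trans swap; apply: weq_sym; exact: weq_add.
  have [jq|njq] := eqVneq j q; last first.
    by apply: weq_perm => i ij; apply: agree; clia.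
  apply: weq_replace => //; exists x => // u /andP[mu ux].
  rewrite count0 // => y yT; rewrite negb_and -leqNgt -ltnNge.
  apply/orP; right; apply: (col_ge iT _ yT) => hq; apply: K2 => //; clia.
Qed.
End RowStep.

Lemma outer0I R T : size (head [::] T) < size R -> outer (R :: T) 0.
Proof. by rewrite -nth0. Qed.

Lemma del_pos R T : inc (R :: T) -> size (head [::] T) < size R ->
  pos (head [::] (if size R == 1 then T else take (size R).-1 R :: T)) (Some (last 0 R)) =
    (size R).-1.
Proof.
move=> [[R0 sR aR] aRT iT] szT; case: ifP => [/eqP s1|_]; last by case: (ins_take sR R0).
by case: (head _ _) szT => //=; rewrite s1.
Qed.

Lemma col_del R T i : inc (R :: T) -> size (head [::] T) < size R ->
  col (R :: T) i = (if i == (size R).-1 then [:: last 0 R] else [::]) ++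
    col (if size R == 1 then T else take (size R).-1 R :: T) i.
Proof.
move=> [[R0 sR aR] aRT iT] szT; have sz : 0 < size R by case: (R) R0.
have st : size (take (size R).-1 R) = (size R).-1 by rewrite size_take; case: ltnP; clia.
rewrite col_cons -nth_last; have [s1|s1] := eqVneq (size R) 1.
  by rewrite s1; case: i.
rewrite col_cons st catA; congr (_ ++ _); case: (ltngtP i (size R).-1) => [ic|ic|->].
- by rewrite nth_take //; case: ltnP => //; clia.
- by case: ltnP => //; clia.
- by case: ltnP => //; clia.
Qed.

Lemma del_notin R T : inc (R :: T) -> size (head [::] T) < size R ->
  last 0 R \notin head [::] (if size R == 1 then T else take (size R).-1 R :: T).
Proof.
move=> iP szT; have [iD _ _ _] := rins_state iP (outer0I szT) (Rins_del R T).
apply/negP => /memR_nth[k kR km].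
have := lto_nth (Some (last 0 R)) (inc_head_sorted iD) kR.
rewrite /= km ltnn (del_pos iP szT); move: kR szT; case: ifP => [/eqP->|_] /=.
  by move=> kT sT; have := leq_trans kT sT.
move=> kR' sz; rewrite size_take ltn_predL (leq_ltn_trans _ sz) // in kR'.
by rewrite kR'.
Qed.

Lemma row_cons (R : seq nat) T r : row (R :: T) r.+1 = row T r. Proof. by []. Qed.

(** Supplies the witness required by [weq_rstep]. It arises in a row of the third kind of [rf_key]
    and is carried upwards while (DR) keeps the column; the deletion itself has [p = c] and is
    excluded by hypothesis. *)
Lemma rins_excess P r al P' m a (c := (size (row P r)).-1) (p := pos (head [::] P') (Some m)) :
  inc P -> outer P r -> rins P r al P' m a -> (al -> p <> c) -> m \notin head [::] P' ->
  0 < p /\ excess p m (col P').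
Proof.
rewrite /c /p => {c p} + + ri; elim: ri => {P r al P' m a} [R T|R T q|R T r al T' e a q ri IH].
- by move=> iP /outer0 szT /(_ isT); rewrite del_pos.
- move=> [oR aR iT] /outer0 szT _; have rs := rowst_None oR aR iT szT.
  have F := rstep_facts rs (erefl : false = ~~ ejecto T None); rewrite /= -/q in F.
  rewrite [head _ _]/= (rf_pos F); apply: (rstep_excess rs F erefl) => //.
- move=> iP /outerS oT; have [rs aE] := rins_rowst iP oT ri; have [_ _ iT] := iP.
  have F := rstep_facts rs aE; rewrite /= -/q in F.
  rewrite row_cons [head _ (_ :: _)]/= (rf_pos F) => nc; apply: (rstep_excess rs F erefl).
  move=> pq h [<-] eT; apply: IH => // al1; rewrite pq; exact: nc.
Qed.

(** The rows [A] not yet reached belong to the statement because cuts see whole columns; the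
    induction hypothesis is used with [R] appended to [A]. *)
Lemma rins_weq A P r al P' m a j (c := (size (row P r)).-1) (p := pos (head [::] P') (Some m)) :
  inc (A ++ P) -> outer P r -> rins P r al P' m a -> (al -> j <> c) ->
  weq j (col (A ++ P)) (fcol ((p < j) && (m \notin head [::] P')) m p (col (A ++ P'))).
Proof.
rewrite /c /p => {c p} + + ri.
elim: ri A => {P r al P' m a} [R T|R T q|R T r al T' e a q ri IH] A.
- move=> iAP /outer0 szT /(_ isT) jc; have iP := inc_cat iAP; rewrite del_pos //.
  have mD := del_notin iP szT.
  rewrite mD andbT /fcol; case: ifP => cj; apply: weq_perm => i ij.
    rewrite /addf col_cat (col_del _ iP szT); case: eqP => [->|_]; last by rewrite col_cat.
    by rewrite col_cat -cat1s perm_catCA.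
  have jc' : j != (size R).-1 by apply/eqP.
  by rewrite !col_cat (col_del _ iP szT) ifN //; clia.
- move=> iAP /outer0 szT _; have [oR aR iT] := inc_cat iAP.
  have rs := rowst_None oR aR iT szT.
  have F := rstep_facts rs (erefl : false = ~~ ejecto T None); rewrite /= -/q in F.
  rewrite [head _ _]/= (rf_pos F); have := weq_rstep rs F erefl iAP (j := j).
  by rewrite /fe; apply.
- move=> iAP /outerS oT; have iP := inc_cat iAP; have [rs aE] := rins_rowst iP oT ri.
  have [_ _ iT] := iP; have [iT' _ hT _] := rins_state iT oT ri.
  have F := rstep_facts rs aE; rewrite /= -/q in F.
  rewrite row_cons [head _ (_ :: _)]/= (rf_pos F) => nc.
  have h1 : inc (rcons A R ++ T) by rewrite cat_rcons.
  have iAP' : inc (A ++ R :: T').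
    have := inc_cat_head h1 iT'; rewrite cat_rcons; apply=> S.
    by rewrite hT => /(above_ins _ _ (inc_head_sorted iT'))[].
  have := IH (rcons A R) h1 oT nc; rewrite !cat_rcons => h.
  apply: weq_trans h _.
  have := weq_rstep rs F erefl iAP' (j := j); apply => jp h [<-] eT.
  apply: (rins_excess iT oT ri) => // al1; rewrite -jp; exact: nc.
Qed.

(** * Columns of the keys *)

Definition kN P j v := count (leq v) (Kcol tri_lt P j).

Lemma kNE P j v : kN P j v = count (leq v) (nestc tri_lt (col P) 0 j).
Proof. exact: count_sort. Qed.

Lemma kN_le P v us : kN P (size us) v <= wcost (col P) 0 v us.
Proof. by rewrite kNE; apply: nest_lt_le. Qed.

Lemma kN_ex P j v : exists2 us, size us = j & wcost (col P) 0 v us <= kN P j v.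
Proof. by rewrite kNE; apply: nest_lt_ex. Qed.

Lemma weq_kN P P' j v : weq j (col P) (col P') -> kN P j v = kN P' j v.
Proof. by case=> h1 h2; apply/eqP; rewrite !kNE eqn_leq !wle_nest. Qed.

Lemma rins_key P r al P' m a j v (c := (size (row P r)).-1) :
  inc P -> outer P r -> rins P r al P' m a -> (al -> j <> c) -> kN P j v = kN P' j v.
Proof.
move=> iP oP ri nc; apply: weq_kN.
have := @rins_weq [::] P r al P' m a j iP oP ri nc; rewrite !cat0s => h.
apply: weq_trans h _; rewrite /fcol; case: ifP => [/andP[pj mP]|_]; last exact: weq_refl.
have [iP' _ _ _] := rins_state iP oP ri; have sH := inc_head_sorted iP'.
set p := pos _ _ in pj *; split; last exact: wle_addf.
have -> : j = p + (j - p.+1).+1 by clia.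
apply: wle_up => [i /andP[_ ip]|]; first by rewrite /addf ltn_eqF.
rewrite add0n; apply: wle_drop => u; apply: count_col_sub => S SX pS /andP[hS Su].
have Sp : nth 0 S p < nth 0 S p.+1 by apply: nth_lt => //; apply: inc_sorted SX.
rewrite (ltnW pS) (leq_trans Sp Su) andbT /=; apply: (@col_ge P' p) => //.
  by move=> ?; apply: pos_ge.
by apply/mapP; exists S; rewrite // mem_filter SX (ltnW pS).
Qed.

Lemma rins_left P r al P' m a (c := (size (row P r)).-1) :
  inc P -> outer P r -> rins P r al P' m a ->
  c <= pos (head [::] P') (Some m) /\ forall j, j < c -> col P' j = col P j.
Proof.
rewrite /c => {c} + + ri; elim: ri => {P r al P' m a} [R T|R T q|R T r al T' e a q ri IH].
- move=> iP /outer0 szT; rewrite del_pos //; split=> [|j jc]; first by [].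
  by rewrite (col_del j iP szT) [j == _](ltn_eqF jc).
- move=> [oR aR iT] /outer0 szT; have rs := rowst_None oR aR iT szT.
  have F := rstep_facts rs (erefl : false = ~~ ejecto T None); rewrite /= -/q in F.
  have qE : q = (size R).-1 by rewrite /q /pos /= count_predT.
  rewrite [head _ _]/= (rf_pos F) {1}qE; split=> // j jc; rewrite /row /= in jc.
  by rewrite !col_cons size_upd ?(rf_q F) // nth_upd [j == q]ltn_eqF // qE.
- move=> iP /outerS oT; have [rs aE] := rins_rowst iP oT ri; have [_ _ iT] := iP.
  have F := rstep_facts rs aE; rewrite /= -/q in F; have [cp hj] := IH iT oT.
  rewrite row_cons [head _ (_ :: _)]/= (rf_pos F); have cq := leq_trans cp (rf_pq F).
  split=> // j jc; rewrite !col_cons size_upd ?(rf_q F) // nth_upd hj //.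
  by rewrite [j == q](ltn_eqF (leq_trans jc cq)).
Qed.

(** The second summand serves the induction: while the path stays in column [c], the value in
    transit still counts and bounds the entry that replaces the next one. *)
Lemma rins_colc_le P r (al : bool) P' m a (c := (size (row P r)).-1) t : al ->
  inc P -> outer P r -> rins P r al P' m a ->
  count (leq t) (col P' c) + (c == pos (head [::] P') (Some m)) * (t <= m) <=
    count (leq t) (col P c).
Proof.
rewrite /c => {c} + + + ri; elim: ri => {P r al P' m a} [R T|R T q|R T r al T' e a q ri IH] //.
- move=> _ iP /outer0 szT; rewrite del_pos // (col_del _ iP szT) eqxx count_cat /=.
  by rewrite mul1n addn0 addnC.
- move=> al1 iP /outerS oT; have [rs aE] := rins_rowst iP oT ri; have [_ _ iT] := iP.
  have F := rstep_facts rs aE; rewrite /= -/q in F; have [cp hj] := rins_left iT oT ri.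
  have := IH al1 iT oT; rewrite row_cons [head _ (_ :: _)]/= (rf_pos F).
  rewrite !col_cons size_upd ?(rf_q F) // !count_cat nth_upd.
  case: (eqVneq _ q) => [cq|ncq] h; last by rewrite mul0n addn0; apply: leq_add; clia.
  have xe := rf_xe F erefl; rewrite cq (rf_q F) /= in h *.
  have pq : q == pos (head [::] T') (Some e).
    by rewrite eqn_leq (rf_pq F) -{1}cq cp.
  by move: h; rewrite pq; clia.
Qed.

(* Column [c] loses its entry [w]; as long as the bumping path stays in that
   column with values moving up, the lost entry is the path value, and the path
   leaves this regime only when column [c.+1] has an entry [<= w] in that row. *)
Lemma rins_colc P r (al : bool) P' m a (c := (size (row P r)).-1) : al ->
  inc P -> outer P r -> rins P r al P' m a ->
  exists w, forall t,
    (w < t -> count (leq t) (col P c) <= count (leq t) (col P' c)) /\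
    (t <= w -> count (fun y => t <= y < w) (col P c) + r <=
                 count (leq t) (col P' c) + count (geq w) (col P c.+1)).
Proof.
move=> al1 iP oP ri.
suff [[pc mP h1 h2 h3]|[w [cH Hw h]]] :
  [/\ pos (head [::] P') (Some m) = c, m \notin head [::] P',
      forall t, count (leq t) (col P' c) + (t <= m) = count (leq t) (col P c),
      forall z, z \in col P c -> m <= z & size (col P c) = r.+1] \/
  exists w, [/\ c.+1 < size (head [::] P), nth 0 (head [::] P) c.+1 <= w & forall t,
    (w < t -> count (leq t) (col P c) <= count (leq t) (col P' c)) /\
    (t <= w -> count (fun y => t <= y < w) (col P c) + r <=
                 count (leq t) (col P' c) + count (geq w) (col P c.+1))].
- exists m => t; split=> [mt|tm]; first by have := h1 t; clia.
  rewrite count0 ?add0n => [|z zP]; last by rewrite negb_and -leqNgt h2 ?orbT.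
  have : count (leq t) (col P c) = size (col P c).
    apply/eqP; rewrite -all_count; apply/allP => z /h2 mz; exact: leq_trans mz.
  by have := h1 t; clia.
- by exists w.
move: al1 iP oP; rewrite /c => {c}.
elim: ri => {P r al P' m a} [R T|R T q|R T r al T' e a q ri IH] //.
- move=> _ iP /outer0 szT; left.
  have szR : 0 < size R by clia.
  have cT : col T (size R).-1 = [::].
    case E: (col T _) => [//|z s]; have : z \in col T (size R).-1 by rewrite E inE eqxx.
    case/mem_col => S [ST cS _].
    suff : size S <= size (head [::] T) by clia.
    case: (T) iP ST => //= R1 T1 [_ _ iT]; rewrite inE => /predU1P[->//|ST].
    by have [] := inc_above iT ST.
  have cR : col (R :: T) (size R).-1 = [:: last 0 R].
    by rewrite col_cons ltn_predL szR cT cats0 nth_last.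
  have := col_del (size R).-1 iP szT; rewrite cR eqxx => /= -[<-].
  split=> //.
  + exact: del_pos.
  + exact: del_notin.
  + by move=> t; rewrite /= addn0.
  + by move=> z; rewrite inE => /eqP->.
- move=> al1 iP /outerS oT; have [rs aE] := rins_rowst iP oT ri; have [oR aR iT] := iP.
  have F := rstep_facts rs aE; rewrite /= -/q in F; have [cp hj] := rins_left iT oT ri.
  have sR : sorted ltn R by case: oR.
  rewrite row_cons [head _ (_ :: _)]/= (rf_pos F).
  have cR : (size (row T r)).-1 < size R.
    exact: leq_ltn_trans (leq_trans cp (rf_pq F)) (rf_q F).
  have R'c : nth 0 R (size (row T r)).-1 <=
      nth 0 (set_nth 0 R q (rstep R T' (Some e) a).1) (size (row T r)).-1.
    by rewrite nth_upd; case: eqP => // ->; apply: rf_mx F.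
  have cR' : (size (row T r)).-1 < size (set_nth 0 R q (rstep R T' (Some e) a).1).
    by rewrite size_upd // (rf_q F).
  move: (IH al1 iT oT) (rf_key F) cp cR cR' R'c; clear IH hj.
  move: (size (row T r)).-1 => c IH key cp cR cR' R'c.
  have xR' := rf_mx F; move: F xR' key cR' R'c; move: (rstep R T' _ _) => [x a'] /= F mx key cR' R'c.
  rewrite !(col_cons _ _ c) cR cR' (col_cons R T c.+1).
  case: IH => [[pc mP h1 h2 h3]|[w [cH Hw h]]].
    (* The regime ends in this row, and [w] is the value [e] arriving in it: column [c] below has no
       entry under [e], and column [c.+1] of [R] contributes an entry at most [e]. *)
    have K1F : c.+1 < size R /\ nth 0 R c.+1 <= e -> exists w,
       [/\ c.+1 < size R, nth 0 R c.+1 <= w & forall t,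
        (w < t -> count (leq t) ([:: nth 0 R c] ++ col T c) <=
           count (leq t) ([:: nth 0 (set_nth 0 R q x) c] ++ col T' c)) /\
        (t <= w -> count (fun y => t <= y < w) ([:: nth 0 R c] ++ col T c) + r.+1 <=
           count (leq t) ([:: nth 0 (set_nth 0 R q x) c] ++ col T' c) +
           count (geq w) ((if c.+1 < size R then [:: nth 0 R c.+1] else [::]) ++ col T c.+1))].
      move=> [c1R c1e]; exists e; split=> // t; rewrite c1R !count_cat /= !addn0; have := h1 t.
      split=> [et|te]; first by clia.
      rewrite (@count0 _ (col T c)) => [|z zP]; last by rewrite negb_and -leqNgt h2 ?orbT.
      have : count (leq t) (col T c) = size (col T c).
        apply/eqP; rewrite -all_count; apply/allP => z /h2 mz; exact: leq_trans mz.
      by rewrite h3 c1e; clia.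
    case: key => [[_ K1]|[[ee] pq hT hR]|[_ _ K1 _]].
    + by right; apply: K1F; rewrite -pc; apply: K1.
    + left; have qc : q = c by rewrite -pq.
      have qR := rf_q F; have Em := rf_m F.
      have ltmx : nth 0 R q < x.
        rewrite ltn_neqAle mx andbT; apply: contra hR => /eqP <-; exact: nth_mem.
      split=> //.
      * exact: ejectable_head_notin.
      * by move=> t; rewrite !count_cat /= nth_upd -qc eqxx qc -h1 ee; clia.
      * move=> z; rewrite inE => /predU1P[->|/h2 ez]; first by rewrite qc.
        by apply: ltnW; apply: leq_trans ez; rewrite ee.
      * by rewrite /= h3.
    + by right; apply: K1F; rewrite -pc; apply: K1.
  right; exists w; have [aR1 aR2] := aR.
  have c1R : c.+1 < size R by apply: leq_trans aR1.
  have c1w : nth 0 R c.+1 <= w by apply: leq_trans Hw; apply/ltnW/aR2.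
  split=> // t; rewrite c1R !count_cat /= !addn0; have [ht1 ht2] := h t.
  split=> [/ht1|/ht2]; first by clia.
  by clia.
Qed.

Lemma inc_row_sub P R j : inc P -> R \in P -> j.+1 < size R -> nth 0 R j < nth 0 R j.+1.
Proof. by move=> iP RP jR; apply: nth_lt => //; apply: inc_sorted RP. Qed.

(** Every cut charges each row that is long enough: an entry past the window is at least [u], so the
    next entry of the row is at least [u.+1], where the next window starts. Hence key columns keep
    their full height. *)
Lemma wcost_rows P k v us : inc P ->
  count (fun S => (k + size us < size S) && (v <= nth 0 S k)) P <= wcost (col P) k v us.
Proof.
move=> iP; elim: us k v => [|u us IH] k v /=; first by rewrite count_col addn0.
apply: leq_trans (leq_add (leqnn _) (IH k.+1 u.+1)); rewrite count_col.
elim: P iP {IH} => //= R P IHP [oR aR iP]; have := IHP iP.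
have sR : sorted ltn R by case: oR.
rewrite addnS addSn; case: (ltnP (k + size us).+1 (size R)) => kR; last by rewrite /=; clia.
have kR' : k < size R by clia.
have := nth_lt sR (ltnSn k) => /(_ ltac:(clia)); rewrite kR' /=; clia.
Qed.

(** With consecutive separators all windows are empty and only the last column is charged. *)
Lemma wcost_iota C k v n : wcost C k v (iota v n) = count (leq (v + n)) (C (k + n)).
Proof.
elim: n k v => [|n IH] k v /=; first by rewrite !addn0.
rewrite IH !addSnnS count0 // => y _; clia.
Qed.

Lemma kN_le_col P j v : kN P j v <= count (leq v) (col P j).
Proof.
have := kN_le P v (iota v j); rewrite size_iota wcost_iota add0n => h; apply: leq_trans h _.
by apply: sub_count => y /=; apply: leq_trans; apply: leq_addr.
Qed.

Lemma kN_size P j : inc P -> kN P j 0 = size (col P j).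
Proof.
move=> iP; apply/eqP; rewrite eqn_leq; apply/andP; split.
  by apply: leq_trans (kN_le_col _ _ _) (count_size _ _).
have [us su hu] := kN_ex P j 0; apply: leq_trans hu; rewrite -su.
apply: leq_trans (wcost_rows 0 0 us iP); rewrite /col size_map size_filter.
by apply: sub_count => S /= ->.
Qed.

Lemma size_Kcol P j : inc P -> size (Kcol tri_lt P j) = size (col P j).
Proof. by move=> iP; rewrite -kN_size // /kN -[LHS]count_predT; apply: eq_count => y. Qed.

(** [L] is the cost of the earlier columns and [t] the start of the last window. They depend only on
    the columns before the last, so they serve [P] and [P'] at once and allow a separator to be
    appended or removed. *)
Lemma wcost_rcons C k v us : exists L t, forall C', (forall i, k <= i < k + size us -> C' i = C i) ->
  wcost C' k v us = L + count (leq t) (C' (k + size us)) /\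
  forall w, wcost C' k v (rcons us w) = L + (count (fun y => t <= y < w) (C' (k + size us)) +
                                   count (leq w.+1) (C' (k + size us).+1)).
Proof.
elim: us k v => [|u us IH] k v; first by exists 0, v => C' _; rewrite /= addn0.
have [L [t h]] := IH k.+1 u.+1; exists (count (fun y => v <= y < u) (C k) + L), t => C' hC.
have [|h1 h2] := h C' _; first by move=> i hi; apply: hC => /=; clia.
by split=> [|w]; rewrite /= ?h1 ?h2 hC ?addnA ?addSnnS ?leqnn //= -?addSnnS; clia.
Qed.

Lemma count_leqS v s : count (geq v) s + count (leq v.+1) s = size s.
Proof. by elim: s => //= y s <-; clia. Qed.

(** In complementary form: key column [j.+1] has at most as many entries below [v] as key column
    [j]. The last separator [u] is removed from an optimal cut; each entry [<= u] of column [j.+1]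
    has an entry [< u] on its left, which bounds the change of cost. *)
Lemma kN_nested P j v : inc P ->
  kN P j v + size (col P j.+1) <= kN P j.+1 v + size (col P j).
Proof.
move=> iP; have [us su hu] := kN_ex P j.+1 v; case/lastP: us su hu => // us u.
rewrite size_rcons => -[su]; have [L [t h]] := wcost_rcons (col P) 0 v us.
have [//|h1 h2] := h (col P); rewrite h2 add0n su in h1 *; move=> hu.
have := kN_le P v us; rewrite h1 su => hj.
have h3 : count (geq u) (col P j.+1) <= count (gtn u) (col P j).
  apply: count_col_sub => S SP jS; rewrite /geq /= => hS; rewrite (ltnW jS) /=.
  exact: leq_trans (inc_row_sub iP SP jS) hS.
have h4 := count_leqS u (col P j.+1).
have h5 : count (leq t) (col P j) + count (gtn u) (col P j) <=
    count (fun y => t <= y < u) (col P j) + size (col P j).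
  by elim: (col P j) => //= y s; clia.
by clia.
Qed.

Lemma kN_del_le P r P' m a v (c := (size (row P r)).-1) :
  inc P -> outer P r -> rins P r true P' m a -> kN P' c v <= kN P c v.
Proof.
move=> iP oP ri; have [us su hu] := kN_ex P c v; apply: leq_trans hu.
have [cp hc] := rins_left iP oP ri.
have [L [t h]] := wcost_rcons (col P) 0 v us; rewrite add0n su in h.
have [//|h1 _] := h (col P); have [|h2 _] := h (col P').
  by move=> i /andP[_ ic]; apply: hc.
have := kN_le P' v us; rewrite su h1 h2 => hk; apply: leq_trans hk _; rewrite leq_add2l.
by apply: leq_trans (rins_colc_le t isT iP oP ri); apply: leq_addr.
Qed.

(** Take an optimal cut for [P'], with last window starting at [t]. If [w < t], it costs no more for
    [P]; otherwise appending [w] as a further separator bounds column [c.+1] of the key of [P]. *)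
Lemma kN_del_ge P r P' m a v (c := (size (row P r)).-1) :
  inc P -> outer P r -> rins P r true P' m a ->
  kN P c v <= kN P' c v \/ kN P c.+1 v + r <= kN P' c v + size (col P c.+1).
Proof.
move=> iP oP ri; have [us su hu] := kN_ex P' c v.
have [cp hc] := rins_left iP oP ri.
have [L [t h]] := wcost_rcons (col P) 0 v us; rewrite add0n su in h.
have [//|h1 h1'] := h (col P); have [|h2 _] := h (col P').
  by move=> i /andP[_ ic]; apply: hc.
rewrite h2 in hu; have [w /(_ t)[hw1 hw2]] := rins_colc isT iP oP ri; rewrite -/c in hw1 hw2.
have [wt|tw] := ltnP w t.
  left; have := kN_le P v us; rewrite su h1; have := hw1 wt; clia.
right; have := kN_le P v (rcons us w); rewrite size_rcons su h1'.
by have := hw2 tw; have := count_leqS w (col P c.+1); clia.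
Qed.

(** * The key of [L(Q)] and the deletion of a minimum *)

Definition kL X j v := count (gtn v) (Kcol tri_ge X j).

Lemma kLE X j v : kL X j v = count (gtn v) (nestc tri_ge (col X) 0 j).
Proof. exact: count_sort. Qed.

Lemma kL_le X v us : kL X (size us) v <= qcost (col X) 0 v us.
Proof. by rewrite kLE; apply: nest_ge_le. Qed.

Lemma kL_ex X j v : exists2 us, size us = j & qcost (col X) 0 v us <= kL X j v.
Proof. by rewrite kLE; apply: nest_ge_ex. Qed.

Lemma qcost_nseq C k v n : qcost C k v (nseq n v) = count (gtn v) (C (k + n)).
Proof.
elim: n k => [|n IH] k /=; first by rewrite addn0.
rewrite IH addSnnS count0 // => y _; clia.
Qed.

Lemma kL_le_col X j v : kL X j v <= count (gtn v) (col X j).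
Proof. by have := kL_le X v (nseq j v); rewrite size_nseq qcost_nseq. Qed.

Lemma qcost_rows X k v us : (forall S i, S \in X -> i.+1 < size S -> nth 0 S i.+1 <= nth 0 S i) ->
  count (fun S => (k + size us < size S) && (nth 0 S k < v)) X <= qcost (col X) k v us.
Proof.
move=> dX; elim: us k v => [|u us IH] k v /=; first by rewrite count_col addn0.
apply: leq_trans (leq_add (leqnn _) (IH k.+1 u)); rewrite count_col.
elim: X dX {IH} => //= R X IHX dX; have := IHX (fun S i h => dX S i (@mem_behead _ (R :: X) S h)).
rewrite addnS addSn; case: (ltnP (k + size us).+1 (size R)) => kR; last by rewrite /=; clia.
have kR' : k < size R by clia.
have := dX R k (mem_head R X) ltac:(clia); rewrite kR' /=; clia.
Qed.

Lemma size_KcolQ X j : (forall S i, S \in X -> i.+1 < size S -> nth 0 S i.+1 <= nth 0 S i) ->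
  size (Kcol tri_ge X j) = size (col X j).
Proof.
(* [M] exceeds the whole key column, so all of it is counted, and also column 0, so that
   [qcost_rows] applies to every row reaching column [j]. *)
move=> dX; pose M := (seqmax (Kcol tri_ge X j) + seqmax (col X 0)).+1.
have -> : size (Kcol tri_ge X j) = kL X j M.
  rewrite /kL -[LHS]count_predT; apply/esym/eq_in_count => y /seqmax_ge /= hy.
  by rewrite /M; clia.
apply/eqP; rewrite eqn_leq; apply/andP; split.
  by apply: leq_trans (kL_le_col _ _ _) (count_size _ _).
have [us su hu] := kL_ex X j M; apply: leq_trans hu; rewrite -su.
apply: leq_trans (qcost_rows 0 M us dX); rewrite /col size_map size_filter.
apply: count_sub_in => S SX /= jS; rewrite jS /=.
have : nth 0 S 0 \in col X 0.
  by apply/mapP; exists S; rewrite // mem_filter SX andbT; apply: leq_ltn_trans jS.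
by move/seqmax_ge; rewrite /M; clia.
Qed.

Lemma qcost_rcons C k v us : exists L t, forall C', (forall i, k <= i < k + size us -> C' i = C i) ->
  qcost C' k v us = L + count (gtn t) (C' (k + size us)) /\
  forall w, qcost C' k v (rcons us w) = L + (count (fun y => w <= y < t) (C' (k + size us)) +
                                   count (gtn w) (C' (k + size us).+1)).
Proof.
elim: us k v => [|u us IH] k v; first by exists 0, v => C' _; rewrite /= addn0.
have [L [t h]] := IH k.+1 u; exists (count (fun y => u <= y < v) (C k) + L), t => C' hC.
have [|h1 h2] := h C' _; first by move=> i hi; apply: hC => /=; clia.
by split=> [|w]; rewrite /= ?h1 ?h2 hC ?addnA ?addSnnS ?leqnn //= -?addSnnS; clia.
Qed.

(** A final separator 0 charges nothing in the added column. *)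
Lemma kL_nested X j v : kL X j.+1 v <= kL X j v.
Proof.
have [us su hu] := kL_ex X j v; apply: leq_trans hu; have := kL_le X v (rcons us 0).
rewrite size_rcons su => h; apply: leq_trans h _.
have [L [t h]] := qcost_rcons (col X) 0 v us; have [//|-> ->] := h (col X).
rewrite leq_add2l -[leqRHS]addn0 leq_add // leqn0.
by apply/eqP/count0 => y.
Qed.

Section DeleteMin.
Variables (X X' : tab) (c q : nat).
Hypothesis colXX' : forall k, perm_eq (col X k) (if k == c then q :: col X' k else col X' k).
Hypothesis gt_q : forall k z, c < k -> z \in col X k -> q < z.
Hypothesis ge_q : forall k z, z \in col X k -> q <= z.

Let colne k : k != c -> perm_eq (col X k) (col X' k).
Proof. by move=> kc; have := colXX' k; rewrite (negbTE kc). Qed.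

Lemma qcost_del k v us : qcost (col X') k v us <= qcost (col X) k v us.
Proof.
elim: us k v => [|u us IH] k v /=; last apply: leq_add => //;
  by rewrite (permP (colXX' k)); case: ifP => //= _; apply: leq_addl.
Qed.

Lemma qcost_eq k v us : (k + size us < c) || (c < k) -> qcost (col X) k v us = qcost (col X') k v us.
Proof.
elim: us k v => [|u us IH] k v /= h; first by apply/permP/colne; clia.
by congr (_ + _); [apply/permP/colne; clia | apply: IH; clia].
Qed.

Lemma qcost_gt k t us : c < k -> t <= q.+1 -> exists2 us', size us' = size us &
  qcost (col X) k q.+1 us' <= qcost (col X) k t us.
Proof.
move=> ck tq; exists us => //.
have z u : count (fun y => u <= y < q.+1) (col X k) = 0.
  by apply: count0 => y /(gt_q ck); clia.
case: us => [|u us] /=; last by rewrite z add0n leq_addl.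
by rewrite (@count0 (gtn q.+1)) // => y /(gt_q ck) /=; clia.
Qed.

(** A cut charging the new [q] has its separator in column [c] raised to [q.+1]; this is free
    further right, where all entries exceed [q]. *)
Lemma qcost_add k v us : k <= c < k + size us -> exists2 us', size us' = size us &
  qcost (col X) k v us' <= qcost (col X') k v us.
Proof.
elim: us k v => [|u us IH] k v /=; first by clia.
move=> hk; have [kc|nkc] := eqVneq k c; last first.
  have [|us' su hu] := IH k.+1 u; first by clia.
  exists (u :: us'); rewrite /= ?su //; apply: leq_add => //.
  by rewrite (permP (colne nkc)).
have ck : c < k.+1 by clia.
have [/andP[uq qv]|nq] := boolP (u <= q < v); last first.
  exists (u :: us) => //=; rewrite qcost_eq ?ck ?orbT // leq_add2r.
  by rewrite (permP (colXX' k)) kc eqxx /= (negbTE nq).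
have [us' su hu] := qcost_gt us ck (leqW uq : u <= q.+1).
exists (q.+1 :: us'); rewrite /= ?su //; apply: leq_add; last first.
  by apply: leq_trans hu _; rewrite qcost_eq // ck orbT.
rewrite (permP (colXX' k)) kc eqxx /= ltnn add0n; apply: sub_count => y /andP[qy ->].
by rewrite andbT; apply: leq_trans uq (ltnW qy).
Qed.

Lemma kL_del_ne j v : j != c -> kL X j v = kL X' j v.
Proof.
move=> jc; apply/eqP; rewrite eqn_leq; apply/andP; split; last first.
  have [us su hu] := kL_ex X j v; apply: leq_trans hu; rewrite -su.
  exact: leq_trans (kL_le _ _ _) (qcost_del _ _ _).
have [us su hu] := kL_ex X' j v; apply: leq_trans hu; rewrite -su.
have [cj|cj] := ltnP c j.
  have [|us' su' hu'] := @qcost_add 0 v us; first by rewrite add0n su.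
  by apply: leq_trans hu'; rewrite -su'; apply: kL_le.
rewrite -qcost_eq ?add0n ?su; first by have := kL_le X v us; rewrite su.
by rewrite ltn_neqAle jc cj.
Qed.

Lemma kL_del_le v : kL X c v <= (kL X' c v).+1.
Proof.
have [us su hu] := kL_ex X' c v; apply: (@leq_trans (qcost (col X') 0 v us).+1); last by [].
have := kL_le X v us; rewrite su => h; apply: leq_trans h _.
have : 0 + size us = c by [].
elim: us 0 v {su hu} => [|u us IH] k v /=.
  by rewrite addn0 => kc; rewrite (permP (colXX' _)) kc eqxx /=; case: (_ < _).
rewrite -addSnnS => h; rewrite -addnS; apply: leq_add; last exact: IH.
by rewrite (permP (colne _)) //; clia.
Qed.

(** Let [u] be the last separator of an optimal cut for [X]. If [q < u], the cut charges [q], and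
    for [X'] it is cheaper by one. If [u <= q], the last window bounds nothing from below, and the
    cut without [u] bounds column [c.-1]. *)
Lemma kL_del_ge v : 0 < c -> (kL X' c v).+1 <= kL X c v \/ kL X c.-1 v <= kL X c v.
Proof.
move=> c0; have [us su hu] := kL_ex X c v; case/lastP: us su hu => [|us u].
  by move=> h; rewrite -h in c0.
rewrite size_rcons => su.
have [L [t h]] := qcost_rcons (col X) 0 v us; have [//|h1 h2] := h (col X).
rewrite h2 add0n => hu; have [qu|uq] := ltnP q u.
  left; apply: leq_trans hu; have := kL_le X' v (rcons us u); rewrite size_rcons su.
  have [L' [t' h']] := qcost_rcons (col X') 0 v us; have [//|h1' h2'] := h' (col X').
  have e1 : qcost (col X) 0 v us = qcost (col X') 0 v us by apply: qcost_eq; rewrite add0n su leqnn.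
  have : qcost (col X') 0 v (rcons us u) < qcost (col X) 0 v (rcons us u).
    have : 0 + (size us).+1 = c by rewrite add0n.
    elim: us 0 v {su h h1 h2 h' h1' h2' e1} => [|w us IH] k v /= hk.
      rewrite (permP (colne (_ : k != c))); last by clia.
      rewrite (permP (colXX' k.+1)) (_ : k.+1 == c); last by apply/eqP; clia.
      by rewrite /= qu add1n addnS.
    rewrite -addnS leq_add //; last by apply: IH; clia.
    by rewrite (permP (colne (_ : k != c))) //; clia.
  by rewrite h2 add0n su; clia.
right; apply: leq_trans hu; have := kL_le X v us; rewrite -su /= h1 add0n => hk.
apply: leq_trans hk _; rewrite leq_add2l; apply: leq_trans (leq_addr _ _).
by apply: count_sub_in => y /ge_q qy /= ->; rewrite andbT; apply: leq_trans uq qy.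
Qed.

Lemma kL_del0 v : c = 0 -> q < v -> (kL X' c v).+1 <= kL X c v.
Proof.
move=> c0 qv; rewrite !kLE c0 /nestc /=; have := colXX' 0; rewrite c0 eqxx => /permP ->.
by rewrite /= qv.
Qed.
End DeleteMin.

(** * Dominance *)

(* As column [j] has the same height in [P] and [X], this compares the number of
   entries [>= v] of the two keys. *)
Definition dom P X := forall j v, size (col P j) <= kN P j v + kL X j v.

(** At [v = q] the key of [X] contributes nothing, so the key of [P], and with it column [j] of [P],
    lies entirely at or above [q]. *)
Lemma dom_min P X q j z : dom P X -> (forall y, y \in col X j -> q <= y) -> z \in col P j -> q <= z.
Proof.
move=> /(_ j q) + hX zP; have -> : kL X j q = 0.
  apply/eqP; rewrite -leqn0; apply: leq_trans (kL_le_col _ _ _) _.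
  by rewrite leqn0; apply/eqP/count0 => y /hX; rewrite -leqNgt.
rewrite addn0 => h; have := leq_trans h (kN_le_col P j q).
have := count_size (leq q) (col P j) => h1 h2.
have : all (leq q) (col P j) by rewrite all_count eqn_leq h1 h2.
by move/allP/(_ _ zP).
Qed.

Lemma mem_head_col P z : z \in head [::] P -> exists j, z \in col P j.
Proof.
case: P => // R T /= /memR_nth[j jR <-]; exists j.
by rewrite col_cons jR inE eqxx.
Qed.

Lemma dom_step P r al P' m a X X' q (c := (size (row P r)).-1) :
  inc P -> outer P r -> rins P r al P' m a ->
  (forall j, size (col P j) = size (col X j)) ->
  (forall j, size (col P' j) = size (col X' j)) ->
  size (col P c) = r.+1 ->
  (forall k z, z \in col X k -> q <= z) -> (forall k z, z \in col X' k -> q <= z) ->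
  (if al then (forall k, perm_eq (col X k) (if k == c then q :: col X' k else col X' k)) /\
              (forall k z, c < k -> z \in col X k -> q < z)
   else X' = X) ->
  dom P X <-> dom P' X' /\ q <= m.
Proof.
move=> iP oP ri hs hs' hr qX qX' hX; have [iP' _ hP mP] := rins_state iP oP ri.
have keyN j v : (al -> j <> c) -> kN P j v = kN P' j v by exact: rins_key ri.
suff main : (dom P X -> dom P' X') /\ (dom P' X' -> q <= m -> dom P X).
  split=> [h|[h1 h2]]; last exact: main.2.
  split; first exact: main.1.
  have [j mj] := mem_head_col mP; exact: dom_min h (@qX j) mj.
case: al ri hX keyN => [ri [hX gX]|ri XX'] keyN; last first.
  have e j v : kN P j v = kN P' j v by apply: keyN.
  by split=> [h|h _] j v; have := h j v; rewrite hs hs' XX' e.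
have ne j v : j != c -> kN P j v + kL X j v = kN P' j v + kL X' j v /\ size (col P j) = size (col P' j).
  move=> jc; rewrite keyN; last by move=> _; apply/eqP.
  rewrite (kL_del_ne hX gX v jc); split=> //.
  by rewrite hs hs' (perm_size (hX j)) (negbTE jc).
have sc : size (col P' c) = r by apply/eqP; rewrite -eqSS -hr hs hs' (perm_size (hX c)) eqxx.
split=> [h j v|h qm j v].
  have [->|jc] := eqVneq j c; last by have [<- <-] := ne j v jc; apply: h.
  rewrite sc; have := h c v; rewrite hr => hc; have := kL_del_le hX v => kl.
  case: (kN_del_ge v iP oP ri) => k1; first by rewrite -/c in k1; clia.
  (* The drop is paid by column [c.+1]: its dominance is assumed, and [kL] does not increase from
     column [c] to [c.+1]. *)
  rewrite -/c in k1; have := h c.+1 v => h1; have := kL_nested X' c v.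
  by rewrite -(kL_del_ne hX gX v (_ : c.+1 != c)) ?gtn_eqF // => h2; clia.
have [->|jc] := eqVneq j c; last by have [-> ->] := ne j v jc; apply: h.
have kn := kN_del_le v iP oP ri; rewrite -/c in kn.
have h1 := h c v; rewrite sc in h1.
have [c0|c0] := posnP c; last first.
  case: (kL_del_ge hX qX v c0) => kl; first by rewrite hr; clia.
  (* The missing unit comes from column [c.-1], where dominance is unchanged by the step;
     [kN_nested] carries it to column [c]. *)
  have cc : c.-1 != c by clia.
  have [e1 e2] := ne c.-1 v cc; have := h c.-1 v; rewrite -e1 -e2.
  by have := kN_nested c.-1 v iP; rewrite prednK //; clia.
(* Without a left neighbour, [q <= m] is used: for [v <= q] all of column 0 of [P] is at least [q],
   its top entry being [m] or an entry of [P']. *)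
have [qv|vq] := ltnP q v; first by have := kL_del0 hX c0 qv; rewrite hr; clia.
apply: leq_trans (leq_addr _ _); rewrite kNE c0 /nestc /=.
rewrite (_ : count _ _ = size (col P 0)) //; apply/eqP; rewrite -all_count; apply/allP => z zP.
apply: leq_trans vq _; apply: (col_ge iP) zP => _.
rewrite hP nth_ins; case: (posnP (pos (head [::] P') (Some m))) => [->|p0]; first by rewrite eqxx.
rewrite (ltn_eqF p0); have pH : 0 < size (head [::] P').
  exact: leq_trans p0 (pos_le_size _ _).
apply: (dom_min h (@qX' 0)); case: (P') pH => //= R T R0.
by rewrite col_cons R0 inE eqxx.
Qed.

Lemma sorted_leq_count s v i : sorted leq s -> i < size s -> (nth 0 s i < v) = (i < count (gtn v) s).
Proof.
elim: s i => // x s IH i /= ps; have := IH ^~ (path_sorted ps) => {}IH.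
case: (ltnP x v) => xv.
  by case: i => [|i] /= hi; [rewrite xv | rewrite IH].
have n0 : count (gtn v) s = 0.
  apply: count0 => y ys; rewrite -leqNgt; apply: leq_trans xv _.
  exact: (allP (order_path_min leq_trans ps)).
by case: i => [|i] /= hi; [rewrite ltnNge xv n0 | rewrite IH // n0].
Qed.

Lemma count_gtn_leq v s : count (gtn v) s + count (leq v) s = size s.
Proof. by elim: s => //= y s <-; clia. Qed.

Lemma sorted_dominance A B h : sorted leq A -> sorted leq B -> size A = h -> size B = h ->
  (forall i, i < h -> nth 0 B i <= nth 0 A i) <->
  (forall v, h <= count (leq v) A + count (gtn v) B).
Proof.
move=> sA sB hA hB; split=> [H v|H i ih].
  have := count_gtn_leq v A; rewrite hA => e; rewrite -{1}e addnC leq_add2l.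
  rewrite leqNgt; apply/negP => lt.
  have iA : count (gtn v) B < size A by apply: leq_trans lt (count_size _ _).
  have := lt; rewrite -sorted_leq_count // => h1.
  have h2 := leq_ltn_trans (H _ (_ : count (gtn v) B < h)) h1.
  have : nth 0 B (count (gtn v) B) < v by apply: h2; rewrite -hA.
  by rewrite sorted_leq_count ?ltnn // hB -hA.
rewrite leqNgt; apply/negP => lt; have := H (nth 0 B i).
have := count_gtn_leq (nth 0 B i) A; rewrite hA => e; rewrite -{1}e addnC leq_add2l leqNgt.
move/negP; apply; apply: leq_ltn_trans (_ : i < _).
  by rewrite leqNgt -sorted_leq_count ?hB // ltnn.
by rewrite -sorted_leq_count // hA.
Qed.

(** * Reverse insertion on tableaux *)

Lemma row_size_gt0 (A : Type) (X : seq (seq A)) r c : c < size (row X r) -> r < size X.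
Proof. by move=> h; rewrite ltnNge; apply/negP => /(nth_default [::]) e; rewrite /row e in h. Qed.

Lemma mem_cells (A : Type) (X : seq (seq A)) r c : ((r, c) \in cells X) = (c < size (row X r)).
Proof.
apply/flatten_mapP/idP => [[r' _ /mapP[c']]|h].
  by rewrite mem_iota => h [-> ->].
exists r; first by rewrite mem_iota /= add0n; apply: row_size_gt0 h.
by apply/mapP; exists c; rewrite // mem_iota.
Qed.

Definition tshape (A : Type) (X : seq (seq A)) : Prop :=
  (forall i, size (row X i.+1) <= size (row X i)) /\ (forall i, i < size X -> 0 < size (row X i)).

Lemma tshapeP (A : Type) (X : seq (seq A)) : reflect (tshape X) (is_shape (shape X)).
Proof.
have szn i : i < size X -> nth 0 (shape X) i = size (row X i).
  by move=> iX; rewrite (nth_map [::]).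
apply: (iffP andP) => [[/all_nthP h1 /(sortedP 0) h2]|[h1 h2]].
  split=> i; last by move=> iX; rewrite -szn //; apply: h1; rewrite size_map.
  have [iX|iX] := ltnP i.+1 (size X); last by rewrite {1}/row nth_default.
  by rewrite -!szn ?(ltnW iX) //; apply: h2; rewrite size_map.
split; first by apply/(all_nthP 0) => i; rewrite size_map => iX; rewrite szn // h2.
apply/(sortedP 0) => i; rewrite size_map => iX; rewrite !szn ?(ltnW iX) //; exact: h1.
Qed.

Lemma inc_rowsP P : inc P <->
  [/\ forall i, i < size P -> okrow (row P i) & forall i, above (row P i) (row P i.+1)].
Proof.
elim: P => [|R T IH]; first by split=> // _; split=> // i; rewrite /row !nth_nil.
split=> [[oR aR /IH[h1 h2]]|[h1 h2]].
  by split=> [[|i]|[|i]] //; [apply: h1 | apply: h2].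
split; first exact: (h1 0).
  by rewrite -nth0; apply: (h2 0).
by apply/IH; split=> i; [apply: (h1 i.+1) | apply: (h2 i.+1)].
Qed.

Lemma incP P : increasing P <-> inc P.
Proof.
rewrite inc_rowsP; split.
  case/andP=> /andP[/andP[/tshapeP[sh1 sh2] /allP h1] /allP h2] /allP h3.
  have e1 r c : c < size (row P r) -> 0 < entry P r c.
    by move=> h; apply: (h1 (r, c)); rewrite mem_cells.
  have e2 r c : c.+1 < size (row P r) -> entry P r c < entry P r c.+1.
    by move=> h; have := h2 (r, c); rewrite mem_cells (ltnW h) /= h; apply.
  have e3 r c : c < size (row P r.+1) -> entry P r c < entry P r.+1 c.
    move=> h; have := h3 (r, c); rewrite mem_cells (leq_trans h (sh1 r)) /= h; exact.
  split=> i; last by split=> [|k /e3]; first exact: sh1.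
  move=> iP; split; [by rewrite -size_eq0 -lt0n sh2 | by apply: sorted_nth => c /e2|].
  by apply: all_nth => c /e1.
case=> h1 h2.
have ok r c : c < size (row P r) -> okrow (row P r) by move=> /row_size_gt0 /h1.
apply/andP; split; first (apply/andP; split; first (apply/andP; split)).
- apply/tshapeP; split=> i; first by have [] := h2 i.
  by move=> /h1[]; case: (row P i).
- apply/allP => -[r c]; rewrite mem_cells /= => h; have [_ _ /allP h0] := ok _ _ h.
  by apply/h0/nth_mem.
- apply/allP => -[r c]; rewrite mem_cells /= => h; have [_ s _] := ok _ _ h.
  by apply/implyP => h'; apply: nth_lt.
- apply/allP => -[r c]; rewrite mem_cells /= => h; apply/implyP => h'.
  by have [_] := h2 r; apply.
Qed.

Lemma size_col_shape P X j : shape P = shape X -> size (col P j) = size (col X j).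
Proof.
have e Y : size (col Y j) = count (fun n => j < n) (shape Y).
  by rewrite /col size_map size_filter /shape count_map.
by rewrite !e => ->.
Qed.

Lemma lt_size_col P i j : inc P -> (i < size (col P j)) = (j < size (row P i)).
Proof.
elim: P i => [|R T IH] i iP; first by rewrite /row nth_nil.
have [oR [aR1 aR2] iT] := iP; rewrite col_cons.
have colT : size R <= j -> col T j = [::].
  move=> Rj; case E: (col T j) => [//|z s]; have : z \in col T j by rewrite E inE eqxx.
  by case/mem_col => S [ST jS _]; have [h1 _] := inc_above iP ST;
    have := leq_trans jS (leq_trans h1 Rj); rewrite ltnn.
case: i => [|i].
  by rewrite [row _ _]/=; case: (ltnP j (size R)) => //= /colT->.
by rewrite row_cons -IH //; case: (ltnP j (size R)) => //= /colT->.
Qed.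

Lemma size_col_outer P r : inc P -> outer P r -> size (col P (size (row P r)).-1) = r.+1.
Proof.
move=> iP [rP hr]; apply/eqP; rewrite eqn_leq leqNgt !lt_size_col // -leqNgt.
by apply/andP; split; clia.
Qed.

Lemma K_dominatesP P Q : inc P -> shape P = shape (LQ Q) ->
  (forall S i, S \in LQ Q -> i.+1 < size S -> nth 0 S i.+1 <= nth 0 S i) ->
  K_dominates P Q <-> dom P (LQ Q).
Proof.
move=> iP sPQ dQ.
have D j : (forall i, i < size (col P j) ->
      nth 0 (Kcol tri_ge (LQ Q) j) i <= nth 0 (Kcol tri_lt P j) i) <->
    (forall v, size (col P j) <= kN P j v + kL (LQ Q) j v).
  apply: sorted_dominance; rewrite ?size_Kcol ?size_KcolQ //; try exact: sort_sorted leq_total _.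
  exact/esym/size_col_shape.
split=> [h j|h [i j]].
  by apply/D => i; rewrite lt_size_col // => hi; apply: (h (i, j)); rewrite mem_cells.
by rewrite mem_cells -lt_size_col // => hi; apply: (D j).2 => //; apply: h.
Qed.

Lemma rins_fun P r al P' m a P2 m2 a2 : rins P r al P' m a -> rins P r al P2 m2 a2 ->
  [/\ P' = P2, m = m2 & a = a2].
Proof.
move=> ri; elim: ri P2 m2 a2 => {P r al P' m a} [R T|R T q|R T r al T' e a q ri IH] P2 m2 a2 h.
- by inversion h.
- by inversion h; subst; split.
- inversion h as [| |R1 T1 r1 al1 T2 e2 b q2 ri2]; subst.
  by rewrite /q; have [-> -> ->] := IH _ _ _ ri2.
Qed.

Lemma row_catE (A : Type) (X Y : seq (seq A)) R : row (X ++ R :: Y) (size X) = R.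
Proof. by rewrite /row nth_cat ltnn subnn. Qed.

Lemma set_nth_cat (A : Type) (d : A) (X Y : seq A) y z :
  set_nth d (X ++ y :: Y) (size X) z = X ++ z :: Y.
Proof. by elim: X => //= x X ->. Qed.

(** The row is read in the original tableau, with lower rows [B], while ejectability is tested in
    the partly treated one, with lower rows [T]. *)
Lemma rri_stepE A R B T e al (q := (pos R e).-1) : 0 < size R ->
  rri_step (A ++ R :: B) (A ++ R :: T) (size A) q e al =
  (A ++ set_nth 0 R q (rstep R T e al).1 :: T, (rstep R T e al).2).
Proof.
move=> sR; have qR : q < size R by have := pos_le_size R e; clia.
have idq : A ++ set_nth 0 R q (nth 0 R q) :: T = A ++ R :: T by rewrite upd_id.
have se x : set_entry (A ++ R :: T) (size A) q x = A ++ set_nth 0 R q x :: T.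
  by rewrite /set_entry row_catE set_nth_cat.
have dT : drop (size A).+1 (A ++ R :: T) = T.
  by rewrite -cat_rcons -(size_rcons A R) drop_size_cat.
have hT : row (A ++ R :: T) (size A).+1 = head [::] T.
  by rewrite /row -cat_rcons -(size_rcons A R) nth_cat ltnn subnn nth0.
rewrite /rri_step /rstep /max_ejectable /entry row_catE dT hT -/(ejcands T (nth 0 R q) e) -/q.
move: q qR idq se => q qR idq se; case: ifP => _; first by rewrite /= idq.
case: al; case: e => [h|] /=; first (case: ifP => _ /=; first by rewrite se);
  by case: (ejcands _ _ _) => [|y s] /=; rewrite ?idq ?se.
Qed.

(** The loop runs towards row 0, so the induction strips the last row of [A]; one iteration is one
    [Rins_row]. *)
Lemma rri_loop_rins A R B T e al r al0 (q := (pos R e).-1) :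
  all (fun S => 0 < size S) (A ++ [:: R]) ->
  rins (R :: B) r al0 (set_nth 0 R q (rstep R T e al).1 :: T) (nth 0 R q) (rstep R T e al).2 ->
  exists a, rins (A ++ R :: B) (size A + r) al0
    (rri_loop (A ++ R :: B) (A ++ R :: T) (size A) q e al) (path_top (A ++ R :: B) (size A) q) a.
Proof.
rewrite /q => {q}; elim/last_ind: A R B T e al r => [|A S IH] R B T e al r.
  rewrite /= andbT => sR; have := rri_stepE [::] B T e al sR; rewrite !cat0s /= => ->.
  by move=> ri; exists (rstep R T e al).2.
move=> hall ri; rewrite -cats1 -catA all_cat in hall.
have /andP[hA /= /and3P[sS sR _]] := hall.
have hAS : all (fun S => 0 < size S) (A ++ [:: S]) by rewrite all_cat hA /= sS.
have [a ri'] := IH S (R :: B) _ (Some (nth 0 R (pos R e).-1)) _ r.+1 hAS (Rins_row S ri).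
exists a; rewrite !cat_rcons size_rcons addSnnS.
have st := rri_stepE (rcons A S) B T e al sR; rewrite !cat_rcons size_rcons in st.
have eR : row (A ++ [:: S, R & B]) (size A).+1 = R.
  by rewrite -cat_rcons -(size_rcons A S) row_catE.
by rewrite /= st /entry eR /bump_col row_catE.
Qed.

Lemma delete_cell_cat (A : Type) (X Y : seq (seq A)) R :
  all (fun S => 0 < size S) (X ++ R :: Y) ->
  delete_cell (X ++ R :: Y) (size X) (size R).-1 =
  X ++ (if size R == 1 then Y else take (size R).-1 R :: Y).
Proof.
rewrite all_cat /= => /and3P[hX sR hY].
have fl (Z : seq (seq A)) : all (fun S => 0 < size S) Z -> [seq S <- Z | size S != 0] = Z.
  by move=> h; apply/all_filterP; apply: sub_all h => S; rewrite lt0n.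
rewrite /delete_cell row_catE set_nth_cat filter_cat fl //=; congr (_ ++ _).
rewrite size_take ltn_predL sR fl //.
by case: (size R) sR => [|[|n]].
Qed.

Lemma inc_nonempty P : inc P -> all (fun S => 0 < size S) P.
Proof. by move=> iP; apply/allP => S /(inc_okrow iP)[]; case: S. Qed.

Lemma rev_insert_rins P r al : inc P -> r < size P ->
  exists a, rins P r al (rev_insert P r (size (row P r)).-1 al).1
                (rev_insert P r (size (row P r)).-1 al).2 a.
Proof.
move=> iP rP; have E : P = take r P ++ row P r :: drop r.+1 P.
  by rewrite /row -drop_nth // cat_take_drop.
have sz : size (take r P) = r by rewrite size_take rP.
have pN R : (size R).-1 = (pos R None).-1 by rewrite /pos /= count_predT.
move: E sz iP {rP}; move: (take r P) (row P r) (drop r.+1 P) => A R B -> <- iP {P r}.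
have nP := inc_nonempty iP.
rewrite /rev_insert; case: al.
  case/lastP: A iP nP => [|A S] iP nP /=.
    exists true; have := delete_cell_cat nP; rewrite /= => ->.
    by rewrite /entry /row /= nth_last; apply: Rins_del.
  rewrite size_rcons.
  have e1 : entry (rcons A S ++ R :: B) (size A).+1 (size R).-1 = last 0 R.
    by rewrite /entry -(size_rcons A S) row_catE nth_last.
  have e2 : row (rcons A S ++ R :: B) (size A) = S by rewrite cat_rcons row_catE.
  have e3 := delete_cell_cat nP; rewrite size_rcons in e3.
  rewrite /= e1 e3 /bump_col e2 !cat_rcons.
  have hAS : all (fun S => 0 < size S) (A ++ [:: S]).
    by move: nP; rewrite cat_rcons !all_cat /= => /and4P[-> -> _ _].
  have [a h] := rri_loop_rins hAS (Rins_row S (Rins_del R B)).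
  by exists a; move: h; rewrite addn1.
have hA : all (fun S => 0 < size S) (A ++ [:: R]).
  by move: nP; rewrite !all_cat /= => /and3P[-> ->].
by have := rri_loop_rins hA (Rins_zero R B); rewrite addn0 /= pN.
Qed.

(** * The Pieri rule *)

Lemma mem_ins m R : sorted ltn R -> m \in ins m R.
Proof.
move=> sR; have := @nth_mem (ins m R) (pos R (Some m)).
by rewrite nth_ins eqxx size_ins leq_max ltnSn; apply.
Qed.

Lemma size_row_head P r : inc P -> size (row P r) <= size (head [::] P).
Proof.
move=> /inc_rowsP[_ h]; rewrite head_row; elim: r => // r IH.
by apply: leq_trans IH; have [] := h r.
Qed.

(** The row receiving [e] contains [e.+1] only when (D) is being undone, and then [e.+1] is inserted
    below and ejectable by induction. In the Pieri rule this makes the first inserted value a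
    candidate for [nexte]. *)
Lemma fins_ejectable T e T' r al : inc T -> 0 < e -> fins T e = (T', r, al) -> ejectable T' e.
Proof.
elim: T e T' r al => [|R T IH] e T' r al; first by move=> _ _ [<- _ _] /=; rewrite !inE eqxx gtn_eqF.
move=> iRT e0; have [[_ sR _] aRT iT] := iRT.
have me : e \in ins e R by apply: mem_ins.
have big k : pos R (Some e) < k -> k < size R -> nth 0 R (pos R (Some e)) < nth 0 R k.
  by move=> *; apply: nth_lt.
have succ : e.+1 \in ins e R -> pos R (Some e) < size R ->
    nth 0 R (pos R (Some e)) = e /\ e.+1 \in R.
  move=> /memR_nth[k kR]; rewrite nth_ins; case: eqVneq => [_ h|nk kk]; first by clia.
  move=> pR; have kR' : k < size R by move: kR; rewrite size_ins; clia.
  have yk : ~~ (nth 0 R k < e) by rewrite kk -leqNgt.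
  have := lto_nth (Some e) sR kR'; rewrite /= (negbTE yk) => /esym/negbT; rewrite -leqNgt => pk.
  have pk' : pos R (Some e) < k by rewrite ltn_neqAle eq_sym nk.
  have := pos_ge sR pR; have := big k pk' kR'; rewrite kk => h1 h2.
  by split; [clia | rewrite -kk; apply: nth_mem].
rewrite /=; case: eqP => [pE [<- _ _]|/eqP pN] /=.
  rewrite me; suff -> : e.+1 \notin ins e R by [].
  apply/negP => /memR_nth[k]; rewrite size_ins nth_ins pE => kR.
  case: eqVneq => [_ h|nk h]; first by clia.
  have kR' : k < size R by clia.
  by have := lto_nth (Some e) sR kR'; rewrite pE kR' /= h; clia.
have qR : pos R (Some e) < size R by rewrite ltn_neqAle pN pos_le_size.
case E: (nexte R T e) => [e'|].
  case F: (fins T e') => [[T2 r2] al2] [<- _ _] /=; rewrite me /=.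
  case: (boolP (_ \in _)) => //= /succ/(_ qR)[y1 y2].
  by move: E F; rewrite /nexte y1 eqxx y2 /= => -[<-]; apply: IH.
move=> [<- _ _] /=; rewrite me /=; case: (boolP (_ \in _)) => //= /succ/(_ qR)[y1 y2].
by move: E; rewrite /nexte y1 eqxx y2.
Qed.

Lemma fins_inc P m P2 r al : inc P -> 0 < m -> fins P m = (P2, r, al) -> inc P2 /\ outer P2 r.
Proof. by move=> iP m0 /(rins_fins iP m0)[a []]. Qed.

Lemma fins_cons R T m P r al : inc (R :: T) -> 0 < m -> fins (R :: T) m = (P, r, al) ->
  [\/ [/\ pos R (Some m) = size R, P = ins m R :: T & r = 0],
      [/\ pos R (Some m) < size R, nexte R T m = None, P = ins m R :: T & r = 0]
    | exists e T2 r2 al2, [/\ pos R (Some m) < size R, nexte R T m = Some e,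
        fins T e = (T2, r2, al2), P = ins m R :: T2 & r = r2.+1]].
Proof.
move=> iRT m0 /=; case: eqP => [pE [<- <- _]|/eqP pN]; first by apply: Or31.
have qR : pos R (Some m) < size R by rewrite ltn_neqAle pN pos_le_size.
case E: (nexte R T m) => [e|]; last by move=> [<- <- _]; apply: Or32.
case F: (fins T e) => [[T2 r2] al2] [<- <- _].
by apply: Or33; exists e, T2, r2, al2.
Qed.

(* This turns the choice of the rightmost cell in [Psi] into the condition
   [i_j = i_(j+1) -> a_j > a_(j+1)] on compatible pairs. *)
Lemma fins_fins P0 m' P' r' al' m P r al :
  inc P0 -> 0 < m' -> 0 < m -> fins P0 m' = (P', r', al') -> fins P' m = (P, r, al) ->
  ((size (row P' r')).-1 < (size (row P r)).-1) = (m' < m).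
Proof.
elim: P0 m' P' r' al' m P r al => [|R0 T0 IH] m' P' r' al' m P r al iP0 m'0 m0.
  move=> [<- <- _] /=; rewrite /pos /= addn0; case: ltnP => h /=.
    by move=> [<- <- _]; rewrite /row /= /ins /pos /= h.
  case: nexte => [e|].
    by move=> [<- <- _]; rewrite /row /= ltn0.
  by move=> [<- <- _]; rewrite /row /= /ins /pos /= [m' < m]ltnNge h.
move=> F1 F2; have [iP' oP'] := fins_inc iP0 m'0 F1.
have [iP oP] := fins_inc iP' m0 F2.
have [[_ sR0 _] _ iT0] := iP0.
have cP := size_row_head r iP.
have [R' [T' [EP' ER']]] : exists R' T', P' = R' :: T' /\ R' = ins m' R0.
  case: (fins_cons iP0 m'0 F1) => [[_ -> _]|[_ _ -> _]|[e [T2 [r2 [al2 [_ _ _ -> _]]]]]];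
    by do 2 eexists.
move: iP' oP' F2; rewrite EP' => iP' oP' F2; have [[_ sR' _] aRT' iT'] := iP'.
set q' := pos R0 (Some m').
have sz' : size R' = maxn q'.+1 (size R0) by rewrite ER' size_ins.
have q'R' : q' < size R' by rewrite sz' leq_max ltnSn.
have R'q' : nth 0 R' q' = m' by rewrite ER' nth_ins eqxx.
have qE : (m' < m) = (q' < pos R' (Some m)) by rewrite -R'q' -lto_nth.
have szP : pos R' (Some m) < size R' -> size (row P r) <= size R'.
  move=> pR; apply: leq_trans cP _; have szI : size (ins m R') = size R' by rewrite size_ins; clia.
  by case: (fins_cons iP' m0 F2) => [[_ -> _]|[_ _ -> _]|[e [T2 [r2 [al2 [_ _ _ -> _]]]]]];
    rewrite /= szI.
have szPa : pos R' (Some m) = size R' -> (size (row P r)).-1 = size R'.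
  move=> pR; case: (fins_cons iP' m0 F2) => [[_ -> ->]|[h _ _ _]|[e [T2 [r2 [al2 [h _ _ _ _]]]]]].
  - by rewrite /row /= size_ins pR; clia.
  - by rewrite pR ltnn in h.
  - by rewrite pR ltnn in h.
have pR' := pos_le_size R' (Some m).
(* If the first insertion stops in row 0, its cell is the last one of [R'], and the second ends
   further right exactly when [m] lands past [q']. *)
have fin : (size (row P' r')).-1 = q' -> q'.+1 = size R' ->
    ((size (row P' r')).-1 < (size (row P r)).-1) = (m' < m).
  move=> -> q'E; rewrite qE; have [h|h] := ltnP q' (pos R' (Some m)).
    by rewrite szPa; clia.
  by have := szP ltac:(clia); clia.
rewrite -EP'; case: (fins_cons iP0 m'0 F1) => [[h1 EP r0]|[h1 h2 EP r0]|].
- by apply: fin; [rewrite r0 EP' /row /= -/q'; clia | rewrite sz' /q' h1; clia].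
- have [_ _ aft _ _] := nexte_facts true iP0 m'0 h1; rewrite h2 in aft.
  have : size R0 <= q'.+1.
    by rewrite leqNgt; apply/negP => h; have := aft _ (ltnSn _) h.
  move=> h3; apply: fin; last by rewrite sz'; clia.
  by rewrite r0 EP' /row /=; clia.
move=> [e' [T2 [r2 [al2 [h1 E' F' EP rE]]]]].
have [_ me' aft' _ _] := nexte_facts true iP0 m'0 h1; rewrite E' /= in me' aft'.
have ET : T' = T2 by move: EP; rewrite EP' => -[].
rewrite -ET in F'; have e'0 : 0 < e' by clia.
have ej := fins_ejectable iT0 e'0 F'.
have szR : size R' = size R0 by rewrite sz'; clia.
have e'R k : q' < k -> k < size R' -> e' <= nth 0 R' k.
  move=> qk kR; rewrite ER' nth_ins gtn_eqF // leqNgt.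
  by apply: aft'; rewrite -?szR.
have c'E : row P' r' = row T' r2 by rewrite rE EP'.
rewrite c'E; have c'T := size_row_head r2 iT'; have c'R : size (head [::] T') <= size R' by case: aRT'.
have [iT2 [r2T _]] := fins_inc iT0 e'0 F'.
have pos_row : 0 < size (row T' r2).
  have /inc_rowsP[h _] := iT'; by have [] := h _ r2T; case: (row T' r2).
case: (fins_cons iP' m0 F2) => [[p1 _ _]|[p1 p2 EP2 r0]|[e [T3 [r3 [al3 [p1 E F EP2 rE2]]]]]].
- by rewrite szPa // qE p1 q'R'; clia.
(* The second insertion stops in row 0 without a new cell. Had [m] landed at [q'], the ejectable
   value [e'] would have been a candidate for [nexte]. *)
- have [my me aft rs _] := nexte_facts false iP' m0 p1; rewrite p2 in aft rs.
  have szI : size (ins m R') = size R' by rewrite size_ins; clia.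
  have cE : size (row P r) = size R' by rewrite EP2 r0 /row /= szI.
  have [_ _ _ + _] := rs; rewrite /pos /= count_predT szI => hT.
  rewrite cE qE; have [h|h] := ltnP q' (pos R' (Some m)); first by clia.
  have pl : size R' <= (pos R' (Some m)).+1.
    by rewrite leqNgt; apply/negP => hh; have := aft _ (ltnSn _) hh.
  have NP := nexteP R' T' m; rewrite p2 in NP; case: NP => [[]//|[]//|[_ _ [+ _]]].
  have -> : pos R' (Some m) = q' by clia.
  by rewrite R'q' => /(_ e' me' isT); rewrite ej orbT.
have IHe := IH e' T' r2 al2 e T3 r3 al3 iT0 e'0 _ F' F.
have [my me aft rs _] := nexte_facts true iP' m0 p1; rewrite E /= in me.
rewrite EP2 rE2 row_cons IHe; last by clia.
(* By induction [e'] and [e] are to be compared. If [m] lands past [q'], the bumped entry is at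
   least [e'], and [e] exceeds it or equals it without being ejectable. Otherwise the bumped entry
   is at most [m' < e'], and the ejectable [e'] bounds [e] from above. *)
rewrite qE; have [h|h] := ltnP q' (pos R' (Some m)).
  have e'y : e' <= nth 0 R' (pos R' (Some m)) by apply: e'R.
  case: (nexteP R' T' m) => [[y1 y2]|[y1 y2]|[y1 y2 [y3 y4]]].
  - by rewrite E => -[ee]; rewrite y1 in e'y; clia.
  - rewrite E => -[ee]; rewrite -ee ltn_neqAle ?ee -?ee in e'y *.
    rewrite e'y andbT; apply/eqP => eq; move: y2; rewrite -ee -eq ej //.
  - by have [y5 _] := y4 e E; clia.
have y' : nth 0 R' (pos R' (Some m)) <= m' by rewrite -R'q'; apply: nth_le.
apply/negbTE; rewrite -leqNgt; have mm' : m <= m' by rewrite leqNgt qE ltnNge h.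
case: (nexteP R' T' m) => [[y1 y2]|[y1 y2]|[y1 y2 [y3 y4]]].
- by rewrite E => -[ee]; clia.
- by rewrite E => -[ee]; clia.
- rewrite leqNgt; apply/negP => ee; have := y3 e' ltac:(clia); rewrite E /= ej orbT => /(_ ee).
  by [].
Qed.

(** * Adding an entry to a set-valued tableau *)

(** The default 0 of [nth] also covers the creation of a new bottom row. *)
Definition ashape (sh : seq nat) r := set_nth 0 sh r (nth 0 sh r).+1.

Lemma ashape_inj sh sh' r : all (ltn 0) sh -> all (ltn 0) sh' -> r <= size sh -> r <= size sh' ->
  ashape sh r = ashape sh' r -> sh = sh'.
Proof.
elim: sh sh' r => [|n sh IH] [|n' sh'] [|r] //=.
- by case: n' => // n' _ _ _ _ [].
- by case: n => // n _ _ _ _ [].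
- by move=> _ _ _ _ [-> ->].
- by move=> /andP[_ h] /andP[_ h'] hr hr' [-> e]; rewrite (IH sh' r).
Qed.

Lemma fins_shape P m P2 r al : inc P -> fins P m = (P2, r, al) ->
  if al then r <= size P /\ shape P2 = ashape (shape P) r else shape P2 = shape P.
Proof.
elim: P m P2 r al => [|R T IH] m P2 r al /=; first by move=> _ [<- <- <-].
move=> [_ _ iT]; have szI : pos R (Some m) != size R -> size (ins m R) = size R.
  by move=> pN; have := pos_le_size R (Some m); rewrite size_ins; clia.
case: eqP => [pE [<- <- <-]|/eqP/szI {}szI]; first rewrite /= size_ins pE.
  by split=> //; rewrite /ashape /=; congr (_ :: _); clia.
case: nexte => [e|]; last by move=> [<- <- <-] /=; rewrite szI.
case F: (fins T e) => [[T2 r2] al2] [<- <- <-].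
by have := IH _ _ _ _ iT F; case: al2 {F} => [[h1 h2]|h]; rewrite /= ?szI ?h2 ?h.
Qed.

(** [q] is put at the head of the list, which keeps the cell strictly increasing when [q] is a new
    minimum. *)
Definition qadd (Q : rsvt) r q (al : bool) : rsvt :=
  set_nth [::] Q r (if al then rcons (row Q r) [:: q]
    else set_nth [::] (row Q r) (size (row Q r)).-1 (q :: last [::] (row Q r))).

Arguments qadd : simpl never.

Lemma qadd_cons R Q r q al : qadd (R :: Q) r.+1 q al = R :: qadd Q r q al.
Proof. by []. Qed.

Lemma set_nth_rcons (A : Type) (d : A) s x y : set_nth d (rcons s x) (size s) y = rcons s y.
Proof. by elim: s => //= z s ->. Qed.

Lemma qadd0 S s Q q : qadd (rcons S s :: Q) 0 q false = rcons S (q :: s) :: Q.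
Proof. by rewrite /qadd /row /= size_rcons last_rcons set_nth_rcons. Qed.

Lemma row_qadd Q r q al i : row (qadd Q r q al) i =
  if i == r then if al then rcons (row Q r) [:: q]
    else set_nth [::] (row Q r) (size (row Q r)).-1 (q :: last [::] (row Q r))
  else row Q i.
Proof. by rewrite /row /qadd nth_set_nth. Qed.

Definition addable (Q : rsvt) r (al : bool) := if al then r <= size Q else 0 < size (row Q r).

Lemma size_row_qadd Q r q al i : addable Q r al ->
  size (row (qadd Q r q al) i) = size (row Q i) + (al && (i == r)).
Proof.
rewrite row_qadd; case: eqVneq => [->|_]; last by rewrite andbF addn0.
case: al => /= h; first by rewrite size_rcons addn1.
by rewrite addn0 size_set_nth; case: (size _) h => // n _; rewrite maxnn.
Qed.

Lemma qcell_qadd Q r q al i k (c := (size (row (qadd Q r q al) r)).-1) : addable Q r al ->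
  qcell (qadd Q r q al) i k =
  if (i == r) && (k == c) then if al then [:: q] else q :: qcell Q r c else qcell Q i k.
Proof.
rewrite /c => {c} h; rewrite size_row_qadd // eqxx andbT /qcell row_qadd; case: eqVneq => [->|] //=.
case: al h => /= [_|h]; last by rewrite addn0 nth_set_nth /= nth_last.
by rewrite addn1 nth_rcons; case: ltngtP => // kr; rewrite nth_default // ltnW.
Qed.

Lemma shape_qadd Q r q al : addable Q r al ->
  shape (qadd Q r q al) = if al then ashape (shape Q) r else shape Q.
Proof.
elim: Q r => [|R Q IH] [|r]; try by case: al.
- case: al {IH} => h; first by rewrite /qadd /ashape /= size_rcons.
  by case/lastP: R h => // S s _; rewrite qadd0 /= !size_rcons.
- by move=> h; rewrite qadd_cons /= IH //; case: al {IH} h.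
Qed.

Lemma perm_qentries Q r q al : addable Q r al -> perm_eq (qentries (qadd Q r q al)) (q :: qentries Q).
Proof.
rewrite /qentries; elim: Q r => [|R Q IH] [|r]; try by case: al.
- case: al {IH} => h.
    rewrite /qadd /row /= flatten_cat flatten_rcons -catA perm_catC /= perm_cons perm_catC //.
    by rewrite -flatten_cat.
  case/lastP: R h => // S s _; rewrite qadd0 /= !flatten_cat !flatten_rcons -!catA /=.
  by rewrite perm_catC /= perm_cons perm_catC.
- move=> h; rewrite qadd_cons /= !flatten_cat; have {}IH := IH r h.
  by rewrite (perm_trans (perm_cat (perm_refl _) IH)) // -cat1s perm_catCA.
Qed.

Lemma seqmax_cons x s : seqmax (x :: s) = maxn x (seqmax s).
Proof. by rewrite /seqmax big_cons. Qed.

Lemma seqmax1 x : seqmax [:: x] = x.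
Proof. by rewrite seqmax_cons /seqmax big_nil maxn0. Qed.

Lemma LQ_cons R Q : LQ (R :: Q) = map seqmax R :: LQ Q.
Proof. by []. Qed.

Lemma LQ_qadd Q r q : 0 < size (row Q r) ->
  (forall x, x \in qcell Q r (size (row Q r)).-1 -> q <= x) ->
  qcell Q r (size (row Q r)).-1 != [::] -> LQ (qadd Q r q false) = LQ Q.
Proof.
rewrite /qcell; elim: Q r => [|R Q IH] [|r] //; last first.
  by move=> h1 h2 h3; rewrite qadd_cons !LQ_cons IH.
case/lastP: R => // S s _; rewrite qadd0 /row /= size_rcons /= nth_rcons ltnn eqxx => h1 h2.
rewrite !map_rcons seqmax_cons (maxn_idPr _) //.
by apply: h1; apply: seqmax_mem.
Qed.

Lemma col_qadd Q r q k : r <= size Q ->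
  perm_eq (col (LQ (qadd Q r q true)) k)
    (if k == size (row Q r) then q :: col (LQ Q) k else col (LQ Q) k).
Proof.
elim: Q r => [|R Q IH] [|r] //.
- by move=> _; rewrite /qadd /row /= /LQ /= !col_cons /= seqmax1; case: k.
- move=> _; rewrite /qadd /row /= /LQ /= map_rcons !col_cons size_rcons size_map nth_rcons size_map.
  rewrite seqmax1 ltnS leq_eqVlt; case: eqVneq => [->|nk] /=.
    by rewrite ltnn.
  by case: (ltnP k (size R)).
- move=> rQ; rewrite qadd_cons !LQ_cons !col_cons; have := IH r rQ.
  change (row (R :: Q) r.+1) with (row Q r); case: eqVneq => _ h; last by rewrite perm_cat2l.
  by rewrite (perm_trans (perm_cat (perm_refl _) h)) // perm_catC /= perm_cons perm_catC.
Qed.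

Definition rows_nonempty (Q : rsvt) := all (fun R => 0 < size R) Q.

Definition qdel (Q : rsvt) r c q : rsvt :=
  if qcell Q r c == [:: q] then delete_cell Q r c
  else set_nth [::] Q r (set_nth [::] (row Q r) c (rem q (qcell Q r c))).

Lemma filter_rows_nonempty Q : rows_nonempty Q -> [seq R <- Q | size R != 0] = Q.
Proof. by move=> h; apply/all_filterP; apply: sub_all h => S; rewrite lt0n. Qed.

Lemma qaddK Q r q al (c := (size (row (qadd Q r q al) r)).-1) : rows_nonempty Q ->
  addable Q r al -> (al || (qcell Q r c != [::])) -> qdel (qadd Q r q al) r c q = Q.
Proof.
move=> rQ h h1; have := qcell_qadd q r c h; rewrite -/c !eqxx /= /qdel => ->.
move: h1; rewrite /c => {c}; case: al h => /= h h1.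
  rewrite eqxx; elim: Q r rQ h {h1} => [|R Q IH] [|r] //= /andP[R0 rQ] h.
    rewrite /delete_cell /qadd /row /= size_rcons /= -cats1 take_size_cat //.
    by rewrite -lt0n R0 filter_rows_nonempty.
  rewrite qadd_cons /delete_cell /= -lt0n R0; congr (_ :: _); exact: IH.
rewrite eqseq_cons eqxx /= (negbTE h1) size_row_qadd // addn0 {h1}.
elim: Q r {rQ} h => [|R Q IH] [|r] // h; last exact: (congr1 (cons R) (IH r h)).
case/lastP: R h => // S s _; rewrite qadd0 /qcell /row /= !size_rcons /= set_nth_rcons.
by rewrite nth_rcons ltnn eqxx.
Qed.

Lemma qdelK Q r q (c := (size (row Q r)).-1) : rows_nonempty Q -> r < size Q ->
  size (row Q r.+1) < size (row Q r) ->
  sorted ltn (qcell Q r c) -> q \in qcell Q r c -> (forall x, x \in qcell Q r c -> q <= x) ->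
  let al := qcell Q r c == [:: q] in
  qadd (qdel Q r c q) r q al = Q /\ addable (qdel Q r c q) r al.
Proof.
rewrite /c => {c} rQ rsz out; set s := qcell _ _ _ => ss qs mins /=; rewrite /qdel -/s.
have [sE|sN] := eqVneq s [:: q].
  move: sE; rewrite /s => {s ss qs mins}; rewrite /delete_cell /qcell.
  elim: Q r rQ rsz out => [|R Q IH] [|r] //= /andP[R0 rQ] rsz; last first.
    move=> out sE; have [e1 e2] := IH r rQ rsz out sE.
    by rewrite -lt0n R0 qadd_cons e1.
  case/lastP: R R0 => // S s _; rewrite /row /= !size_rcons /= nth_rcons ltnn eqxx => out ->.
  rewrite -cats1 take_size_cat // filter_rows_nonempty //.
  case: S out => [|x S] /=; last by rewrite /qadd /row /= -cats1.
  by case: (Q) rQ => //= R Q' /andP[R0 _]; rewrite ltnS leqn0 => /eqP R1; rewrite R1 in R0.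
have [s' sE s'N] : exists2 s', s = q :: s' & s' != [::].
  case: s sN ss qs mins => // x s' sN ss qs mins.
  have xq : x = q.
    apply/eqP; rewrite eqn_leq mins ?inE ?eqxx // andbT.
    move: qs; rewrite inE => /predU1P[->//|qs'].
    by have /allP/(_ q qs') := order_path_min ltn_trans ss; apply: ltnW.
  by rewrite xq in sN *; exists s' => //; apply: contra sN => /eqP->.
have -> : rem q s = s' by rewrite sE /= eqxx.
move: sE; rewrite /s => {s ss qs mins sN}; rewrite /qcell.
elim: Q r rQ rsz out => [|R Q IH] [|r] //= /andP[R0 rQ] rsz; last first.
  move=> out sE; have [e1 e2] := IH r rQ rsz out sE.
  by rewrite qadd_cons e1.
case/lastP: R R0 => // S s _; rewrite /row /= !size_rcons /= nth_rcons ltnn eqxx => out ->.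
by rewrite set_nth_rcons qadd0 size_rcons.
Qed.

Lemma mem_qentries Q x : reflect (exists r c, c < size (row Q r) /\ x \in qcell Q r c) (x \in qentries Q).
Proof.
apply: (iffP flattenP) => [[s /flattenP[R RQ sR] xs]|[r [c [cr xs]]]].
  have [r rQ er] := nthP [::] RQ; have [c cR ec] := nthP [::] sR.
  by exists r, c; rewrite /qcell /row er ec.
exists (qcell Q r c) => //; apply/flattenP; exists (row Q r); last exact: mem_nth.
by apply: mem_nth; apply: row_size_gt0 cr.
Qed.

Lemma tshape_nonempty Q : tshape Q -> rows_nonempty Q.
Proof. by case=> _ h; apply/(all_nthP [::]) => i /h. Qed.

Definition cellok (s : seq nat) := [&& s != [::], sorted ltn s & all (fun x => 0 < x) s].

Lemma seqminmaxP s t : s != [::] -> t != [::] ->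
  (seqmax t <= seqmin s <-> forall x y, x \in s -> y \in t -> y <= x) /\
  (seqmax t < seqmin s <-> forall x y, x \in s -> y \in t -> y < x).
Proof.
move=> s0 t0; have hs := seqmin_mem s0; have ht := seqmax_mem t0; split; split=> h.
- by move=> x y /seqmin_le xs /seqmax_ge yt; apply: leq_trans yt (leq_trans h xs).
- exact: h.
- by move=> x y /seqmin_le xs /seqmax_ge yt; apply: leq_ltn_trans yt (leq_trans h xs).
- exact: h.
Qed.

Lemma rsvtP Q : is_rsvt Q <-> [/\ tshape Q, forall r c, c < size (row Q r) -> cellok (qcell Q r c),
  forall r c x y, c.+1 < size (row Q r) -> x \in qcell Q r c -> y \in qcell Q r c.+1 -> y <= x &
  forall r c x y, c < size (row Q r.+1) -> x \in qcell Q r c -> y \in qcell Q r.+1 c -> y < x].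
Proof.
have ne s : cellok s -> s != [::] by case/and3P.
split.
  case/andP=> /andP[/andP[/tshapeP sh /allP h1] /allP h2] /allP h3; have [sh1 sh2] := sh.
  have ok r c : c < size (row Q r) -> cellok (qcell Q r c).
    by move=> h; apply: (h1 (r, c)); rewrite mem_cells.
  split=> // r c x y h.
    have := h2 (r, c); rewrite mem_cells (ltnW h) /= h => /(_ isT).
    by have [[e _] _] := seqminmaxP (ne _ (ok _ _ (ltnW h))) (ne _ (ok _ _ h)) => /e; apply.
  have h' := leq_trans h (sh1 r).
  have := h3 (r, c); rewrite mem_cells h' /= h => /(_ isT).
  by have [_ [e _]] := seqminmaxP (ne _ (ok _ _ h')) (ne _ (ok _ _ h)) => /e; apply.
case=> sh ok h2 h3; have [sh1 sh2] := sh.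
apply/andP; split; first (apply/andP; split; first (apply/andP; split)).
- exact/tshapeP.
- by apply/allP => -[r c]; rewrite mem_cells => /ok.
- apply/allP => -[r c]; rewrite mem_cells /= => h; apply/implyP => h'.
  have [[_ e] _] := seqminmaxP (ne _ (ok _ _ h)) (ne _ (ok _ _ h')); apply: e => x y.
  exact: h2.
- apply/allP => -[r c]; rewrite mem_cells /= => h; apply/implyP => h'.
  have [_ [_ e]] := seqminmaxP (ne _ (ok _ _ h)) (ne _ (ok r.+1 c h')); apply: e => x y.
  exact: h3.
Qed.

Lemma rightmostP l : l != [::] -> rightmost l \in l /\ forall rc, rc \in l -> rc.2 <= (rightmost l).2.
Proof.
case: l => // rc0 l _; rewrite /rightmost [head _ _]/=.
pose f (best rc : nat * nat) := if best.2 < rc.2 then rc else best.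
suff h m b : let z := foldl f b m in
    (z = b \/ z \in m) /\ b.2 <= z.2 /\ forall rc, rc \in m -> rc.2 <= z.2.
  have [h1 [h2 h3]] := h (rc0 :: l) rc0; split; last exact: h3.
  by case: h1 => [->|//]; rewrite inE eqxx.
elim: m b => [|rc m IH] b /=; first by split; [left | split].
have [h1 [h2 h3]] := IH (f b rc); have fb : b.2 <= (f b rc).2 /\ rc.2 <= (f b rc).2.
  by rewrite /f; case: ltnP => h; split=> //; apply: ltnW.
split.
  case: h1 => [->|h1]; last by right; rewrite inE h1 orbT.
  by rewrite /f; case: ifP => _; [right; rewrite inE eqxx | left].
split; first exact: leq_trans fb.1 h2.
move=> rc'; rewrite inE => /predU1P[->|/h3//]; exact: leq_trans fb.2 h2.
Qed.

(** * The map Psi *)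

Lemma shape_row (A B : Type) (X : seq (seq A)) (Y : seq (seq B)) : shape X = shape Y ->
  (forall i, size (row X i) = size (row Y i)) /\ size X = size Y.
Proof.
move=> e; have sz : size X = size Y by rewrite -(size_map size X) -/(shape X) e size_map.
split=> // i; have [iX|iX] := ltnP i (size X).
  have := congr1 (fun s => nth 0 s i) e; rewrite /shape !(nth_map [::]) // -?sz //.
by rewrite /row !nth_default // -sz.
Qed.

Lemma inTP P Q : inT (P, Q) <-> [/\ inc P, is_rsvt Q & shape P = shape Q].
Proof. by split=> [[/incP]|[/incP]] //= iP []. Qed.

(* One step of [Psi] removes the smallest entry [q] of [Q], emitting [m]; seen
   backwards, [m] is inserted in [P'] and [q] is added to the last cell. *)
Definition extends P Q P' Q' m q r al : Prop :=
  [/\ inT (P', Q'), fins P' m = (P, r, al), Q = qadd Q' r q al & addable Q' r al] /\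
  [/\ 0 < m, 0 < q, forall x, x \in qentries Q' -> q <= x &
      forall i k, k < size (row Q' i) -> q \in qcell Q' i k -> k < (size (row Q r)).-1].

Lemma qcell_lt_size (Q : rsvt) i k (x : nat) : x \in qcell Q i k -> k < size (row Q i).
Proof. by rewrite ltnNge => h; apply/negP => /(nth_default [::]) e; rewrite /qcell e in h. Qed.

Lemma qcell_nil (Q : rsvt) i k : is_rsvt Q -> k < size (row Q i) -> exists x, x \in qcell Q i k.
Proof.
move=> /rsvtP[_ ok _ _] /ok/and3P[]; case: (qcell _ _ _) => // x s _ _ _.
by exists x; rewrite inE eqxx.
Qed.

Lemma inT_extends P Q : inT (P, Q) -> qentries Q != [::] ->
  exists P' Q' m q r al, extends P Q P' Q' m q r al.
Proof.
move=> /inTP[iP rQ sPQ] Q0; have [shQ ok rt dn] := (rsvtP Q).1 rQ.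
have [szr szX] := shape_row sPQ.
have qQ := seqmin_mem Q0; have minq := @seqmin_le (qentries Q).
move: (seqmin _) qQ minq => q qQ minq.
have Rc0 : cells_with Q q != [::].
  have [r0 [c0 [h1 h2]]] := mem_qentries _ _ qQ.
  have : (r0, c0) \in cells_with Q q by rewrite mem_filter mem_cells /= h1 h2.
  by case: (cells_with Q q).
have [] := rightmostP Rc0; move: (rightmost _) => [r c].
rewrite mem_filter mem_cells /= => /andP[qrc cr] rmax.
have inQ i k x : x \in qcell Q i k -> x \in qentries Q.
  by move=> h; apply/mem_qentries; exists i, k; split=> //; apply: qcell_lt_size h.
have rm i k : q \in qcell Q i k -> k <= c.
  by move=> h; apply: (rmax (i, k)); rewrite mem_filter mem_cells /= h (qcell_lt_size h).
(* A cell to the right would have all its entries at most [q], hence contain the minimum [q],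
   against the choice of the rightmost cell. *)
have cE : c = (size (row Q r)).-1.
  apply/eqP; rewrite eqn_leq leqNgt; apply/andP; split; last first.
    rewrite -subn1 leq_subLR add1n leqNgt; apply/negP => h; have [y yc] := qcell_nil rQ h.
    have := rt _ _ _ _ h qrc yc; have := minq _ (inQ _ _ _ yc) => h1 h2.
    have yq : y = q by clia.
    by have := rm r c.+1; rewrite -yq => /(_ yc); rewrite ltnn.
  by apply/negP => h; clia.
have below i : q \in qcell Q i c -> size (row Q i.+1) <= c.
  move=> h; rewrite leqNgt; apply/negP => h'; have [y yc] := qcell_nil rQ h'.
  by have := dn _ _ _ _ h' h yc; have := minq _ (inQ _ _ _ yc); clia.
have outQ : size (row Q r.+1) < size (row Q r) by have := below r qrc; clia.
have rsz : r < size Q := row_size_gt0 cr.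
have oP : outer P r by split; [rewrite szX | rewrite !szr].
have minrc x : x \in qcell Q r (size (row Q r)).-1 -> q <= x.
  by rewrite -cE => /inQ/minq.
have srt : sorted ltn (qcell Q r (size (row Q r)).-1) by rewrite -cE; case/and3P: (ok _ _ cr).
rewrite cE in qrc.
have [] := qdelK (tshape_nonempty shQ) rsz outQ srt qrc minrc.
rewrite -cE in qrc *; set al := _ == _; set Q' := qdel _ _ _ _ => QE ad.
have [a ri] := rev_insert_rins al iP oP.1; move: ri.
case: (rev_insert _ _ _ _) => P' m /= ri.
have [iP' _ _ mP] := rins_state iP oP ri.
have F := fins_rins iP oP ri.
have m0 : 0 < m.
  have [_ _ /allP h] : okrow (head [::] P).
    by apply: (inc_okrow iP); case: (P) mP => //= R T _; rewrite inE eqxx.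
  exact: h.
(* For a deleted cell, both shapes give the common shape of [P] and [Q] by adding a cell in row [r],
   and this operation is injective. *)
have sE : shape P' = shape Q'.
  have := fins_shape iP' F; have := shape_qadd q ad; rewrite QE -sPQ.
  have adl : al -> r <= size Q' by move=> al1; move: ad; rewrite /addable al1.
  have : al -> all (ltn 0) (shape Q').
    rewrite /Q' /qdel -/al => ->; rewrite /delete_cell; apply/allP => n /mapP[S].
    by rewrite mem_filter => /andP[h _] ->; rewrite /= lt0n.
  case: (al) adl => /= adl h e; last by move=> e'; rewrite -e' e.
  case=> r1 e'; apply: (@ashape_inj _ _ r); rewrite ?size_map //; last by rewrite -e -e'.
  - by apply/allP => n /mapP[S /(inc_okrow iP')[S0 _ _] ->]; case: (S) S0.
  - exact: h.
  - exact: adl.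
have szQ i : size (row Q i) = size (row Q' i) + (al && (i == r)).
  by rewrite -QE size_row_qadd.
have cell i k : qcell Q i k =
    if (i == r) && (k == c) then if al then [:: q] else q :: qcell Q' r c else qcell Q' i k.
  by have := qcell_qadd q i k ad; rewrite QE -cE.
have sub i k x : k < size (row Q' i) -> x \in qcell Q' i k -> x \in qcell Q i k.
  move=> h1 h2; rewrite cell; case: ifP => // /andP[/eqP ir /eqP kc].
  rewrite ir kc in h1 h2; move: (szQ r) h1; rewrite eqxx andbT.
  by case: (al) => /= e h1; [clia | rewrite inE h2 orbT].
have subR i k : k < size (row Q' i) -> k < size (row Q i) by rewrite szQ; clia.
have subC i k : k < size (row Q' i) -> cellok (qcell Q' i k).
  move=> h1; have := ok i k (subR _ _ h1); rewrite cell; case: ifP => // /andP[/eqP ir /eqP kc].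
  rewrite ir kc in h1 *; have := szQ r; rewrite eqxx andbT.
  case E: al => /= e; first by clia.
  move=> /and3P[_ /= /path_sorted ss /andP[_ sp]]; rewrite /cellok ss sp !andbT.
  apply/negP => /eqP e'; have := E; rewrite /al cell !eqxx /= E e' eqxx.
  by [].
have inQ' x : x \in qentries Q' -> x \in qentries Q.
  by rewrite -QE (perm_mem (perm_qentries q ad)) inE => ->; rewrite orbT.
have rQ' : is_rsvt Q'.
  apply/rsvtP; split=> //.
  - by apply/tshapeP; rewrite -sE; move/incP: iP' => /andP[/andP[/andP[]]].
  - by move=> i k x y h hx hy; apply: (rt i k); rewrite ?subR ?sub // ltnW.
  - move=> i k x y h hx hy; apply: (dn i k); rewrite ?subR ?sub //.
    exact: qcell_lt_size hx.
exists P', Q', m, q, r, al; split; first by split=> //; apply/inTP.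
split=> //.
- by have [_ _ /allP h] := and3P (ok _ _ cr); apply: h.
- by move=> x /inQ' /minq.
- move=> i k h1 h2; have h3 := sub _ _ _ h1 h2; have := rm _ _ h3.
  rewrite -cE leq_eqVlt => /predU1P[kc|//]; rewrite kc in h1 h2 h3.
  (* A row with [q] in column [c] is the last one reaching that column, by [below]; so it is row
     [r], from whose cell [q] has been removed. *)
  have [ir|ri'|ir] := ltngtP i r.
  + have := below _ h3; have [sh1 _] := shQ.
    have mono d : size (row Q (i.+1 + d)) <= size (row Q i.+1).
      by elim: d => [|d IH]; rewrite ?addn0 // addnS; apply: leq_trans (sh1 _) IH.
    have := mono (r - i.+1); rewrite subnKC //; clia.
  + have := below _ qrc; have [sh1 _] := shQ.
    have mono d : size (row Q (r.+1 + d)) <= size (row Q r.+1).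
      by elim: d => [|d IH]; rewrite ?addn0 // addnS; apply: leq_trans (sh1 _) IH.
    by have := mono (i - r.+1); rewrite subnKC //; have := qcell_lt_size h3; clia.
  + rewrite ir in h1 h2; have := szQ r; rewrite eqxx andbT.
    case E: al => /= e; first by clia.
    have := ok _ _ cr; rewrite cell !eqxx /= E => /and3P[_ /= /(order_path_min ltn_trans)/allP h _].
    by have := h _ h2; rewrite /= ltnn.
Qed.

(** The bound on the columns containing [q] yields the strict conditions: neither the cell that
    receives [q] nor the cell above it contained [q] before. *)
Lemma extends_inT P' Q' m q P r al : inT (P', Q') -> 0 < m -> 0 < q -> fins P' m = (P, r, al) ->
  (forall x, x \in qentries Q' -> q <= x) ->
  (forall i k, k < size (row Q' i) -> q \in qcell Q' i k -> k < (size (row P r)).-1) ->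
  inT (P, qadd Q' r q al) /\ extends P (qadd Q' r q al) P' Q' m q r al.
Proof.
move=> iT m0 q0 F minq colq; have [iP' rQ' sPQ'] := (inTP _ _).1 iT.
have [iP oP] := fins_inc iP' m0 F; have [shQ ok rt dn] := (rsvtP Q').1 rQ'.
have [szr' szX'] := shape_row sPQ'; have FS := fins_shape iP' F.
have ad : addable Q' r al.
  rewrite /addable; case: (al) FS => [[h _]|h]; first by rewrite -szX'.
  have [e _] := shape_row h; rewrite -szr' -e; case: oP => _ h'; clia.
have sPQ : shape P = shape (qadd Q' r q al).
  by rewrite (shape_qadd q ad); case: (al) FS => [[_ ->]|->]; rewrite -?sPQ'.
have [szr szX] := shape_row sPQ; have [_ outP] := oP.
split; last by split=> //; split=> // i k; rewrite -szr; apply: colq.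
apply/inTP; split=> //; apply/rsvtP; set c := (size (row P r)).-1 in colq.
have cell i k : qcell (qadd Q' r q al) i k =
    if (i == r) && (k == c) then if al then [:: q] else q :: qcell Q' r c else qcell Q' i k.
  by have := qcell_qadd q i k ad; rewrite -szr.
have szQ i : size (row (qadd Q' r q al) i) = size (row Q' i) + (al && (i == r)).
  by rewrite size_row_qadd.
have old i k : k < size (row (qadd Q' r q al) i) -> ~~ ((i == r) && (k == c)) -> k < size (row Q' i).
  have := szQ r; rewrite -szr eqxx andbT => e; rewrite szQ; case: eqVneq => [->|_]; last by rewrite andbF addn0.
  by rewrite /= andbT => h1 h2; rewrite /c e in h2; clia.
have clt : c < size (row P r) by rewrite /c; clia.
have minc i k x : x \in qcell Q' i k -> q <= x.
  move=> h; apply: minq; apply/mem_qentries; exists i, k; split=> //; exact: qcell_lt_size h.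
have oldc : ~~ al -> cellok (qcell Q' r c).
  move=> al0; apply: ok; have := szQ r; rewrite -szr (negbTE al0) addn0 => <-; exact: clt.
have shP : is_shape (shape P) by move/incP: iP => /andP[/andP[/andP[]]].
split.
- by apply/tshapeP; rewrite -sPQ.
- move=> i k h; rewrite cell; case: ifP => [_|/negbT nrc]; last exact/ok/old.
  case E: al; first by rewrite /cellok /= q0.
  have /and3P[h1 h2 h3] := oldc (negbT E); rewrite /cellok /= q0 h3 !andbT.
  rewrite path_min_sorted ?h2 //; apply/allP => x hx /=.
  rewrite ltn_neqAle (minc _ _ _ hx) andbT; apply/negP => /eqP qx; rewrite -qx in hx.
  by have := colq r c (qcell_lt_size hx) hx; rewrite ltnn.
- move=> i k x y h; rewrite !cell.
  have nrc : (i == r) && (k == c) = false.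
    apply/negP => /andP[/eqP ir /eqP kc]; move: h; rewrite ir kc -szr /c; clia.
  rewrite nrc => hx; case: ifP => [/andP[/eqP ir /eqP kc]|/negbT nrc'] hy; last first.
    exact: rt (old _ _ h nrc') hx hy.
  have yqs : y = q \/ (y \in qcell Q' i k.+1).
    move: hy; rewrite ir kc; case: (al); rewrite inE; first by move/eqP; left.
    by case/predU1P; [left | right].
  case: yqs => [->|hy']; first exact: minc hx.
  exact: rt (qcell_lt_size hy') hx hy'.
- move=> i k x y h; rewrite !cell.
  have nrc : (i == r) && (k == c) = false.
    apply/negP => /andP[/eqP ir /eqP kc]; move: h; rewrite ir kc -szr /c; clia.
  rewrite nrc => hx; case: ifP => [/andP[/eqP ir /eqP kc]|/negbT nrc'] hy; last first.
    exact: dn (old _ _ h nrc') hx hy.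
  have yqs : y = q \/ (y \in qcell Q' i.+1 k).
    move: hy; rewrite ir kc; case: (al); rewrite inE; first by move/eqP; left.
    by case/predU1P; [left | right].
  case: yqs => [->|hy']; last exact: dn (qcell_lt_size hy') hx hy'.
  rewrite ltn_neqAle (minc _ _ _ hx) andbT; apply/negP => /eqP qx; rewrite -qx in hx.
  by have := colq i k (qcell_lt_size hx) hx; rewrite kc ltnn.
Qed.

Section Extends.
Variables (P : tab) (Q : rsvt) (P' : tab) (Q' : rsvt) (m q r : nat) (al : bool).
Hypotheses (iT : inT (P, Q)) (E : extends P Q P' Q' m q r al).
Let c := (size (row Q r)).-1.

Let iP : inc P. Proof. by case/inTP: iT. Qed.
Let rQ : is_rsvt Q. Proof. by case/inTP: iT. Qed.
Let sPQ : shape P = shape Q. Proof. by case/inTP: iT. Qed.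
Let iP' : inc P'. Proof. by case: E => [[/inTP[]]]. Qed.
Let rQ' : is_rsvt Q'. Proof. by case: E => [[/inTP[]]]. Qed.
Let sPQ' : shape P' = shape Q'. Proof. by case: E => [[/inTP[]]]. Qed.
Let F : fins P' m = (P, r, al). Proof. by case: E => [[]]. Qed.
Let QE : Q = qadd Q' r q al. Proof. by case: E => [[]]. Qed.
Let ad : addable Q' r al. Proof. by case: E => [[]]. Qed.
Let m0 : 0 < m. Proof. by case: E => [_ []]. Qed.
Let minq x : x \in qentries Q' -> q <= x. Proof. by case: E => [_ [_ _ h _]]; apply: h. Qed.
Let colq i k : q \in qcell Q' i k -> k < c.
Proof. by case: E => [_ [_ _ _ h]] hq; apply: (h i); rewrite ?(qcell_lt_size hq). Qed.

Let oP : outer P r. Proof. by have [] := fins_inc iP' m0 F. Qed.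

Let rins_PP' : exists a, rins P r al P' m a.
Proof. by have [a []] := rins_fins iP' m0 F; exists a. Qed.

Let cE : c = (size (row P r)).-1.
Proof. by rewrite /c; have [-> _] := shape_row sPQ. Qed.

Let clt : c < size (row Q r).
Proof. by have [<- _] := shape_row sPQ; rewrite cE; case: oP => _; clia. Qed.

Let cell i k : qcell Q i k =
  if (i == r) && (k == c) then if al then [:: q] else q :: qcell Q' r c else qcell Q' i k.
Proof. by have := qcell_qadd q i k ad; rewrite -QE. Qed.

Let oldc : ~~ al -> cellok (qcell Q' r c).
Proof.
move=> al0; have [_ ok _ _] := (rsvtP Q').1 rQ'; apply: ok.
by have := size_row_qadd q r ad; rewrite -QE (negbTE al0) addn0 => <-.
Qed.

Let qc : q \in qcell Q r c.
Proof. by rewrite cell !eqxx; case: (al); rewrite inE eqxx. Qed.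

Lemma extends_perm : perm_eq (qentries Q) (q :: qentries Q').
Proof. by rewrite QE; apply: perm_qentries. Qed.

Lemma extends_min x : x \in qentries Q -> q <= x.
Proof. by rewrite (perm_mem extends_perm) inE => /predU1P[->|/minq]. Qed.

Lemma extends_col i k : q \in qcell Q i k -> k <= c.
Proof.
by rewrite cell; case: ifP => [/andP[_ /eqP->] _|_ /colq/ltnW].
Qed.

(** [extends] pins down every choice made by [psi_fuel]: [q] is the minimum, the other cells
    containing it lie in earlier columns, and the flag tells whether [q] is alone in its cell. *)
Lemma extends_psi n : psi_fuel n.+1 P Q = (m :: (psi_fuel n P' Q').1, q :: (psi_fuel n P' Q').2).
Proof.
have Q0 : qentries Q != [::].
  by apply/negP => /eqP h; have := perm_mem extends_perm q; rewrite h inE eqxx.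
have qE : seqmin (qentries Q) = q.
  apply/eqP; rewrite eqn_leq extends_min ?seqmin_mem // andbT; apply: seqmin_le.
  by rewrite (perm_mem extends_perm) inE eqxx.
have Rc : (r, c) \in cells_with Q q by rewrite mem_filter mem_cells /= qc clt.
have Rc0 : cells_with Q q != [::] by case: (cells_with Q q) Rc.
have rcE : rightmost (cells_with Q q) = (r, c).
  have [] := rightmostP Rc0; case: (rightmost _) => r1 c1 /=; rewrite mem_filter /= => /andP[h _].
  move=> /(_ _ Rc) /= h2; move: h; rewrite cell; case: ifP => [/andP[/eqP-> /eqP->] //|_ /colq].
  by rewrite ltnNge h2.
have alE : (qcell Q r c == [:: q]) = al.
  rewrite cell !eqxx /=; case e: al; first exact: eqxx.
  by have /and3P[h _ _] := oldc (negbT e); rewrite eqseq_cons eqxx (negbTE h).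
have dE : qdel Q r c q = Q'.
  have rn : rows_nonempty Q' by apply: tshape_nonempty; case/rsvtP: rQ'.
  have := @qaddK Q' r q al rn ad; rewrite -QE -/c; apply.
  by case: (boolP al) => // /oldc /and3P[].
have [a ri] := rins_PP'; have [a' ri'] := rev_insert_rins al iP oP.1.
have rE : rev_insert P r c al = (P', m).
  by rewrite cE; have [e1 e2 _] := rins_fun ri' ri; rewrite -e1 -e2; case: (rev_insert _ _ _ _).
rewrite /= qE rcE /=; case: (qentries Q) Q0 => // _ _ _.
move: dE; rewrite /qdel alE rE => ->; by case: (psi_fuel n P' Q').
Qed.

Lemma extends_hecke : hecke_eq (rev (word P)) (m :: rev (word P')).
Proof.
have [a ri] := rins_PP'; apply: heq_trans (word_hecke iP) _.
apply: heq_trans (rins_hecke iP oP ri) _; apply: heq_cons; exact/heq_sym/word_hecke.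
Qed.

Lemma LQ_row_le (Q1 : rsvt) S i : is_rsvt Q1 -> S \in LQ Q1 -> i.+1 < size S -> nth 0 S i.+1 <= nth 0 S i.
Proof.
move=> /rsvtP[_ ok rt _] /mapP[R /(nthP [::])[k kQ <-] ->]; rewrite size_map => iR.
rewrite !(nth_map [::]) ?(ltnW iR) //.
have /and3P[h1 _ _] := ok k i (ltnW iR); have /and3P[h2 _ _] := ok k i.+1 iR.
exact: rt iR (seqmax_mem h1) (seqmax_mem h2).
Qed.

Lemma shape_LQ (Q1 : rsvt) : shape (LQ Q1) = shape Q1.
Proof. by rewrite /shape /LQ -map_comp; apply: eq_map => R /=; rewrite size_map. Qed.

Lemma mem_col_LQ (Q1 : rsvt) k z : is_rsvt Q1 -> z \in col (LQ Q1) k ->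
  exists i, z \in qcell Q1 i k.
Proof.
move=> /rsvtP[_ ok _ _] /mem_col[S [/mapP[R /(nthP [::])[i iQ eR] ->]]]; rewrite size_map => kR <-.
exists i; rewrite (nth_map [::]) // -eR; rewrite -eR in kR.
by have /and3P[h _ _] := ok i k kR; apply: seqmax_mem.
Qed.

Lemma extends_dominates : K_dominates P Q <-> K_dominates P' Q' /\ q <= m.
Proof.
have [a ri] := rins_PP'.
rewrite (K_dominatesP iP) ?shape_LQ //; last by move=> S i; apply: LQ_row_le.
rewrite (K_dominatesP iP') ?shape_LQ //; last by move=> S i; apply: LQ_row_le.
have in1 (Q1 : rsvt) i k x : x \in qcell Q1 i k -> x \in qentries Q1.
  by move=> h; apply/mem_qentries; exists i, k; split=> //; apply: qcell_lt_size h.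
have ge1 k z : z \in col (LQ Q) k -> q <= z.
  by case/(mem_col_LQ rQ) => i /in1/extends_min.
have ge2 k z : z \in col (LQ Q') k -> q <= z.
  by case/(mem_col_LQ rQ') => i /in1/minq.
apply: (dom_step iP oP ri) => //.
- by move=> j; apply: size_col_shape; rewrite shape_LQ.
- by move=> j; apply: size_col_shape; rewrite shape_LQ.
- exact: size_col_outer.
have gt k z : c < k -> z \in col (LQ Q) k -> q < z.
  move=> ck /(mem_col_LQ rQ)[i hz]; rewrite ltn_neqAle extends_min ?(in1 _ _ _ _ hz) // andbT.
  by apply/negP => /eqP qz; rewrite -qz in hz; have := extends_col hz; rewrite leqNgt ck.
case e : al.
  rewrite -cE; have ad' : r <= size Q' by move: ad; rewrite /addable e.
  split=> // k; rewrite QE e; have := col_qadd q k ad'.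
  have := size_row_qadd q r ad; rewrite -QE e eqxx addn1 => h.
  by rewrite /c h.
have al0 : ~~ al by rewrite e.
have h1 : (size (row Q' r)).-1 = c.
  by rewrite /c; have := size_row_qadd q r ad; rewrite -QE e addn0 => ->.
rewrite QE e LQ_qadd ?h1 //.
- by move: ad; rewrite /addable e.
- by move=> x /in1/minq.
- by case/and3P: (oldc al0).
Qed.
End Extends.

(** * Induction on the number of entries of [Q] *)

Lemma inT_nil P Q : inT (P, Q) -> qentries Q = [::] -> P = [::] /\ Q = [::].
Proof.
move=> /inTP[iP rQ sPQ] Q0.
have Qn : Q = [::].
  case: Q rQ Q0 {sPQ} => // R Q rQ Q0.
  have [sh _ _ _] := (rsvtP _).1 rQ; have R0 : 0 < size (row (R :: Q) 0) by apply: sh.2.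
  have [x hx] := qcell_nil rQ R0.
  have : x \in qentries (R :: Q) by apply/mem_qentries; exists 0, 0.
  by rewrite Q0.
by split=> //; move: sPQ; rewrite Qn; case: (P).
Qed.

Lemma inT_step P Q n : inT (P, Q) -> size (qentries Q) = n.+1 ->
  exists P' Q' m q r al, extends P Q P' Q' m q r al /\ size (qentries Q') = n.
Proof.
move=> iT sn; have [|P' [Q' [m [q [r [al E]]]]]] := inT_extends iT; first by rewrite -size_eq0 sn.
exists P', Q', m, q, r, al; split=> //.
by have := perm_size (extends_perm E); rewrite sn => -[].
Qed.

(** If [q = q'], the cell of [q'] lies in an earlier column by the choice of the rightmost cell, and
    the Pieri rule turns this into [m' < m]. *)
Lemma extends_next P Q P' Q' m q r al P2 Q2 m' q' r' al' :
  inT (P, Q) -> extends P Q P' Q' m q r al -> extends P' Q' P2 Q2 m' q' r' al' ->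
  q <= q' /\ (q = q' -> m' < m).
Proof.
move=> iT E E'; have [[iT' F QE ad] [m0 q0 minq colq]] := E.
have [[iT2 F' _ _] [m'0 _ _ _]] := E'; have [iP2 _ _] := (inTP _ _).1 iT2.
have q'Q : q' \in qentries Q' by rewrite (perm_mem (extends_perm E')) inE eqxx.
split=> [|qq]; first exact: minq.
have [_ _ sPQ] := (inTP _ _).1 iT; have [_ _ sPQ'] := (inTP _ _).1 iT'.
rewrite -(fins_fins iP2 m'0 m0 F' F).
have [-> _] := shape_row sPQ; have [-> _] := shape_row sPQ'.
have [[_ _ QE' ad'] _] := E'; have := qcell_qadd q' r' (size (row Q' r')).-1 ad'.
rewrite -QE' !eqxx /= => cE; have hq : q \in qcell Q' r' (size (row Q' r')).-1.
  by rewrite cE qq; case: (al'); rewrite inE eqxx.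
exact: colq (qcell_lt_size hq) hq.
Qed.

Lemma psi_spec n P Q : inT (P, Q) -> size (qentries Q) = n ->
  [/\ size (psi_fuel n P Q).1 = n, compatible (psi_fuel n P Q),
      hecke_eq (rev (word P)) (psi_fuel n P Q).1 &
      K_dominates P Q <->
        forall j, j < size (psi_fuel n P Q).1 -> nth 0 (psi_fuel n P Q).2 j <= nth 0 (psi_fuel n P Q).1 j].
Proof.
elim: n P Q => [|n IH] P Q iT sn.
  have [-> ->] := inT_nil iT (size0nil sn); split=> //=; first exact: heq_refl.
have [P' [Q' [m [q [r [al [E sn']]]]]]] := inT_step iT sn.
have [[iT' _ _ _] [m0 q0 _ _]] := E.
have [h1 h2 h3 h4] := IH _ _ iT' sn'; rewrite (extends_psi iT E).
have nx : (0 < n -> q <= nth 0 (psi_fuel n P' Q').2 0 /\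
    (q = nth 0 (psi_fuel n P' Q').2 0 -> nth 0 (psi_fuel n P' Q').1 0 < m)).
  case: n sn' {IH sn h1 h2 h3 h4} => // n sn' _.
  have [P2 [Q2 [m' [q' [r' [al' [E' _]]]]]]] := inT_step iT' sn'.
  by rewrite (extends_psi iT' E'); apply: extends_next iT E E'.
move: h1 h2 h3 h4 nx; case: (psi_fuel n P' Q') => a i /= h1 [c1 c2 c3 c4 c5] h3 h4 nx.
split=> //.
- by rewrite h1.
- split; rewrite /= ?m0 ?q0 ?c1 //.
    case: i c1 c4 nx {c3 c5 h4} => //= x i c1 -> nx; rewrite andbT.
    by have [] := nx _; rewrite -?h1 ?c1.
  case=> [|j] //= ; last exact: c5.
  by rewrite ltnS => i0 qi; have [] := nx _; rewrite -?h1 ?c1 // => _; apply.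
- by apply: heq_trans (extends_hecke iT E) _; apply: heq_cons.
- rewrite (extends_dominates iT E) h4; split=> [[h5 h6] [|j] //= /h5 //|h5].
  by split=> [j ja|]; [apply: (h5 j.+1) | apply: (h5 0)].
Qed.

Lemma psi_inj n P Q P2 Q2 : inT (P, Q) -> inT (P2, Q2) ->
  size (qentries Q) = n -> size (qentries Q2) = n ->
  psi_fuel n P Q = psi_fuel n P2 Q2 -> P = P2 /\ Q = Q2.
Proof.
elim: n P Q P2 Q2 => [|n IH] P Q P2 Q2 iT iT2 sn sn2.
  by have [-> ->] := inT_nil iT (size0nil sn); have [-> ->] := inT_nil iT2 (size0nil sn2).
have [P' [Q' [m [q [r [al [E sn']]]]]]] := inT_step iT sn.
have [P2' [Q2' [m2 [q2 [r2 [al2 [E2 sn2']]]]]]] := inT_step iT2 sn2.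
rewrite (extends_psi iT E) (extends_psi iT2 E2) => -[mm e1 qq e2].
have [[iT' F -> _] _] := E; have [[iT2' F2 -> _] _] := E2.
have [eP eQ] : P' = P2' /\ Q' = Q2'.
  apply: IH => //; move: e1 e2; case: (psi_fuel n P' Q') (psi_fuel n P2' Q2') => [a i] [b k] /=.
  by move=> -> ->.
by move: F; rewrite eP mm F2 qq eQ => -[-> -> ->].
Qed.

Lemma psi_surj a i : compatible (a, i) -> exists P Q,
  [/\ inT (P, Q), size (qentries Q) = size a & psi_fuel (size a) P Q = (a, i)].
Proof.
elim: a i => [|m a IH] [|q i] [] //=.
  by move=> *; exists [::], [::].
move=> [si] /andP[m0 pa] /andP[q0 pi] st adj.
have [|P' [Q' [iT' sz e]]] := IH i.
  by split=> //; [apply: path_sorted st | move=> j; apply: (adj j.+1)].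
case F : (fins P' m) => [[P r] al].
have [iP' _ sPQ'] := (inTP _ _).1 iT'.
have [iP oP] := fins_inc iP' m0 F.
(* The Pieri rule is used backwards: equal indices force [m' < m], so the new cell is right of all
   cells containing [q]. *)
have [h1 h2] : (forall x, x \in qentries Q' -> q <= x) /\
    (forall k j, j < size (row Q' k) -> q \in qcell Q' k j -> j < (size (row P r)).-1).
  case: a i si {IH} adj st sz e {pa pi} => [|m' a] [|q' i] //= si adj st sz e.
    have [_ ->] := inT_nil iT' (size0nil sz); split=> // k j; by rewrite /row nth_nil.
  have [P2 [Q2 [m'' [q'' [r' [al' [E' _]]]]]]] := inT_step iT' sz.
  have := e : psi_fuel (size a).+1 P' Q' = (m' :: a, q' :: i); rewrite (extends_psi iT' E').
  move=> -[m'E _ q'E _]; case/andP: st => qq' _.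
  have minQ x : x \in qentries Q' -> q <= x.
    by move=> /(extends_min E'); rewrite q'E; apply: leq_trans.
  split=> // k j jk hq; have qE : q = q'.
    apply/eqP; rewrite eqn_leq qq' -q'E; apply: (extends_min E').
    by apply/mem_qentries; exists k, j.
  have m'm : m' < m by have := adj 0 isT qE.
  have [[iT2 F' _ _] [m''0 _ _ _]] := E'; have [iP2 _ _] := (inTP _ _).1 iT2.
  rewrite -m'E -(fins_fins iP2 m''0 m0 F' F) in m'm.
  apply: leq_ltn_trans m'm; have [-> _] := shape_row sPQ'.
  by apply: (extends_col E'); rewrite q'E -qE; apply: hq.
have [iT E] := extends_inT iT' m0 q0 F h1 h2.
exists P, (qadd Q' r q al); split=> //; last by have := extends_psi iT E (size a); rewrite e.
by rewrite (perm_size (extends_perm E)) /= sz.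
Qed.

Lemma Psi_bij : bij_on inTb inCb Psi.
Proof.
split.
- move=> [P Q] [iT D]; have [_ h1 _ h2] := psi_spec iT erefl.
  rewrite /Psi /=; split=> //; exact/h2.
- move=> [P Q] [P2 Q2] [iT _] [iT2 _]; rewrite /Psi /= => e.
  have [s1 _ _ _] := psi_spec iT erefl; have [s2 _ _ _] := psi_spec iT2 erefl.
  have s : size (qentries Q2) = size (qentries Q) by rewrite -s2 -e s1.
  by have [-> ->] := psi_inj iT iT2 erefl s (etrans e (congr1 (fun n => psi_fuel n P2 Q2) s)).
- move=> [a i] [C B]; have [P [Q [iT s e]]] := psi_surj C; exists (P, Q); last by rewrite /Psi /= s.
  split=> //; have [_ _ _ [_ h]] := psi_spec iT s; apply: h; rewrite e; exact: B.
Qed.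

Lemma Psi_hecke t w : inT t -> hecke_class (rev (word t.1)) w <-> hecke_class (Psi t).1 w.
Proof.
case: t => P Q iT; have [_ _ h _] := psi_spec iT erefl; rewrite /Psi /=.
split=> -[u [hu1 hu2]]; exists u; split=> //; apply: heq_trans hu2; [exact: heq_sym|exact: h].
Qed.

Theorem theorem3p1 :
  bij_on inTb inCb Psi /\
  (forall w : nat -> nat, in_Splus w -> bij_on (inTbw w) (inCbw w) Psi).
Proof.
have [h1 h2 h3] := Psi_bij; split=> [//|w _]; split.
- by move=> t [tb tw]; split; [apply: h1 | apply/Psi_hecke; first by case: tb].
- by move=> x y [xb _] [yb _]; apply: h2.
- move=> b [bb bw]; have [t tb e] := h3 b bb; exists t => //; split=> //.
  by apply/Psi_hecke; [case: tb | rewrite e].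
Qed.
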